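(* Let $X$ be a locally compact CAT(0) cube complex and $\Gamma$ be a discrete group acting cocompactly on $X$. If $X$ is a product of $n$ unbounded cube subcomplexes, then $\Gamma$ contains a subgroup isomorphic to $\mathbf{Z}^n$.
   Context: A CAT(0) cube complex is a simply connected cell complex all of whose cells are Euclidean cubes with edge length one and such that the link of each vertex is a flag complex; it is endowed with the induced length metric, which is CAT(0). A product of cube complexes carries the product cubical structure and the $\ell^2$-product metric.
   Formalization: The action of the discrete group is assumed to be proper (only finitely many group elements move a compact set to meet itself). Without this the claim fails: a free group mapping onto F_2 x F_2 acts cocompactly on a product of two trees but contains no Z^2. *)

(* Defs.v *)
From HB Require Import structures.
From mathcomp Require Import all_boot all_order all_algebra.
From mathcomp Require Import all_classical all_reals all_analysis.
Import numFieldNormedType.Exports.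
Import Order.TTheory GRing.Theory Num.Theory.

Set Implicit Arguments.
Unset Strict Implicit.
Unset Printing Implicit Defensive.

Local Open Scope classical_set_scope.
Local Open Scope ring_scope.

Section Cubes.
Context {R : realType}.

Definition unit_cube (S : finType) : set (S -> R) :=
  [set x | forall a, 0 <= x a <= 1].

Definition open_cube (S : finType) : set (S -> R) :=
  [set x | forall a, 0 < x a < 1].

(* The coordinates in the domain of the partial assignment phi are frozen. *)
Definition cube_face (S : finType) (phi : S -> option bool) : set (S -> R) :=
  [set x | unit_cube x /\ forall a b, phi a = Some b -> x a = b%:R].

Definition edist (S : finType) (x y : S -> R) : R :=
  Num.sqrt (\sum_a (x a - y a) ^+ 2).

Definition isometry_onto (S T : finType) (A : set (S -> R)) (B : set (T -> R))
    (h : (S -> R) -> (T -> R)) :=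
  (forall x y, A x -> A y -> edist (h x) (h y) = edist x y) /\ h @` A = B.

End Cubes.
Arguments unit_cube : clear implicits.
Arguments open_cube : clear implicits.

(* A complex of Euclidean unit cubes: every cell c has a characteristic map
   [chart c] from the cube [0,1]^(coord c) (its values outside the unit cube
   are irrelevant).  The open cells partition the space, and the restriction of
   a characteristic map to a face is, up to an isometry of cubes, the
   characteristic map of a cell.  The faces of one cube may be identified with
   each other, and two cubes may meet in several faces. *)
Record cubeComplex (R : realType) := CubeComplex {
  point : Type;
  cell : Type;
  coord : cell -> finType;
  chart : forall c, (coord c -> R) -> point;
  open_cell_cover : forall p, exists c (x : coord c -> R),
    open_cube R (coord c) x /\ chart x = p;
  open_cell_inj : forall c c' (x : coord c -> R) (x' : coord c' -> R),
    open_cube R (coord c) x -> open_cube R (coord c') x' ->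
    chart x = chart x' ->
    existT (fun c => coord c -> R) c x = existT (fun c => coord c -> R) c' x';
  face_cell : forall c (phi : coord c -> option bool),
    exists c' (h : (coord c' -> R) -> (coord c -> R)),
      isometry_onto (unit_cube R (coord c')) (cube_face phi) h /\
      forall x, unit_cube R (coord c') x -> chart x = chart (h x)
}.
Arguments chart {R} _ _ _.

Definition space (R : realType) (X : cubeComplex R) : Type := point X.
Coercion space : cubeComplex >-> Sortclass.

HB.instance Definition _ (R : realType) (X : cubeComplex R) :=
  gen_eqMixin (space X).
HB.instance Definition _ (R : realType) (X : cubeComplex R) :=
  gen_choiceMixin (space X).

Section LengthMetric.
Context {R : realType} (X : cubeComplex R).
Implicit Types (x y z : X) (l e : R).

Definition segment_length x y l := exists c (a b : coord c -> R),
  [/\ unit_cube R (coord c) a, unit_cube R (coord c) b,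
      chart X c a = x, chart X c b = y & l = edist a b].

Inductive string_length : X -> X -> R -> Prop :=
| string_nil x : string_length x x 0
| string_cons x y z l m : segment_length x y l -> string_length y z m ->
    string_length x z (l + m).

(* The induced length metric: the infimum of the lengths of the piecewise
   linear paths from x to y, hence +oo when there is no such path. *)
Definition length_dist x y : \bar R :=
  ereal_inf [set l%:E | l in string_length x y].

Definition length_ball x e y := (length_dist x y < e%:E)%E.

Lemma length_ballP x e y :
  length_ball x e y <-> exists2 l, string_length x y l & l < e.
Proof.
split=> [/ereal_inf_lt[_ [l xyl <-]]|[l xyl le]]; first by exists l.
apply: (@le_lt_trans _ _ l%:E); last by rewrite lte_fin.
by apply: ereal_inf_lbound; exists l.
Qed.

Lemma string_cat x y z l m :
  string_length x y l -> string_length y z m -> string_length x z (l + m).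
Proof.
move=> xyl; elim: xyl m => [x' m|x' y' z' l1 l2 s _ IH m yz]; first by rewrite add0r.
by rewrite -addrA; apply: string_cons s _; exact: IH.
Qed.

Lemma string_sym x y l : string_length x y l -> string_length y x l.
Proof.
elim=> [x'|x' y' z' l1 l2 [c [a [b [ha hb ax bx ->]]]] _ IH].
  exact: string_nil.
rewrite addrC; apply: string_cat IH _; rewrite -[edist a b]addr0.
apply: string_cons (string_nil _); exists c, b, a; split=> //.
by congr Num.sqrt; apply: eq_bigr => i _; rewrite -sqrrN opprB.
Qed.

Lemma length_ball_center x e : 0 < e -> length_ball x e x.
Proof. by move=> e0; apply/length_ballP; exists 0 => //; exact: string_nil. Qed.

Lemma length_ball_sym x y e : length_ball x e y -> length_ball y e x.
Proof.
by move=> /length_ballP[l /string_sym yxl le]; apply/length_ballP; exists l.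
Qed.

Lemma length_ball_triangle x y z e1 e2 :
  length_ball x e1 y -> length_ball y e2 z -> length_ball x (e1 + e2) z.
Proof.
move=> /length_ballP[l xyl le1] /length_ballP[m yzm me2].
by apply/length_ballP; exists (l + m); [exact: string_cat yzm|exact: ltrD].
Qed.

HB.instance Definition _ :=
  hasNbhs.Build (space X) (nbhs_ (entourage_ length_ball)).
HB.instance Definition _ := @Nbhs_isPseudoMetric.Build R (space X)
  (entourage_ length_ball) erefl length_ball
  length_ball_center length_ball_sym length_ball_triangle erefl.

End LengthMetric.

Definition unbounded (R : realType) (X : cubeComplex R) :=
  forall M : R, exists x y : X, (M%:E < length_dist x y)%E.

Definition simply_connected (R : realType) (T : topologicalType) :=
  [/\ [set: T] !=set0,
      forall x y : T, exists gamma : R -> T,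
        [/\ {within `[0, 1], continuous gamma}, gamma 0 = x & gamma 1 = y] &
      forall gamma : R -> T,
        {within `[0, 1], continuous gamma} -> gamma 0 = gamma 1 ->
        exists H : R * R -> T,
          {within `[0, 1] `*` `[0, 1], continuous H} /\
          forall t : R, 0 <= t <= 1 ->
            [/\ H (0, t) = gamma t, H (1, t) = gamma 0,
                H (t, 0) = gamma 0 & H (t, 1) = gamma 0]].

Section Links.
Context {R : realType} (X : cubeComplex R).

(* A cell together with a vertex of its cube.  The d-dimensional cells with a
   corner at v are the (d-1)-simplices of the link of v; in particular the
   corners of edges are the vertices of the links. *)
Record corner := Corner {
  corner_cell : cell X;
  corner_vtx : coord corner_cell -> bool
}.
Arguments corner_vtx : clear implicits.

Definition corner_dim (k : corner) := #|coord (corner_cell k)|.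

Definition corner_at (v : X) : set corner :=
  [set k | chart X (corner_cell k) (fun a => (corner_vtx k a)%:R) = v].

(* e is the edge issuing from the corner k in the direction a *)
Definition corner_edge (k : corner) (a : coord (corner_cell k)) (e : corner) :=
  corner_dim e = 1%N /\ forall t : R, 0 <= t <= 1 ->
    chart X (corner_cell k) (fun b => if b == a then `|(corner_vtx k b)%:R - t|
                              else (corner_vtx k b)%:R) =
    chart X (corner_cell e) (fun b => `|(corner_vtx e b)%:R - t|).

Definition corner_edges (k : corner) : set corner :=
  [set e | exists a, @corner_edge k a e].

Definition link_vertices (v : X) : set corner :=
  [set e | corner_at v e /\ corner_dim e = 1%N].

Definition link_simplices (v : X) : set corner :=
  [set k | corner_at v k /\ (0 < corner_dim k)%N].

Definition link (v : X) : set (set corner) :=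
  corner_edges @` link_simplices v.

(* The simplices of the link are determined by their vertices, which are
   pairwise distinct. *)
Definition simplicial_link (v : X) :=
  (forall k a b e, corner_at v k ->
     @corner_edge k a e -> @corner_edge k b e -> a = b) /\
  {in link_simplices v &, injective corner_edges}.

Definition is_vertex (v : X) := exists k, corner_at v k.

End Links.

(* V: vertex set of an abstract simplicial complex, F: its set of simplices *)
Definition is_flag (T : Type) (V : set T) (F : set (set T)) :=
  forall S : set T, finite_set S -> S !=set0 -> S `<=` V ->
    (forall x y, S x -> S y -> x <> y -> F [set x; y]) -> F S.

Definition CAT0_cube_complex (R : realType) (X : cubeComplex R) :=
  simply_connected R X /\
  forall v : X, is_vertex v ->
    simplicial_link v /\ is_flag (link_vertices v) (link v).

Definition cubical_iso (R : realType) (X Y : cubeComplex R) (f : X -> Y) :=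
  bijective f /\
  forall c : cell X, exists (c' : cell Y) (h : (coord c -> R) -> (coord c' -> R)),
    isometry_onto (unit_cube R (coord c)) (unit_cube R (coord c')) h /\
    forall x, unit_cube R (coord c) x -> f (chart X c x) = chart Y c' (h x).

Section Product.
Context {R : realType} (I : finType) (Y : I -> cubeComplex R).

Definition product_cell := forall i, cell (Y i).

Definition product_coord (c : product_cell) : finType := {i : I & coord (c i)}.

Definition slice (c : product_cell) (x : product_coord c -> R) (i : I) :
    coord (c i) -> R :=
  fun a => x (Tagged (fun i => coord (c i)) a).
Arguments slice {c} x i _.

Definition product_chart (c : product_cell) (x : product_coord c -> R) :
    forall i, Y i :=
  fun i => chart (Y i) (c i) (slice x i).

Let glue (c : product_cell) (y : forall i, coord (c i) -> R) :
    product_coord c -> R :=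
  fun t => y (tag t) (tagged t).

Lemma product_cover p : exists c (x : product_coord c -> R),
  open_cube R (product_coord c) x /\ product_chart x = p.
Proof.
have H i := open_cell_cover (p i).
pose c i := projT1 (cid (H i)); pose y i := projT1 (cid (projT2 (cid (H i)))).
have Hy i := projT2 (cid (projT2 (cid (H i)))).
exists c, (@glue c y); split; first by case=> i a; case: (Hy i) => + _; exact.
by apply/functional_extensionality_dep => i; case: (Hy i).
Qed.

Lemma product_inj c c' (x : product_coord c -> R) (x' : product_coord c' -> R) :
  open_cube R (product_coord c) x -> open_cube R (product_coord c') x' ->
  product_chart x = product_chart x' ->
  existT (fun c => product_coord c -> R) c x = existT (fun c => product_coord c -> R) c' x'.
Proof.
move=> hx hx' E.
have H i : existT (fun c => coord c -> R) (c i) (slice x i) =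
           existT (fun c => coord c -> R) (c' i) (slice x' i).
  apply: open_cell_inj; [by move=> a; exact: hx|by move=> a; exact: hx'|].
  exact: (congr1 (fun f => f i) E).
have Ec : c = c'.
  by apply/functional_extensionality_dep => i; exact: (congr1 (@projT1 _ _) (H i)).
move: Ec x' hx' E H => <- x' _ _ H; congr existT; apply/funext => -[i a].
move: (H i) => Hi.
have := projT2_eq Hi; rewrite (Prop_irrelevance (projT1_eq Hi) erefl)/=.
by move=> /(congr1 (fun f => f a)).
Qed.

Lemma edist_sig (c c' : product_cell) (x y : product_coord c -> R) (x' y' : product_coord c' -> R) :
  (forall i, edist (slice x i) (slice y i) = edist (slice x' i) (slice y' i)) ->
  edist x y = edist x' y'.
Proof.
move=> H; rewrite /edist; congr Num.sqrt.
have E (d : product_cell) (u v : product_coord d -> R) : \sum_t (u t - v t) ^+ 2 =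
    \sum_i edist (slice u i) (slice v i) ^+ 2.
  transitivity (\sum_i \sum_(a : coord (d i)) (slice u i a - slice v i a) ^+ 2).
    rewrite (sig_big_dep _ _ (fun i a => (slice u i a - slice v i a) ^+ 2))/=.
    by apply: eq_bigr => -[].
  apply: eq_bigr => i _; rewrite sqr_sqrtr//.
  by apply: sumr_ge0 => a _; exact: sqr_ge0.
by rewrite !E; apply: eq_bigr => i _; rewrite H.
Qed.

Lemma product_face c (phi : product_coord c -> option bool) :
  exists c' (h : (product_coord c' -> R) -> (product_coord c -> R)),
    isometry_onto (unit_cube R (product_coord c')) (cube_face phi) h /\
    forall x, unit_cube R (product_coord c') x -> product_chart x = product_chart (h x).
Proof.
pose phi_ i (a : coord (c i)) := phi (Tagged (fun i => coord (c i)) a).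
have H i := @face_cell _ _ (c i) (@phi_ i).
pose c' i := projT1 (cid (H i)); pose k i := projT1 (cid (projT2 (cid (H i)))).
have Hk i : isometry_onto (unit_cube R (coord (c' i))) (cube_face (@phi_ i)) (k i) /\
    forall x, unit_cube R (coord (c' i)) x -> chart (Y i) (c' i) x = chart (Y i) (c i) (k i x).
  exact: projT2 (cid (projT2 (cid (H i)))).
pose h (x : product_coord c' -> R) := @glue c (fun i => k i (slice x i)).
have sl x i : unit_cube R (product_coord c') x -> unit_cube R (coord (c' i)) (slice x i).
  by move=> hx a; exact: hx.
exists c', h; split; last first.
  move=> x hx; apply/functional_extensionality_dep => i.
  by case: (Hk i) => _; apply; exact: sl.
split.
  move=> x y hx hy; apply: edist_sig => i.
  exact: (Hk i).1.1 (sl _ i hx) (sl _ i hy).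
apply/seteqP; split=> [_ [x hx <-]|z [hz hphi]].
  have F i : cube_face (@phi_ i) (k i (slice x i)).
    by case: (Hk i) => -[_ <-] _; exists (slice x i) => //; exact: sl.
  split=> [[i a]|[i a] b e]; first exact: (F i).1.
  exact: (F i).2 e.
have F i : exists y, unit_cube R (coord (c' i)) y /\ k i y = slice z i.
  have : cube_face (@phi_ i) (slice z i).
    split=> [a|a b e]; first exact: hz.
    exact: (hphi (Tagged (fun i => coord (c i)) a) b e).
  by case: (Hk i) => -[_ <-] _ [y ? ?]; exists y.
exists (@glue c' (fun i => projT1 (cid (F i)))).
  by case=> i a; exact: (projT2 (cid (F i))).1.
apply/funext => -[i a].
exact: (congr1 (fun f => f a) (projT2 (cid (F i))).2).
Qed.

(* The cells are the products of cells; the coordinate set of a product of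
   cubes is the disjoint union of the coordinate sets of the factors, so that
   each cell carries the l^2-product metric of its factors, and the length
   metric is the l^2-product of the length metrics of the factors. *)
Definition cube_product : cubeComplex R :=
  CubeComplex product_cover product_inj product_face.

End Product.

Section Actions.
Context {R : realType} (G : groupType) (X : cubeComplex R) (act : G -> X -> X).

Definition cubical_action :=
  [/\ forall x, act 1%g x = x,
      forall g h x, act (g * h)%g x = act g (act h x) &
      forall g, cubical_iso (act g)].

(* A discrete group is understood to act properly: without properness,
   a free group acts cocompactly on a product of two trees through a surjection
   onto a cocompact lattice. *)
Definition proper_action := forall K : set X, compact K ->
  finite_set [set g | (act g @` K) `&` K !=set0].

Definition cocompact_action := exists2 K : set X, compact K &
  \bigcup_(g in [set: G]) (act g @` K) = [set: X].

End Actions.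

Definition has_subgroup_isomorphic_to_Zn (G : groupType) (n : nat) :=
  exists (H : groupClosed G) (f : 'rV[int]_n -> G),
    {morph f : u v / u + v >-> (u * v)%g} /\
    set_bij [set: 'rV[int]_n] [set` H] f.

(* Main.v *)
(* The proof is combinatorial and takes place in the 1-skeleton of X.  Edge paths are
   considered up to flips across squares and cancellation of backtracks.  As soon as
   three squares pairwise adjacent at a vertex span a cube, two reduced edge paths
   which are homotopic differ by flips only, and whether e can be appended to a
   reduced path p depends only on e and on the set of possible last edges of p.  The
   simple connectedness of X, transported to edge paths by means of the length
   metric, makes any two edge paths with the same ends homotopic.

   The edges of a product are distributed into n types, and edges of different types
   always span squares; a symmetry respecting the types at one vertex respects them
   everywhere.  By unboundedness some reduced path has many edges of each type, and
   it can be arranged into blocks having one edge of each type.  Cocompactness and the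
   pigeonhole principle provide a type-preserving g in Gamma mapping the final vertex
   and the last edges of one union of blocks to those of a longer one.  The translates
   by powers of g of the path in between then concatenate to reduced paths, so that g
   acts on the orbit of a vertex p with no period in any factor.

   The points whose i-th coordinate is that of a power of g applied to p, for all i,
   form a grid Z^n.  Moving along the i-th direction of the grid does not change the
   displacement of g; by properness and the pigeonhole principle there is c_i in Gamma
   which commutes with g and maps one point of the i-th axis of the grid to another.
   Then c_i translates the whole grid.  As stabilizers are finite, suitable powers of
   c_1, ..., c_n commute, and they generate Z^n. *)

From HB Require Import structures.
Require Import Defs.
From mathcomp Require Import all_boot all_order all_algebra.
From mathcomp Require Import all_classical all_reals all_analysis.
From mathcomp Require Import zify lra ring.
Require Import Defs.
Import numFieldNormedType.Exports.
Import Order.TTheory GRing.Theory Num.Theory.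

Set Implicit Arguments.
Unset Strict Implicit.
Unset Printing Implicit Defensive.

Local Open Scope classical_set_scope.
Local Open Scope ring_scope.

(** * Words of edges up to squares *)

(** The action of $\Gamma$ need not split: an element may mix the factors, no subgroup of finite
    index need be a product, and the images of $\Gamma$ in the factors need not be discrete. So
    translations of the single factors cannot be looked for in each factor separately. Instead one
    $g$ is sought that moves in all factors at once, which is why every block has one edge of each
    type. The other translations are found in the centralizer of $g$: by properness it has finitely
    many orbits on the vertices that $g$ displaces by at most a given amount, and the whole grid
    consists of such vertices. Words up to flips behave like those of a partially commutative
    monoid, as in the word problem of right-angled Coxeter groups. The sets of last edges make
    reduced paths the language of an automaton that is finite modulo $\Gamma$; a repeated state is a
    loop, which can be run through any number of times. Counting the edges of one type replaces
    hyperplanes and axes: among the paths with given ends, a reduced one has the fewest edges of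
    each type. *)

(* Edge paths are words read from right to left: the head is the last edge.
   [square e f' f e'] stands for a square with the two boundary paths e, f' and
   f, e' between opposite corners. *)
Section FlipWords.
Variables (D : Type) (rev : D -> D) (square : D -> D -> D -> D -> Prop).
Implicit Types (e f g h : D) (p q r s : seq D).

Inductive flips : seq D -> seq D -> Prop :=
| flips_refl p : flips p p
| flips_trans p q r : flips p q -> flips q r -> flips p r
| flips_swap e f' f e' p :
    square e f' f e' -> flips [:: f', e & p] [:: e', f & p]
| flips_cons e p q : flips p q -> flips (e :: p) (e :: q).

Inductive homotopic : seq D -> seq D -> Prop :=
| homotopic_refl p : homotopic p p
| homotopic_sym p q : homotopic p q -> homotopic q p
| homotopic_trans p q r : homotopic p q -> homotopic q r -> homotopic p r
| homotopic_swap e f' f e' p :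
    square e f' f e' -> homotopic [:: f', e & p] [:: e', f & p]
| homotopic_cancel e p : homotopic [:: rev e, e & p] p
| homotopic_cons e p q : homotopic p q -> homotopic (e :: p) (e :: q).

Definition last_edges p : set D := [set e | exists q, flips p (e :: q)].

Fixpoint reduced p :=
  if p is e :: q then reduced q /\ ~ last_edges q (rev e) else True.

(** A relation, because words matter only up to [flips]. The second case is cancellation: some
    arrangement of [q] ends with [rev e], and [e] removes it. *)
Definition append e q q' :=
  (~ last_edges q (rev e) /\ flips q' (e :: q)) \/ flips q (rev e :: q').

Fixpoint normal_form p q :=
  if p is e :: p' then exists2 q0, normal_form p' q0 & append e q0 q
  else flips q [::].

Lemma homotopic_cat p p' q q' :
  homotopic p p' -> homotopic q q' -> homotopic (p ++ q) (p' ++ q').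
Proof.
move=> pp' qq'; apply: (@homotopic_trans _ (p ++ q')).
  by elim: p {pp'} => //= e p IH; exact: homotopic_cons.
elim: pp' => //=.
- by move=> *; exact: homotopic_refl.
- by move=> *; exact: homotopic_sym.
- by move=> *; apply: homotopic_trans; eauto.
- by move=> *; exact: homotopic_swap.
- by move=> *; exact: homotopic_cancel.
- by move=> *; exact: homotopic_cons.
Qed.

Lemma flips_size p q : flips p q -> size p = size q.
Proof. by elim=> //= [p' q' r _ -> _ ->|_ p' q' _ ->]. Qed.

Lemma flips_nil p : flips p [::] -> p = [::].
Proof. by move=> /flips_size/size0nil. Qed.

Hypothesis revK : involutive rev.
Hypothesis square_sym : forall e f' f e', square e f' f e' -> square f e' e f'.
Hypothesis square_rot : forall e f' f e',
  square e f' f e' -> square (rev e) f f' (rev e').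
Hypothesis square_det : forall e f' f e' f'' e'',
  square e f' f e' -> square e f'' f e'' -> f' = f''.
Hypothesis square_neq : forall e f' f e', square e f' f e' -> e <> f.
(** The three squares share the end of the path [d], [b]; the squares obtained are the other faces
    of a cube and meet at the opposite corner. *)
Hypothesis square_cube : forall d b d' b' a e g c h,
  square d b d' b' -> square a e b g -> square b' g c h ->
  exists k m m', [/\ square d a k m, square d' c k m' & square m e m' h].

Lemma flips_sym p q : flips p q -> flips q p.
Proof.
elim=> {p q}.
- exact: flips_refl.
- by move=> p q r _ qp _ rq; exact: flips_trans rq qp.
- by move=> *; apply: flips_swap; exact: square_sym.
- by move=> *; exact: flips_cons.
Qed.

Lemma square_rev e f' f e' :
  square e f' f e' -> square (rev f') (rev e) (rev e') (rev f).
Proof. by move=> /square_rot/square_sym/square_rot. Qed.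

Lemma square_path_det e f' f e' g h :
  square e f' f e' -> square e f' g h -> f = g /\ e' = h.
Proof.
move=> s1 s2; have fg := square_det (square_rot s1) (square_rot s2).
split=> //; subst g.
exact: (square_det (square_sym s1) (square_sym s2)).
Qed.

(** The alternative of Levi's lemma for partially commutative monoids: the last letters agree, or a
    square exchanges them and the words share the rest. *)
Definition levi p e q g :=
  (e = g /\ flips p q) \/
  (exists r a b, [/\ square a e b g, flips p (a :: r) & flips q (b :: r)]).

(** Induction on the derivation inside an induction on the length. The delicate case is transitivity
    through a word whose last letter is exchanged on both sides: the two arrangements [b :: r] and
    [b' :: r'] of its tail are equivalent and shorter, so the outer hypothesis applies, and
    [square_cube] combines the exchanges. *)
Lemma flipsP p e q g : flips (e :: p) (g :: q) -> levi p e q g.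
Proof.
have [k] := ubnP (size p); elim: k => // k IHk in p e q g *.
rewrite ltnS => kp epq.
have {kp} kp : (size (e :: p) <= k.+1)%N by [].
suff: forall u v, flips u v -> (size u <= k.+1)%N -> forall p e q g,
  u = e :: p -> v = g :: q -> levi p e q g by move/(_ _ _ epq kp); exact.
move=> u v {p e q g epq kp}; elim=> {u v}.
- by move=> u _ p e q g -> [-> ->]; left; split=> //; exact: flips_refl.
- move=> u v w uv IH1 vw IH2 ku p e q g Eu Ew.
  have sv := flips_size uv.
  case: v => [|x s] in uv vw IH1 IH2 sv *; first by rewrite Eu in sv.
  have {IH1} H1 := IH1 ku _ _ _ _ Eu erefl.
  have {IH2}H2 : levi s x q g by apply: IH2; rewrite // -sv.
  case: H1 => [[Ex ps]|[r [a [b [sab pr sr]]]]].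
    subst x; case: H2 => [[-> sq]|[r [a [b [sab sr qr]]]]].
      by left; split=> //; exact: flips_trans sq.
    by right; exists r, a, b; split=> //; exact: flips_trans sr.
  case: H2 => [[Ex sq]|[r' [b' [c [sbc sr' qr']]]]].
    subst x; right; exists r, a, b; split=> //.
    by apply: flips_trans sr; exact: flips_sym.
  have brr : flips (b :: r) (b' :: r').
    by apply: flips_trans sr'; exact: flips_sym.
  case: (IHk r b r' b' _ brr).
    have /= := flips_size sr; rewrite Eu in ku sv.
    by move: ku sv => /=; lia.
  + move=> [Eb rr]; subst b'.
    have [Ea Ee] := square_path_det (square_sym sab) sbc; subst c g.
    left; split=> //; apply: flips_trans pr _; apply: flips_sym.
    apply: flips_trans qr' _; apply: flips_cons; exact: flips_sym.
  + move=> [t [d [d' [sd rt rt']]]].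
    have [l [m [m' [s1 s2 s3]]]] := square_cube sd sab sbc.
    right; exists (l :: t), m, m'; split=> //.
      apply: flips_trans pr _; apply: flips_trans (flips_cons _ rt) _.
      exact: flips_swap.
    apply: flips_trans qr' _; apply: flips_trans (flips_cons _ rt') _.
    exact: flips_swap.
- move=> e f' f e' p sef _ p' g q h [<- <-] [<- <-].
  by right; exists p, e, f; split=> //; exact: flips_refl.
- by move=> e p q pq _ _ p' e' q' g [<- <-] [<- <-]; left.
Qed.


Lemma flips_consI e p q : flips (e :: p) (e :: q) -> flips p q.
Proof.
case/flipsP => [[]//|[r [a [b [/square_rev s _ _]]]]].
by have := square_neq s.
Qed.

Lemma flips_last p q : flips p q -> last_edges p = last_edges q.
Proof.
move=> pq; apply/seteqP; split=> e [r er]; exists r; apply: flips_trans er => //.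
exact: flips_sym.
Qed.

(** A cancellation available after exchanging the last two edges is carried across the square to one
    available before. The recursion passes through the common remainder [r] of [flipsP], hence the
    induction on the length. *)
Lemma flips_reduced p q : flips p q -> reduced p -> reduced q.
Proof.
have [k] := ubnP (size p); elim: k => // k IHk in p q *; rewrite ltnS.
case: p => [|e p] kp pq.
  by move: pq => /flips_sym/flips_nil ->.
case: q pq => // g q pq /= [rp ep].
case: (flipsP pq) => [[<- pq']|[r [a [b [sab pr qr]]]]].
  by split; [exact: IHk rp|rewrite -(flips_last pq')].
have [rr ar] : reduced (a :: r) by exact: IHk rp.
have rbr : reduced (b :: r).
  split=> // -[r' rr']; apply: ep; exists (g :: r').
  apply: flips_trans pr _; apply: flips_trans (flips_cons _ rr') _.
  have sc := square_rot (square_sym sab).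
  exact: flips_swap sc.
have sz := flips_size pr; have sz2 := flips_size qr; have sz3 := flips_size pq.
split.
  apply: (IHk (b :: r)) => //; last exact: flips_sym.
  by move: kp sz sz2 sz3 => /=; lia.
rewrite (flips_last qr) => -[s' rs'].
have [[bg _]|[t [x [y [sxy rt st]]]]] := flipsP rs'.
  have := square_neq (square_rot (square_sym sab)).
  by rewrite bg revK.
have s1 : square (rev b) a g (rev e) by exact: square_rot (square_sym sab).
have s2 : square (rev b) (rev x) g (rev y) by have := square_rev sxy; rewrite revK.
apply: ar; exists t; rewrite (square_det s1 s2) revK.
exact: flips_trans rt (flips_refl _).
Qed.

Lemma append_ex e q : reduced q -> exists2 q', append e q q' & reduced q'.
Proof.
move=> rq; have [[q' qq']|ne] := pselect (last_edges q (rev e)).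
  by exists q'; [right|have [] := flips_reduced qq' rq].
by exists (e :: q); [left; split=> //; exact: flips_refl|].
Qed.

Lemma append_reduced e q q' : reduced q -> append e q q' -> reduced q'.
Proof.
move=> rq [[ne /flips_sym qq']|qq']; first exact: flips_reduced qq' _.
by have [] := flips_reduced qq' rq.
Qed.

Lemma append_flips e q1 q2 q1' q2' : flips q1 q2 -> append e q1 q1' ->
  append e q2 q2' -> flips q1' q2'.
Proof.
move=> q12 [[n1 f1]|f1] [[n2 f2]|f2].
- apply: flips_trans f1 _; apply: flips_sym; apply: flips_trans f2 _.
  by apply: flips_cons; exact: flips_sym.
- by exfalso; apply: n1; rewrite (flips_last q12); exists q2'.
- by exfalso; apply: n2; rewrite -(flips_last q12); exists q1'.
- apply: (@flips_consI (rev e)); apply: flips_trans f2.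
  by apply: flips_trans q12; exact: flips_sym.
Qed.

Lemma append_flipsr e q q1 q2 : flips q1 q2 -> append e q q1 -> append e q q2.
Proof.
move=> q12 [[n1 f1]|f1]; [left; split=> //|right].
  by apply: flips_trans f1; exact: flips_sym.
by apply: flips_trans f1 _; exact: flips_cons.
Qed.

Lemma append_cancel e q q' : reduced q -> append e q q' -> append (rev e) q' q.
Proof.
move=> rq [[ne qq']|qq']; first by right; rewrite revK.
left; rewrite revK; split=> // -[r q'r].
have [_] := flips_reduced qq' rq.
by rewrite revK; apply; exists r.
Qed.

(* The cases of the proof say whether appending e (resp. f) to q cancels. *)
Lemma append_square e f' f e' q q1 q2 : reduced q -> square e f' f e' ->
  append e q q1 -> append f' q1 q2 -> exists2 q3, append f q q3 & append e' q3 q2.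
Proof.
move=> rq s aq1 aq2.
have [q3 aq3 rq3] := append_ex f rq; have [q4 aq4 rq4] := append_ex e' rq3.
exists q3 => //; apply: append_flipsr (aq4); apply: flips_sym.
have ss := square_sym s.
(* A cancellation of [b'] after [a] would be carried across the square to one of the opposite side
   [b] in [p]. *)
have new a a' b b' p p1 : square a b' b a' -> ~ last_edges p (rev b) ->
    flips p1 (a :: p) -> ~ last_edges p1 (rev b').
  move=> sab nb pp1; rewrite (flips_last pp1) => -[p' /flipsP].
  have sb := square_rot sab.
  case=> [[ab _]|[r [x [y [sxy pr _]]]]].
    by have := square_neq sb; rewrite ab revK.
  apply: nb; exists r.
  have := square_rev sxy; rewrite revK => sx.
  by rewrite (square_det sb sx) revK.
(* e cancels in q, f does not *)
have half a a' b b' p p1 p2 p3 p4 : reduced p -> square a b' b a' ->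
    flips p (rev a :: p1) -> append b' p1 p2 ->
    ~ last_edges p (rev b) -> flips p3 (b :: p) -> append a' p3 p4 -> flips p2 p4.
  move=> rp sab ca a2 nb p3b a4.
  have sra := square_rot sab.
  have nb1 : ~ last_edges p1 (rev b').
    case=> p1' p1b'; apply: nb; exists (rev a' :: p1').
    apply: flips_trans ca _; apply: flips_trans (flips_cons _ p1b') _.
    apply: flips_swap; exact: square_rev sab.
  have a2' : append b' p1 (b' :: p1) by left; split=> //; exact: flips_refl.
  apply: flips_trans (append_flips (flips_refl _) a2 a2') _.
  case: a4 => [[n3 _]|f3].
    exfalso; apply: n3; rewrite (flips_last p3b); exists (b' :: p1).
    apply: flips_trans (flips_cons _ ca) _; exact: flips_swap.
  apply: (@flips_consI (rev a')); apply: flips_trans f3.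
  apply: flips_sym; apply: flips_trans p3b _.
  apply: flips_trans (flips_cons _ ca) _; exact: flips_swap.
case: (aq1) => [[n1 f1]|f1]; case: (aq3) => [[n3 f3]|f3].
- have n2 := new _ _ _ _ _ _ s n3 f1; have n4 := new _ _ _ _ _ _ ss n1 f3.
  case: aq2 => [[_ f2]|f2]; last by exfalso; apply: n2; exists q2.
  case: aq4 => [[_ f4]|f4]; last by exfalso; apply: n4; exists q4.
  apply: flips_trans f2 _; apply: flips_trans (flips_cons _ f1) _.
  apply: flips_sym; apply: flips_trans f4 _; apply: flips_trans (flips_cons _ f3) _.
  exact: flips_swap ss.
- apply: flips_sym; exact: (half _ _ _ _ _ _ _ _ _ rq ss f3 aq4 n1 f1 aq2).
- exact: (half _ _ _ _ _ _ _ _ _ rq s f1 aq2 n3 f3 aq4).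
(* Both cancel: the square exchanging [rev e] and [rev f] at the end of [q] is the given one
   traversed backwards, so the second steps cancel as well. *)
- have /flipsP [[ef _]|[r [x [y [sxy xr yr]]]]] :
      flips (rev e :: q1) (rev f :: q3) by exact: flips_trans (flips_sym f1) f3.
    by have /(congr1 rev) := ef; rewrite !revK => /(square_neq s).
  have := square_rev sxy; rewrite !revK => sx.
  have Ex : x = rev f' by rewrite (square_det s sx) revK.
  have Ey : y = rev e' by rewrite (square_det ss (square_sym sx)) revK.
  subst x y.
  have ar2 : append f' q1 r by right.
  have ar4 : append e' q3 r by right.
  apply: flips_trans (append_flips (flips_refl _) aq2 ar2) _.
  exact: append_flips (flips_refl _) ar4 aq4.
Qed.

Lemma normal_form_reduced p q : normal_form p q -> reduced q.
Proof.
elim: p q => /= [q qn|e p IH q [q0 pq0 aq]].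
  by apply: (@flips_reduced [::]) => //; exact: flips_sym.
exact: append_reduced (IH _ pq0) aq.
Qed.

Lemma normal_form_ex p : exists q, normal_form p q.
Proof.
elim: p => [|e p [q pq]]; first by exists [::]; exact: flips_refl.
have [q' aq' _] := append_ex e (normal_form_reduced pq).
by exists q', q.
Qed.

Lemma normal_form_flipsr p q q' :
  flips q q' -> normal_form p q -> normal_form p q'.
Proof.
case: p => /= [|e p] qq'; first by apply: flips_trans; exact: flips_sym.
by move=> [q0 pq0 aq]; exists q0 => //; exact: append_flipsr aq.
Qed.

Lemma reduced_normal_form p : reduced p -> normal_form p p.
Proof.
elim: p => [_|e p IH /= [rp ne]]; first exact: flips_refl.
by exists p; [exact: IH|left; split=> //; exact: flips_refl].
Qed.

(** Van der Waerden's trick: [append] lets letters act on reduced words up to [flips], and this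
    action satisfies the relations [homotopic_swap] (by [append_square]) and [homotopic_cancel] (by
    [append_cancel]). *)
Lemma homotopic_normal_form p q r :
  homotopic p q -> (normal_form p r <-> normal_form q r).
Proof.
move=> pq; elim: pq r => {p q}.
- by [].
- by move=> p q _ IH r; split=> /IH.
- by move=> p q r _ IH1 _ IH2 s; split=> [/IH1/IH2|/IH2/IH1].
- have half e f' f e' p r : square e f' f e' ->
      normal_form [:: f', e & p] r -> normal_form [:: e', f & p] r.
    move=> s /= [q1 [q pq aq1] aq2].
    have [q3 aq3 aq4] := append_square (normal_form_reduced pq) s aq1 aq2.
    by exists q3 => //; exists q.
  by move=> e f' f e' p s r; split; apply: half => //; exact: square_sym.
- move=> e p r; split=> /= [[q1 [q pq aq1] aq2]|pr].
    have aq3 := append_cancel (normal_form_reduced pq) aq1.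
    exact: normal_form_flipsr (append_flips (flips_refl _) aq3 aq2) pq.
  have [q aq _] := append_ex e (normal_form_reduced pr).
  by exists q; [exists r|exact: append_cancel (normal_form_reduced pr) aq].
- by move=> e p q _ IH r; split=> /= -[q0 /IH]; exists q0.
Qed.

(** The transition function of the automaton: the new set is computed from [e] and the old set
    alone, without the rest of [p]. *)
Lemma last_edges_cons e p g : last_edges (e :: p) g <->
  g = e \/ exists2 a, last_edges p a & exists b, square a e b g.
Proof.
split=> [[q /flipsP[[-> _]|[r [a [b [s pr _]]]]]]|[->|[a [r pr] [b s]]]].
- by left.
- by right; exists a; [exists r|exists b].
- by exists p; exact: flips_refl.
- by exists (b :: r); apply: flips_trans (flips_cons _ pr) _; exact: flips_swap.
Qed.

Section Count.
Variable P : pred D.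
Hypothesis P_rev : forall e, P (rev e) = P e.
Hypothesis P_square : forall e f' f e', square e f' f e' -> P e = P e'.

Lemma flips_count p q : flips p q -> count P p = count P q.
Proof.
elim=> //= [p' q' r _ -> _ ->//|e f' f e' r s|e p' q' _ ->//].
by rewrite (P_square s) (P_square (square_sym s)) addnCA.
Qed.

(** While the normal form of [p] is computed, each letter is either added or removes a letter of its
    own class, so the count never exceeds that of [p]. [P] will be a type of edges. *)
Lemma homotopic_reduced_count p q :
  homotopic p q -> reduced q -> (count P q <= count P p)%N.
Proof.
move=> pq /reduced_normal_form/(homotopic_normal_form _ pq) {pq}.
elim: p q => /= [q /flips_count -> //|e p IH q [q0 /IH c0 aq]].
case: aq => [[_ /flips_count ->]|/flips_count] /=; first by rewrite leq_add2l.
by rewrite P_rev => E; move: c0; rewrite E; lia.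
Qed.

End Count.

End FlipWords.

(** * Cubes, faces and links *)

Section CubeMaps.
Context {R : realType}.

Definition flipr (b : bool) (x : R) : R := if b then 1 - x else x.

Definition vtx (S : finType) (u : S -> bool) : S -> R := fun a => (u a)%:R.

(* Signed coordinate embeddings of cubes onto faces of cubes. *)
Record cmap (S T : finType) := CMap {
  cfun : S -> T;
  cfun_inj : injective cfun;
  cflip : S -> bool;
  cconst : T -> bool }.

Definition ev (S T : finType) (m : cmap S T) (x : S -> R) (t : T) : R :=
  if [pick a | cfun m a == t] is Some a then flipr (cflip m a) (x a)
  else (cconst m t)%:R.

Definition evb (S T : finType) (m : cmap S T) (u : S -> bool) (t : T) : bool :=
  if [pick a | cfun m a == t] is Some a then cflip m a (+) u a
  else cconst m t.

Variant cmap_spec (S T : finType) (m : cmap S T) (t : T) : Prop :=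
| CmapIn a of t = cfun m a
| CmapOut of (forall a, cfun m a != t).

Lemma cmapP (S T : finType) (m : cmap S T) t : cmap_spec m t.
Proof.
case: (pickP (fun a => cfun m a == t)) => [a /eqP <-|ne].
  exact: CmapIn.
by apply: CmapOut => a; rewrite ne.
Qed.

Lemma ev_in (S T : finType) (m : cmap S T) x a :
  ev m x (cfun m a) = flipr (cflip m a) (x a).
Proof.
rewrite /ev; case: pickP => [b /eqP/cfun_inj -> //|/(_ a)].
by rewrite eqxx.
Qed.

Lemma evb_in (S T : finType) (m : cmap S T) u a :
  evb m u (cfun m a) = cflip m a (+) u a.
Proof.
rewrite /evb; case: pickP => [b /eqP/cfun_inj -> //|/(_ a)].
by rewrite eqxx.
Qed.

Lemma ev_out (S T : finType) (m : cmap S T) x t :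
  (forall a, cfun m a != t) -> ev m x t = (cconst m t)%:R.
Proof.
by move=> ne; rewrite /ev; case: pickP => [b|//]; rewrite (negPf (ne b)).
Qed.

Lemma evb_out (S T : finType) (m : cmap S T) u t :
  (forall a, cfun m a != t) -> evb m u t = cconst m t.
Proof.
by move=> ne; rewrite /evb; case: pickP => [b|//]; rewrite (negPf (ne b)).
Qed.

Lemma flipr_nat (b c : bool) : flipr b c%:R = (b (+) c)%:R.
Proof. by case: b c => [] []; rewrite /flipr /= ?subrr ?subr0. Qed.

Lemma fliprK b : involutive (flipr b).
Proof. by case: b => x; rewrite /flipr ?subKr. Qed.

Lemma flipr_flipr b c x : flipr b (flipr c x) = flipr (b (+) c) x.
Proof. by case: b c => [] []; rewrite /flipr /= ?subKr. Qed.

Lemma flipr_dist b x y : `|flipr b x - flipr b y| = `|x - y|.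
Proof. by case: b; rewrite /flipr // distrC; congr `| _ |; ring. Qed.

Lemma flipr01 b x : 0 <= x <= 1 -> 0 <= flipr b x <= 1.
Proof. by case: b; rewrite /flipr => // ?; lra. Qed.

Lemma ev_vtx (S T : finType) (m : cmap S T) u : ev m (vtx u) = vtx (evb m u).
Proof.
apply/funext => t; rewrite /vtx; case: (cmapP m t) => [a ->|ne].
  by rewrite ev_in evb_in flipr_nat.
by rewrite ev_out// evb_out.
Qed.

Lemma ev_cube (S T : finType) (m : cmap S T) x :
  unit_cube R S x -> unit_cube R T (ev m x).
Proof.
move=> x01 t; case: (cmapP m t) => [a ->|ne].
  by rewrite ev_in; apply: flipr01; exact: x01.
by rewrite ev_out//; case: (cconst m t); rewrite ?lexx ?ler01.
Qed.

Lemma vtx_cube (S : finType) (u : S -> bool) : unit_cube R S (vtx u).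
Proof. by move=> a; rewrite /vtx; case: (u a); rewrite ?lexx ?ler01. Qed.

Lemma open_cubeW (S : finType) x : open_cube R S x -> unit_cube R S x.
Proof. by move=> ox a; have /andP[/ltW -> /ltW ->] := ox a. Qed.

Definition ccomp (S T U : finType) (n : cmap T U) (m : cmap S T) : cmap S U :=
  @CMap S U (cfun n \o cfun m) (inj_comp (@cfun_inj _ _ n) (@cfun_inj _ _ m))
    (fun a => cflip n (cfun m a) (+) cflip m a)
    (evb n (cconst m)).

Lemma ev_ccomp (S T U : finType) (n : cmap T U) (m : cmap S T) x :
  ev (ccomp n m) x = ev n (ev m x).
Proof.
apply/funext => t; case: (cmapP n t) => [b ->{t}|ne].
  rewrite ev_in; case: (cmapP m b) => [a ->|ne].
    by rewrite (ev_in (ccomp n m) x a) ev_in flipr_flipr.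
  rewrite ev_out/=; last by move=> a; rewrite (inj_eq (@cfun_inj _ _ n)).
  by rewrite ev_out// flipr_nat evb_in.
rewrite [LHS]ev_out/=; last by move=> a.
by rewrite evb_out// ev_out.
Qed.

Lemma evb_ccomp (S T U : finType) (n : cmap T U) (m : cmap S T) u :
  evb (ccomp n m) u = evb n (evb m u).
Proof.
apply/funext => t; case: (cmapP n t) => [b ->{t}|ne].
  rewrite evb_in; case: (cmapP m b) => [a ->|ne].
    by rewrite (evb_in (ccomp n m) u a) evb_in addbA.
  rewrite evb_out/=; last by move=> a; rewrite (inj_eq (@cfun_inj _ _ n)).
  by rewrite evb_in evb_out.
rewrite [LHS]evb_out/=; last by move=> a.
by rewrite evb_out// [RHS]evb_out.
Qed.

Lemma ev_surj (S T : finType) (m : cmap S T) z : unit_cube R T z ->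
  (forall t, (forall a, cfun m a != t) -> z t = (cconst m t)%:R) ->
  exists2 x, unit_cube R S x & ev m x = z.
Proof.
move=> z01 zc; exists (fun a => flipr (cflip m a) (z (cfun m a))).
  by move=> a; apply: flipr01; exact: z01.
apply/funext => t; case: (cmapP m t) => [a ->|ne].
  by rewrite ev_in fliprK.
by rewrite ev_out// zc.
Qed.

(* The images of 0 and 1 are opposite vertices of the face, because they realize
   its diameter; the unit vectors then go to unit vectors, and distances to these
   give the coordinates of all other points. *)
Lemma isometry_cmap (S T : finType) (phi : T -> option bool) h :
  isometry_onto (unit_cube R S) (cube_face phi) h ->
  exists m : cmap S T,
    [/\ forall x, unit_cube R S x -> h x = ev m x,
        forall a, phi (cfun m a) = None,
        forall t, phi t = None -> exists a, t = cfun m a &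
        forall t b, phi t = Some b -> cconst m t = b].
Proof.
move=> [hd him]; pose F t := phi t == None.
have hf x : unit_cube R S x -> cube_face phi (h x).
  by move=> hx; rewrite -him; exists x.
have hs x y : unit_cube R S x -> unit_cube R S y ->
    \sum_(t | F t) (h x t - h y t) ^+ 2 = \sum_a (x a - y a) ^+ 2.
  move=> hx hy; have /(congr1 (fun r => r ^+ 2)) := hd _ _ hx hy.
  rewrite !sqr_sqrtr; try by apply: sumr_ge0 => *; exact: sqr_ge0.
  move=> <-; rewrite [RHS](bigID F)/= [X in _ = _ + X]big1 ?addr0//.
  move=> t; rewrite /F; case E : (phi t) => [b|]// _.
  by rewrite ((hf _ hx).2 _ _ E) ((hf _ hy).2 _ _ E) subrr expr0n.
have cube0 : unit_cube R S (fun=> 0) by move=> a; rewrite lexx ler01.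
have cube1 : unit_cube R S (fun=> 1) by move=> a; rewrite lexx ler01.
set u := h (fun=> 0); set w := h (fun=> 1).
have hu : cube_face phi u := hf _ cube0.
have hw : cube_face phi w := hf _ cube1.
have u01 t : 0 <= u t <= 1 by exact: hu.1.
have w01 t : 0 <= w t <= 1 by exact: hw.1.
(* The main diagonal of the face has squared length the number of free coordinates, and its ends
   come from a cube of squared diameter [#|S|]. *)
have FS : (#|[pred t | F t]|%:R <= #|S|%:R :> R).
  pose z (b : bool) t : R := (odflt b (phi t))%:R.
  have hz b : cube_face phi (z b).
    split=> [t|t c]; rewrite /z; last by move=> ->.
    by case: (odflt _ _); rewrite ?lexx ?ler01.
  have := hz true; have := hz false; rewrite -him => -[x0 hx0 E0] [x1 hx1 E1].
  have := hs _ _ hx1 hx0; rewrite E0 E1.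
  rewrite (eq_bigr (fun=> 1)) => [|t /eqP Ft].
    rewrite sumr_const => ->; rewrite -sumr_const; apply: ler_sum => a _.
    have := hx0 a; have := hx1 a; move: (x0 a) (x1 a) => p q.
    by move=> /andP[? ?] /andP[? ?]; rewrite expr2; nra.
  by rewrite /z Ft/= subr0 expr1n.
have uw1 : \sum_(t | F t) (w t - u t) ^+ 2 = #|S|%:R.
  by rewrite hs// -sumr_const; apply: eq_bigr => a _; rewrite subr0 expr1n.
(* Conversely the image of the diagonal from 0 to 1 has squared length [#|S|]: with at most [#|S|]
   free coordinates, each has to vary by exactly 1. *)
have term t : 0 <= 1 - (w t - u t) ^+ 2.
  have := u01 t; have := w01 t; move: (u t) (w t) => p q.
  move=> /andP[? ?] /andP[? ?].
  have : 0 <= (1 - q + p) * (1 + q - p) by apply: mulr_ge0; lra.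
  by rewrite expr2; lra.
have /eqP : \sum_(t | F t) (1 - (w t - u t) ^+ 2) = 0.
  apply/eqP; rewrite eq_le sumr_ge0 ?andbT//.
  by rewrite sumrB uw1 sumr_const subr_le0.
rewrite psumr_eq0// => /allP uw.
have {}uw t : F t -> exists b : bool, u t = b%:R /\ w t = (~~ b)%:R.
  move=> Ft; have := uw t (mem_index_enum _); rewrite Ft/= subr_eq0 => /eqP.
  have := u01 t; have := w01 t; move: (u t) (w t) => p q.
  move=> /andP[? ?] /andP[? ?] E.
  have : (q - p == 1) || (q - p == -1) by rewrite -sqrf_eq1 -E.
  by case/orP => /eqP {}E; [exists false|exists true]; rewrite /= ?mulr1n ?mulr0n; split; lra.
have FSe : #|[pred t | F t]|%:R = #|S|%:R :> R.
  rewrite -uw1 -sumr_const; apply: eq_bigr => t /uw[b [-> ->]].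
  by case: b; rewrite /= ?sub0r ?subr0 ?sqrrN expr1n.
pose ub t := u t == 1.
have uE t : F t -> u t = (ub t)%:R.
  by move=> /uw[b [E _]]; rewrite /ub E; case: (b); rewrite ?eqxx// eq_sym oner_eq0.
have wE t : F t -> w t = (~~ ub t)%:R.
  move=> /uw[b [E ->]]; rewrite /ub E.
  by case: (b); rewrite ?eqxx// eq_sym oner_eq0.
(* The free coordinates are reflected so that the image of 0 becomes the origin. *)
pose y x t := flipr (ub t) (h x t).
have y01 x t : unit_cube R S x -> 0 <= y x t <= 1.
  by move=> hx; apply: flipr01; exact: (hf _ hx).1.
have yu x t : F t -> (h x t - u t) ^+ 2 = y x t ^+ 2.
  by move=> Ft; rewrite uE// /y; case: (ub t); rewrite /flipr/= ?subr0// -sqrrN opprB.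
have ysum x : unit_cube R S x -> \sum_(t | F t) y x t ^+ 2 = \sum_a x a ^+ 2.
  move=> hx; rewrite -(eq_bigr _ (fun t Ft => yu x t Ft)) hs//.
  by apply: eq_bigr => a _; rewrite subr0.
pose e a (b : S) : R := (b == a)%:R.
have he a : unit_cube R S (e a).
  by move=> b; rewrite /e; case: (b == a); rewrite ?lexx ?ler01.
have sume a : \sum_b e a b ^+ 2 = 1.
  rewrite (bigD1 a)//= /e eqxx expr1n big1 ?addr0// => b /negPf ->.
  by rewrite expr0n.
(* Polarization: the inner product with the unit vector [e a] is preserved. *)
have expand x a : unit_cube R S x ->
    2 * \sum_(t | F t) y x t * y (e a) t = 2 * x a.
  move=> hx.
  have E1 : \sum_(t | F t) (y x t - y (e a) t) ^+ 2 = \sum_b (x b - e a b) ^+ 2.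
    rewrite -hs//; apply: eq_bigr => t _; rewrite /y.
    by case: (ub t); rewrite /flipr//= -[RHS]sqrrN; congr (_ ^+ 2); ring.
  have E2 : \sum_(b : S) 2 * (x b * e a b) = 2 * x a.
    rewrite (bigD1 a)//= big1 ?addr0 /e ?eqxx ?mulr1// => b /negPf ->.
    by rewrite !mulr0.
  rewrite -E2 mulr_sumr.
  transitivity (\sum_(t | F t) (y x t ^+ 2 + y (e a) t ^+ 2 - (y x t - y (e a) t) ^+ 2)).
    by apply: eq_bigr => t _; ring.
  rewrite sumrB big_split/= !ysum// E1 -big_split -sumrB/=.
  by apply: eq_bigr => b _; ring.
have y1 t : F t -> y (fun=> 1) t = 1.
  move=> Ft; rewrite /y -/w wE//; case: (ub t); rewrite /flipr/= ?subr0//.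
(* Numbers in [0, 1] whose sum and sum of squares are both 1 are all 0 except for a single 1. *)
have sig a : exists s, F s /\ forall t, F t -> y (e a) t = (t == s)%:R.
  have s2 : \sum_(t | F t) y (e a) t ^+ 2 = 1 by rewrite ysum.
  have s1 : \sum_(t | F t) y (e a) t = 1.
    have two : (2 : R) != 0 by rewrite pnatr_eq0.
    rewrite -[RHS](mulfI two (expand _ a cube1)); apply: eq_bigr => t Ft.
    by rewrite y1// mul1r.
  have /eqP : \sum_(t | F t) (y (e a) t - y (e a) t ^+ 2) = 0.
    by rewrite sumrB s1 s2 subrr.
  rewrite psumr_eq0; last first.
    move=> t _; have /andP[] := y01 _ t (he a); move: (y (e a) t) => p ? ?.
    by rewrite expr2; nra.
  move=> /allP y2.
  have {}y2 t : F t -> y (e a) t = 0 \/ y (e a) t = 1.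
    move=> Ft; have := y2 t (mem_index_enum _); rewrite Ft/= => /eqP E.
    have /eqP : y (e a) t * (1 - y (e a) t) = 0 by rewrite -E; ring.
    by rewrite mulf_eq0 subr_eq0 => /orP[/eqP|/eqP/esym]; [left|right].
  have [s /andP[Fs ys]|no] := pickP (fun t => F t && (y (e a) t != 0)); last first.
    move: s1; rewrite big1 => [/esym/eqP|t Ft]; first by rewrite oner_eq0.
    by have := no t; rewrite Ft/= => /negbFE/eqP.
  have ys1 : y (e a) s = 1 by case: (y2 _ Fs) ys => ->; rewrite ?eqxx.
  exists s; split=> // t Ft; have [->//|ts] := eqVneq t s.
  move: s1; rewrite (bigD1 s)//= ys1 -[RHS]addr0 => /addrI/eqP.
  rewrite psumr_eq0; last by move=> t' _; have /andP[] := y01 _ t' (he a).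
  by move=> /allP/(_ t (mem_index_enum _)); rewrite Ft ts => /eqP.
pose si a := projT1 (cid (sig a)).
have [Fsi ysi] : (forall a, F (si a)) /\
    forall a t, F t -> y (e a) t = (t == si a)%:R.
  by split=> a; case: (projT2 (cid (sig a))).
have hsi x a : unit_cube R S x -> y x (si a) = x a.
  move=> hx; have two : (2 : R) != 0 by rewrite pnatr_eq0.
  apply: (mulfI two); rewrite -expand//; congr (_ * _).
  rewrite (bigD1 (si a))//= ysi// eqxx mulr1 big1 ?addr0// => t /andP[Ft].
  by rewrite ysi// => /negPf ->; rewrite mulr0.
have si_inj : injective si.
  move=> a b E; have := hsi _ a (he b); rewrite E hsi// /e eqxx.
  by case: eqVneq => // _ /eqP; rewrite oner_eq0.
have onto t : phi t = None -> exists a, t = si a.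
  move=> Ft; have : (si @: finset.setT = finset F)%SET.
    apply/eqP; rewrite eqEcard card_imset// cardsT cardsE.
    rewrite -(ler_nat R) FSe lexx andbT.
    by apply/fintype.subsetP => _ /imsetP[a _ ->]; rewrite inE; exact: Fsi.
  move=> /setP/(_ t); rewrite [in RHS]inE /F Ft eqxx => /imsetP[a _ ta].
  by exists a.
exists (@CMap S T si si_inj (fun a => ub (si a)) (fun t => odflt false (phi t))).
split=> /= [x hx|a|t /onto //|t b -> //]; last exact/eqP/Fsi.
apply/funext => t.
set m := CMap _ _ _; case: (cmapP m t) => [a ->|ne].
  by rewrite ev_in /= -(hsi x a hx) /y fliprK.
rewrite ev_out//=; case E : (phi t) => [b|]; first exact: (hf _ hx).2.
by have [a ta] := onto t E; have := ne a; rewrite /= ta eqxx.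
Qed.

End CubeMaps.

(** * Faces, oriented edges and squares of a cube complex *)

Section Faces.
Context {R : realType}.
Implicit Types X Y : cubeComplex R.

Definition flipc (S : finType) (u : S -> bool) (a : S) : S -> bool :=
  fun b => if b == a then ~~ u b else u b.

Lemma flipcK (S : finType) (u : S -> bool) a : flipc (flipc u a) a = u.
Proof. by apply/funext => b; rewrite /flipc; case: eqP => // _; rewrite negbK. Qed.

Lemma flipcC (S : finType) (u : S -> bool) a b :
  flipc (flipc u a) b = flipc (flipc u b) a.
Proof. by apply/funext => t; rewrite /flipc; case: eqP; case: eqP. Qed.

Lemma evb_flipc (S T : finType) (m : @cmap S T) u a :
  evb m (flipc u a) = flipc (evb m u) (cfun m a).
Proof.
apply/funext => t; rewrite /flipc; case: (cmapP m t) => [b ->|ne].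
  by rewrite !evb_in (inj_eq (@cfun_inj _ _ m)); case: eqP => // _; rewrite addbN.
by rewrite !evb_out// eq_sym (negPf (ne a)).
Qed.

Definition clamp (t : R) : R := Num.max 0 (Num.min t 1).

Lemma clamp01 t : 0 <= clamp t <= 1.
Proof. by rewrite /clamp le_max lexx/= ge_max ge_min lexx orbT ler01. Qed.

Lemma clamp_id t : 0 <= t <= 1 -> clamp t = t.
Proof. by move=> /andP[t0 t1]; rewrite /clamp (min_l t1) (max_r t0). Qed.

Lemma clamp1B t : clamp (1 - t) = 1 - clamp t.
Proof.
rewrite /clamp; have [t0|t0] := ltP t 0.
  have t1 : t <= 1 by lra.
  rewrite (min_l t1) (max_l (ltW t0)) min_r; last by lra.
  by rewrite max_r ?subr0// ler01.
have [t1|t1] := leP t 1.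
  rewrite (max_r t0) min_l; last by lra.
  by rewrite max_r//; lra.
by rewrite (max_r ler01) min_l; [rewrite max_l; lra|lra].
Qed.

Definition along (S : finType) (u : S -> bool) (a : S) (s : R) : S -> R :=
  fun b => if b == a then flipr (u a) s else (u b)%:R.

Lemma along_cube (S : finType) (u : S -> bool) a s :
  0 <= s <= 1 -> unit_cube R S (along u a s).
Proof.
move=> s01 b; rewrite /along; case: eqP => _; first exact: flipr01.
by case: (u b); rewrite ?lexx ?ler01.
Qed.

Lemma along0 (S : finType) (u : S -> bool) a : along u a 0 = vtx u.
Proof.
by apply/funext => b; rewrite /along /vtx; case: eqP => // ->;
  rewrite (flipr_nat (u a) false) addbF.
Qed.

Lemma along_flipc (S : finType) (u : S -> bool) a s :
  along (flipc u a) a s = along u a (1 - s).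
Proof.
apply/funext => b; rewrite /along /flipc eqxx; case: eqP => // _.
by case: (u a); rewrite /flipr/= ?subKr.
Qed.

Lemma along1 (S : finType) (u : S -> bool) a : along u a 1 = vtx (flipc u a).
Proof. by rewrite -(along0 _ a) along_flipc subr0. Qed.

Lemma ev_along (S T : finType) (m : cmap S T) u a s :
  ev m (along u a s) = along (evb m u) (cfun m a) s.
Proof.
apply/funext => t; rewrite /along; case: (cmapP m t) => [b ->|ne].
  rewrite ev_in (inj_eq (@cfun_inj _ _ m)) !evb_in; case: eqP => [->|_].
    by rewrite flipr_flipr.
  by rewrite flipr_nat.
by rewrite ev_out// eq_sym (negPf (ne a)) evb_out.
Qed.

Section Edges.
Variable X : cubeComplex R.
Implicit Types (c : cell X) (e f g : R -> X).

Definition face_map c c' (m : cmap (coord c) (coord c')) :=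
  forall x, unit_cube R (coord c) x -> chart X c x = chart X c' (ev m x).

Lemma face_map_comp c c' c'' (n : cmap (coord c') (coord c''))
    (m : cmap (coord c) (coord c')) :
  face_map n -> face_map m -> face_map (ccomp n m).
Proof. by move=> fn fm x hx; rewrite fm// fn ?ev_ccomp//; exact: ev_cube. Qed.

Lemma face_of c (phi : coord c -> option bool) :
  exists c' (m : cmap (coord c') (coord c)),
    [/\ face_map m, forall a, phi (cfun m a) = None,
        forall t, phi t = None -> exists a, t = cfun m a &
        forall t b, phi t = Some b -> cconst m t = b].
Proof.
have [c' [h [hi hc]]] := face_cell phi.
have [m [mh m1 m2 m3]] := isometry_cmap hi.
by exists c', m; split=> // x hx; rewrite hc// mh.
Qed.

Lemma open_face c x : unit_cube R (coord c) x ->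
  exists c' (m : cmap (coord c') (coord c)) y,
    [/\ face_map m, open_cube R (coord c') y & ev m y = x].
Proof.
move=> hx.
pose phi t := if x t == 0 then Some false else if x t == 1 then Some true else None.
have [c' [m [fm m1 m2 m3]]] := face_of phi.
have xc t : (forall a, cfun m a != t) -> x t = (cconst m t)%:R.
  move=> ne; case E : (phi t) => [b|]; last first.
    by have [a ta] := m2 _ E; have := ne a; rewrite ta eqxx.
  rewrite (m3 _ _ E); move: E; rewrite /phi.
  by case: eqP => [-> [<-]//|_]; case: eqP => [-> [<-]//|].
have [y hy yx] := ev_surj hx xc.
exists c', m, y; split=> // a.
have := m1 a; rewrite /phi -yx ev_in; have := hy a.
case: (cflip m a); rewrite /flipr; case: eqP => // /eqP n0; case: eqP => // /eqP n1 H _.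
  by rewrite !lt_neqAle; have [-> ->] := andP H; rewrite !andbT; apply/andP; split;
     [apply: contra n1 => /eqP <-; rewrite subr0|apply: contra n0 => /eqP ->; rewrite subrr].
by rewrite !lt_neqAle eq_sym n0 n1/=.
Qed.

Lemma open_inj c x x' : open_cube R (coord c) x -> open_cube R (coord c) x' ->
  chart X c x = chart X c x' -> x = x'.
Proof.
move=> ox ox' E; have Hi := open_cell_inj ox ox' E.
have := projT2_eq Hi; rewrite (Prop_irrelevance (projT1_eq Hi) erefl)/=.
by [].
Qed.

Lemma lift_open c0 x0 c q : open_cube R (coord c0) x0 -> unit_cube R (coord c) q ->
  chart X c q = chart X c0 x0 ->
  exists m : cmap (coord c0) (coord c), face_map m /\ ev m x0 = q.
Proof.
move=> ox0 hq E; have [c' [m [y [fm oy myq]]]] := open_face hq.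
pose P (s : {c & coord c -> R}) := exists m : cmap (coord (projT1 s)) (coord c),
  face_map m /\ ev m (projT2 s) = q.
have : P (existT _ c' y) by exists m.
suff -> : existT (fun c => coord c -> R) c' y = existT _ c0 x0 by [].
by apply: open_cell_inj => //; rewrite -E fm ?myq//; exact: open_cubeW.
Qed.

Lemma in_open (S T : finType) (m : cmap S T) x t : open_cube R S x ->
  (exists a, t = cfun m a) <-> 0 < ev m x t < 1.
Proof.
move=> ox; case: (cmapP m t) => [a ->|ne].
  split=> // _; last by exists a.
  by rewrite ev_in; have := ox a; case: (cflip m a); rewrite /flipr//; lra.
rewrite ev_out//; split=> [[a E]|]; first by have := ne a; rewrite E eqxx.
by case: (cconst m t); rewrite ltxx ?andbF.
Qed.

(** Faces of a cube may be identified, so face maps between two cells are not unique. Agreement at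
    one interior point forces the same image face; injectivity of [chart] on open cubes then makes
    the maps agree on the whole open cube, even when [x0] is its centre. *)
Lemma face_map_uniq c0 c (m m' : cmap (coord c0) (coord c)) x0 :
  face_map m -> face_map m' -> open_cube R (coord c0) x0 ->
  ev m x0 = ev m' x0 -> evb m (fun=> false) = evb m' (fun=> false).
Proof.
move=> fm fm' ox0 E.
have inE' t : (exists a, t = cfun m a) <-> (exists a, t = cfun m' a).
  by rewrite (in_open m t ox0) (in_open m' t ox0) E.
have key z : open_cube R (coord c0) z -> ev m z = ev m' z.
  move=> oz.
  have [z' hz' z'z] : exists2 z', unit_cube R (coord c0) z' & ev m z' = ev m' z.
    apply: ev_surj => [|t ne]; first exact/ev_cube/open_cubeW.
    have ne' a : cfun m' a != t.
      apply/eqP => ta; have [b tb] : exists b, t = cfun m b by apply/inE'; exists a.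
      by have := ne b; rewrite tb eqxx.
    by rewrite ev_out// -(ev_out x0 ne) E ev_out.
  have oz' : open_cube R (coord c0) z'.
    move=> a; have : 0 < ev m z' (cfun m a) < 1.
      by rewrite z'z; apply/(in_open m' _ oz)/inE'; exists a.
    by rewrite ev_in; case: (cflip m a); rewrite /flipr//; lra.
  rewrite -z'z; congr ev; apply: open_inj => //.
  by rewrite fm' ?fm ?z'z//; exact: open_cubeW.
(* Since 1/4 differs from 1 - 1/4, the value at this point reveals the flips. *)
have oq : open_cube R (coord c0) (fun=> 1 / 4) by move=> a; lra.
apply/funext => t; have := congr1 (fun F => F t) (key _ oq).
case: (cmapP m t) => [a ta|ne]; case: (cmapP m' t) => [b tb|ne'].
- rewrite {1}ta {1}tb !ev_in {1}ta {1}tb !evb_in.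
  by case: (cflip m a); case: (cflip m' b); rewrite /flipr//; lra.
- have [b tb] : exists b, t = cfun m' b by apply/inE'; exists a.
  by have := ne' b; rewrite tb eqxx.
- have [a ta] : exists a, t = cfun m a by apply/inE'; exists b.
  by have := ne a; rewrite ta eqxx.
- rewrite !ev_out// !evb_out//.
  by case: (cconst m t); case: (cconst m' t) => // /eqP; rewrite ?oner_eq0// eq_sym oner_eq0.
Qed.

(* An oriented edge is the path running along it, constant outside [0, 1]; edges
   of different cubes that coincide in X are thus equal as functions. *)
Definition dedge c (u : coord c -> bool) a : R -> X :=
  fun t => chart X c (along u a (clamp t)).

Definition erev e : R -> X := fun t => e (1 - t).

Definition is_edge e := exists c (u : coord c -> bool) a, e = dedge u a.

Definition square e f' f e' := exists c (u : coord c -> bool) a b,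
  [/\ a <> b, e = dedge u a, f' = dedge (flipc u a) b, f = dedge u b
    & e' = dedge (flipc u b) a].

Lemma erevK : involutive erev.
Proof. by move=> e; apply/funext => t; rewrite /erev subKr. Qed.

Lemma dedge0 c (u : coord c -> bool) a : dedge u a 0 = chart X c (vtx u).
Proof. by rewrite /dedge clamp_id ?along0// lexx ler01. Qed.

Lemma dedge1 c (u : coord c -> bool) a : dedge u a 1 = chart X c (vtx (flipc u a)).
Proof. by rewrite /dedge clamp_id ?along1// lexx ler01. Qed.

Lemma erev_dedge c (u : coord c -> bool) a : erev (dedge u a) = dedge (flipc u a) a.
Proof. by apply/funext => t; rewrite /erev /dedge clamp1B along_flipc. Qed.

Lemma erev_edge e : is_edge e -> is_edge (erev e).
Proof. by move=> [c [u [a ->]]]; exists c, (flipc u a), a; rewrite erev_dedge. Qed.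

Lemma face_dedge c c' (m : cmap (coord c) (coord c')) u a : face_map m ->
  dedge u a = dedge (evb m u) (cfun m a).
Proof.
move=> fm; apply/funext => t; rewrite /dedge fm ?ev_along//.
exact/along_cube/clamp01.
Qed.

Lemma square_edges e f' f e' : square e f' f e' ->
  [/\ is_edge e, is_edge f', is_edge f & is_edge e'].
Proof.
move=> [c [u [a [b [_ -> -> -> ->]]]]].
by split; do 3 eexists.
Qed.

Lemma square_ends e f' f e' : square e f' f e' ->
  [/\ e 0 = f 0, e 1 = f' 0, f 1 = e' 0 & f' 1 = e' 1].
Proof.
by move=> [c [u [a [b [_ -> -> -> ->]]]]]; rewrite !dedge1 !dedge0 flipcC.
Qed.

Lemma square_sym e f' f e' : square e f' f e' -> square f e' e f'.
Proof.
by move=> [c [u [a [b [ab -> -> -> ->]]]]]; exists c, u, b, a; split=> // /esym.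
Qed.

Lemma square_rot e f' f e' : square e f' f e' -> square (erev e) f f' (erev e').
Proof.
move=> [c [u [a [b [ab -> -> -> ->]]]]]; exists c, (flipc u a), a, b.
by rewrite !erev_dedge flipcK (flipcC u a b).
Qed.

Lemma span_face c (u : coord c -> bool) (P : pred (coord c)) :
  exists c' (m : cmap (coord c') (coord c)) u',
    [/\ face_map m, evb m u' = u, forall x, P (cfun m x) &
        forall t, P t -> exists x, t = cfun m x].
Proof.
pose phi t := if P t then None else Some (u t).
have [c' [m [fm m1 m2 m3]]] := face_of phi.
exists c', m, (fun x => cflip m x (+) u (cfun m x)).
split=> // [|x|t Pt]; last by apply: m2; rewrite /phi Pt.
  apply/funext => t; case: (cmapP m t) => [a ->|ne].
    by rewrite evb_in addbA addbb.
  rewrite evb_out//; case E : (phi t) => [b|].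
    by rewrite (m3 _ _ E); move: E; rewrite /phi; case: (P t) => // -[].
  by have [a ta] := m2 _ E; have := ne a; rewrite ta eqxx.
by have := m1 x; rewrite /phi; case: (P _).
Qed.

(** Identifies oriented edges, which are functions, with vertices of links: the corner [k] of a
    1-dimensional cell presenting [e] is unique by [edge_corner_uniq]. *)
Definition edge_corner e (k : corner X) :=
  corner_dim k = 1%N /\ forall a, e = dedge (@corner_vtx _ _ k) a.

Lemma dim1P (S : finType) : #|S| = 1%N -> exists a : S, forall b, b = a.
Proof.
move=> S1; have /card_gt0P[a _] : (0 < #|S|)%N by rewrite S1.
exists a => b; have /fintype_le1P/(_ a) : (#|S| <= 1)%N by rewrite S1.
exact.
Qed.

Lemma edge_corner_ex e : is_edge e -> exists k, edge_corner e k.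
Proof.
move=> [c [u [a ->]]].
have [c' [m [u' [fm um m1 m2]]]] := span_face u (pred1 a).
have [x ax] := m2 a (eqxx _).
have all b : b = x by apply: (@cfun_inj _ _ m); rewrite -ax; exact/eqP/m1.
exists (Corner u'); split=> [|b]; rewrite /corner_dim/=.
  apply/eqP/fintype1P; exists x => b; exact: all.
by rewrite (face_dedge u' b fm) um (all b) -ax.
Qed.

(** As [t < 1 / 2], the values [t] and [1 - t] differ, so the single point [e t] determines the open
    edge and the end from which [e] starts. *)
Lemma edge_corner_open e k t : edge_corner e k -> 0 < t < 1 / 2 ->
  exists x, [/\ open_cube R (coord (corner_cell k)) x,
    e t = chart X (corner_cell k) x, forall a, x a = t \/ x a = 1 - t
    & @corner_vtx _ _ k = fun a => x a == 1 - t].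
Proof.
move=> [/dim1P[a all] ke] t01; exists (along (@corner_vtx _ _ k) a t); split.
- by move=> b; rewrite /along (all b) eqxx; case: (corner_vtx _); rewrite /flipr; lra.
- by rewrite (ke a) /dedge clamp_id//; lra.
- by move=> b; rewrite /along (all b) eqxx; case: (corner_vtx _); [right|left].
apply/funext => b; rewrite /along (all b) eqxx; case: (corner_vtx _); rewrite /flipr.
  by rewrite eqxx.
by apply/esym/negbTE/eqP; lra.
Qed.

Lemma edge_corner_inj e e' k k' t : edge_corner e k -> edge_corner e' k' ->
  0 < t < 1 / 2 -> e t = e' t -> k = k'.
Proof.
move=> ke ke' t01 E.
have [x [ox ex _ xu]] := edge_corner_open ke t01.
have [x' [ox' ex' _ xu']] := edge_corner_open ke' t01.
move: k k' x x' ox ox' ex ex' xu xu' {ke ke'} => [c u] [c' u'] x x' /= ox ox' ex ex' -> ->.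
have := open_cell_inj ox ox' (etrans (esym ex) (etrans E ex')).
move=> /(congr1 (fun s : {c & coord c -> R} =>
  @Corner R X (projT1 s) (fun b => projT2 s b == 1 - t))).
exact.
Qed.

Lemma edge_corner_uniq e k k' : edge_corner e k -> edge_corner e k' -> k = k'.
Proof. by move=> ke ke'; apply: (edge_corner_inj (t := 1 / 4) ke ke') => //; lra. Qed.

Lemma corner_edgeP (k : corner X) a (k' : corner X) :
  @corner_edge _ _ k a k' <-> edge_corner (dedge (@corner_vtx _ _ k) a) k'.
Proof.
have D (b : bool) (t : R) : 0 <= t <= 1 -> `|b%:R - t| = flipr b t.
  move=> /andP[t0 t1]; case: b; rewrite /flipr.
    by rewrite ger0_norm// subr_ge0.
  by rewrite sub0r normrN ger0_norm.
have E1 t : 0 <= t <= 1 ->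
    (fun b => if b == a then `|(@corner_vtx _ _ k b)%:R - t| else (@corner_vtx _ _ k b)%:R)
    = along (@corner_vtx _ _ k) a t.
  by move=> t01; apply/funext => b; rewrite /along; case: eqP => // ->; exact: D.
have E2 x t : (forall b, b = x) -> 0 <= t <= 1 ->
    (fun b => `|(@corner_vtx _ _ k' b)%:R - t|) = along (@corner_vtx _ _ k') x t.
  move=> all t01; apply/funext => b.
  by rewrite /along (all b) eqxx; exact: D.
split=> -[k1 kk]; split=> //.
  move=> y; apply/funext => t; rewrite /dedge.
  have [x all] := dim1P k1.
  by have := kk _ (clamp01 t); rewrite E1 ?(E2 y) ?clamp01// => b; rewrite (all b) (all y).
have [x all] := dim1P k1 => t t01.
rewrite E1// (E2 x)//.
by have := congr1 (fun F => F t) (kk x); rewrite /dedge clamp_id.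
Qed.

Lemma corner_edgesP (k k' : corner X) :
  corner_edges k k' <-> exists a, edge_corner (dedge (@corner_vtx _ _ k) a) k'.
Proof. by split=> -[a /corner_edgeP ?]; exists a. Qed.

Lemma edge_corner_at e k v : edge_corner e k -> e 0 = v -> link_vertices v k.
Proof.
move=> [k1 ke] <-; split=> //; have [a _] := dim1P k1.
by rewrite /corner_at/= (ke a) dedge0.
Qed.

Lemma edge_of_corner k e e' : edge_corner e k -> edge_corner e' k -> e = e'.
Proof. by move=> [k1 ke] [_ ke']; have [a _] := dim1P k1; rewrite (ke a) (ke' a). Qed.

Lemma edge_point_inj e e' t : is_edge e -> is_edge e' -> 0 < t < 1 / 2 ->
  e t = e' t -> e = e'.
Proof.
move=> /edge_corner_ex[k ke] /edge_corner_ex[k' ke'] t01 E.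
have kk := edge_corner_inj ke ke' t01 E; subst k'; exact: edge_of_corner ke ke'.
Qed.

End Edges.

(** * Consequences of the link condition *)

Section Links.
Variable X : cubeComplex R.
Hypothesis links : forall v : X, is_vertex v ->
  simplicial_link v /\ is_flag (link_vertices v) (link v).
Implicit Types (c : cell X) (e f g : R -> X).

Lemma dedge_dir_inj c (u : coord c -> bool) : injective (dedge (X := X) u).
Proof.
move=> a b E; have [k' kk'] : exists k, edge_corner (dedge (X := X) u a) k.
  by apply: edge_corner_ex; exists c, u, a.
have uv : corner_at (chart X c (vtx u)) (Corner u) by [].
have [[dir _] _] := links (ex_intro _ _ uv).
apply: (dir _ _ _ k' uv); first exact/corner_edgeP.
by apply/corner_edgeP; rewrite -E.
Qed.

(** Both corners are simplices of the link with the same two vertices, hence equal since simplices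
    are determined by their vertices; the directions match by [dedge_dir_inj]. *)
Lemma corner_det (k k' : corner X) a b a' b' :
  let u := @corner_vtx _ _ k in let u' := @corner_vtx _ _ k' in
  a <> b -> (forall x, x = a \/ x = b) -> (forall x, x = a' \/ x = b') ->
  dedge (X := X) u a = dedge u' a' -> dedge (X := X) u b = dedge u' b' ->
  dedge (X := X) (flipc u a) b = dedge (flipc u' a') b'.
Proof.
move=> u u' ab all all' Ea Eb.
have v' : chart X (corner_cell k') (vtx u') = chart X (corner_cell k) (vtx u).
  by rewrite -(dedge0 u a) Ea dedge0.
have kv : corner_at (chart X (corner_cell k) (vtx u)) k by [].
have kv' : corner_at (chart X (corner_cell k) (vtx u)) k' by rewrite -v'.
have [[_ inj] _] := links (ex_intro _ _ kv).
have kk' : k = k'.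
  apply: inj.
  - apply: mem_set; split=> //; apply/card_gt0P; by exists a.
  - apply: mem_set; split=> //; apply/card_gt0P; by exists a'.
  apply/seteqP; split=> x /corner_edgesP[y yx]; apply/corner_edgesP.
    by case: (all y) yx => ->; rewrite ?Ea ?Eb => yx; [exists a'|exists b'].
  by case: (all' y) yx => ->; rewrite -?Ea -?Eb => yx; [exists a|exists b].
subst k'; rewrite /u /u' in Ea Eb *.
by rewrite (dedge_dir_inj Ea) (dedge_dir_inj Eb).
Qed.

Lemma square_det e f' f e' f'' e'' :
  square e f' f e' -> square e f'' f e'' -> f' = f''.
Proof.
move=> [c [u [a [b [ab Ee Ef' Ef _]]]]] [c2 [u2 [a2 [b2 [ab2 Ee2 Ef2' Ef2 _]]]]].
(* Passes to the 2-dimensional face in the two directions, to which [corner_det] applies. *)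
have restrict d (w : coord d -> bool) x y : x <> y ->
    exists (k : corner X) (x' y' : coord (corner_cell k)),
    [/\ x' <> y', forall z, z = x' \/ z = y',
        dedge (X := X) w x = dedge (@corner_vtx _ _ k) x',
        dedge (X := X) w y = dedge (@corner_vtx _ _ k) y' &
        dedge (X := X) (flipc w x) y = dedge (flipc (@corner_vtx _ _ k) x') y'].
  move=> xy; have [d' [m [w' [fm wm m1 m2]]]] := span_face w (pred2 x y).
  have [x' xx'] : exists x', x = cfun m x' by apply: m2; rewrite /= eqxx.
  have [y' yy'] : exists y', y = cfun m y' by apply: m2; rewrite /= eqxx orbT.
  exists (Corner w'), x', y'; split=> /=.
  - by move=> E; apply: xy; rewrite xx' E.
  - move=> z; have /pred2P[zx|zy] := m1 z; [left|right]; apply: (@cfun_inj _ _ m).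
      by rewrite zx xx'.
    by rewrite zy yy'.
  - by rewrite (face_dedge w' x' fm) wm -xx'.
  - by rewrite (face_dedge w' y' fm) wm -yy'.
  - by rewrite (face_dedge _ y' fm) evb_flipc wm -xx' -yy'.
have [k [x [y [xy all Ex Ey Exy]]]] := restrict _ u a b ab.
have [k2 [x2 [y2 [xy2 all2 Ex2 Ey2 Exy2]]]] := restrict _ u2 a2 b2 ab2.
rewrite Ef' Ef2' Exy Exy2; apply: corner_det => //.
  by rewrite -Ex -Ex2 -Ee.
by rewrite -Ey -Ey2 -Ef.
Qed.

Lemma square_neq e f' f e' : square e f' f e' -> e <> f.
Proof. by move=> [c [u [a [b [ab -> _ -> _]]]]] /dedge_dir_inj. Qed.

Lemma span_link e f' f e' k k' : square e f' f e' ->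
  edge_corner e k -> edge_corner f k' -> link (e 0) [set k; k'].
Proof.
move=> [c [u [a [b [ab -> _ -> _]]]]] ek fk'.
have [d [m [w [fm wm m1 m2]]]] := span_face u (pred2 a b).
have [x xx] : exists x', a = cfun m x' by apply: m2; rewrite /= eqxx.
have [y yy] : exists y', b = cfun m y' by apply: m2; rewrite /= eqxx orbT.
have Ex : dedge (X := X) u a = dedge w x by rewrite (face_dedge w x fm) wm -xx.
have Ey : dedge (X := X) u b = dedge w y by rewrite (face_dedge w y fm) wm -yy.
exists (Corner w); first split.
- by rewrite /corner_at/= Ex dedge0.
- by apply/card_gt0P; exists x.
apply/seteqP; split=> z.
  move=> /corner_edgesP/=[t]; have /pred2P[tx|ty] := m1 t.
    have -> : t = x by apply: (@cfun_inj _ _ m); rewrite tx.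
    by rewrite -Ex => tz; left; exact: edge_corner_uniq tz ek.
  have -> : t = y by apply: (@cfun_inj _ _ m); rewrite ty.
  by rewrite -Ey => tz; right; exact: edge_corner_uniq tz fk'.
move=> [->|->]; apply/corner_edgesP; [exists x|exists y]; rewrite /= -?Ex -?Ey.
  exact: ek.
exact: fk'.
Qed.

(** The flag condition for a set of three corners; the squares provide its pairs through
    [span_link]. *)
Lemma span3 e1 e2 e3 f12 f21 f13 f31 f23 f32 :
  square e1 f12 e2 f21 -> square e1 f13 e3 f31 -> square e2 f23 e3 f32 ->
  exists c (u : coord c -> bool) x y z,
    [/\ e1 = dedge u x, e2 = dedge u y & e3 = dedge u z].
Proof.
move=> s12 s13 s23.
have [h1 _ h2 _] := square_edges s12; have [_ _ h3 _] := square_edges s13.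
have [k1 K1] := edge_corner_ex h1; have [k2 K2] := edge_corner_ex h2.
have [k3 K3] := edge_corner_ex h3.
have [v12 _ _ _] := square_ends s12; have [v13 _ _ _] := square_ends s13.
have vk1 := edge_corner_at K1 erefl.
have vk2 := edge_corner_at K2 (esym v12).
have vk3 := edge_corner_at K3 (esym v13).
have [_ flag] := links (ex_intro _ _ vk1.1).
have flag' : link (e1 0) [set k | [\/ k = k1, k = k2 | k = k3]].
  apply: flag.
  - apply: (@sub_finite_set _ _ ([set k1] `|` [set k2] `|` [set k3])) => [x [->|->|->]|].
    + by left; left.
    + by left; right.
    + by right.
    by rewrite !finite_setU; do !split; exact: finite_set1.
  - by exists k1; constructor 1.
  - by move=> x [->|->|->].
  have flip x y : link (e1 0) [set x; y] -> link (e1 0) [set y; x] by rewrite setUC.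
  have L12 := span_link s12 K1 K2; have L13 := span_link s13 K1 K3.
  have L23 : link (e1 0) [set k2; k3] by rewrite v12; exact: span_link s23 K2 K3.
  by move=> x y [->|->|->] [->|->|->] // _; [exact: flip|exact: flip|exact: flip].
case: flag' => -[c u] _ /= E.
have dir k e : edge_corner e k -> [\/ k = k1, k = k2 | k = k3] ->
    exists x, e = dedge u x.
  move=> ek; rewrite -[X in X -> _]/([set k | [\/ k = k1, k = k2 | k = k3]] k) -E.
  move=> /corner_edgesP/= [x xk]; exists x; exact: edge_of_corner ek xk.
have [x ex] : exists x, e1 = dedge u x by apply: dir K1 _; constructor 1.
have [y ey] : exists x, e2 = dedge u x by apply: dir K2 _; constructor 2.
have [z ez] : exists x, e3 = dedge u x by apply: dir K3 _; constructor 3.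
by exists c, u, x, y, z.
Qed.

(* The three squares meet at the vertex [b 1], where the flag condition spans a
   cube on the edges [erev b], [erev b'] and [g]. *)
Lemma square_cube d b d' b' a e g (c : R -> X) h :
  square d b d' b' -> square a e b g -> square b' g c h ->
  exists k m m', [/\ square d a k m, square d' c k m' & square m e m' h].
Proof.
move=> s1 s2 s3.
have S1 : square (erev b) (erev d) (erev b') (erev d').
  exact: square_rot (square_sym (square_rot s1)).
have S2 : square (erev b) a g (erev e) by exact: square_rot (square_sym s2).
have S3 : square (erev b') c g (erev h) by exact: square_rot s3.
have [C [w [x [y [z [Eb Eb' Eg]]]]]] := span3 S1 S2 S3.
have xy : x <> y by move=> E; apply: (square_neq S1); rewrite Eb Eb' E.
have xz : x <> z by move=> E; apply: (square_neq S2); rewrite Eb Eg E.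
have yz : y <> z by move=> E; apply: (square_neq S3); rewrite Eb' Eg E.
have nyx := nesym xy; have nzx := nesym xz; have nzy := nesym yz.
have sq p q : p <> q -> square (X := X) (dedge w p) (dedge (flipc w p) q) (dedge w q)
    (dedge (flipc w q) p) by move=> pq; exists C, w, p, q.
move: S1 S2 S3; rewrite Eb Eb' Eg => S1 S2 S3.
have Ed : d = dedge (flipc (flipc w x) y) y.
  by rewrite -erev_dedge -(square_det S1 (sq _ _ xy)) erevK.
have Ed' : d' = dedge (flipc (flipc w x) y) x.
  rewrite flipcC -erev_dedge -(square_det (square_sym S1) (sq _ _ nyx)).
  by rewrite erevK.
have Ea : a = dedge (flipc w x) z by exact: square_det S2 (sq _ _ xz).
have Ee : e = dedge (flipc (flipc w z) x) x.
  by rewrite -erev_dedge -(square_det (square_sym S2) (sq _ _ nzx)) erevK.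
have Ec : c = dedge (flipc w y) z by exact: square_det S3 (sq _ _ yz).
have Eh : h = dedge (flipc (flipc w z) y) y.
  by rewrite -erev_dedge -(square_det (square_sym S3) (sq _ _ nzy)) erevK.
pose v := flipc (flipc w x) y.
exists (dedge v z), (dedge (flipc v z) y), (dedge (flipc v z) x); split.
- by exists C, v, y, z; rewrite /v flipcK -Ed -Ea.
- by exists C, v, x, z; rewrite /v (flipcC w x y) flipcK Ec Ed' (flipcC w x y).
- exists C, (flipc v z), y, x; split=> //.
    by rewrite Ee /v (flipcC _ z y) flipcK (flipcC w x z).
  by rewrite Eh /v (flipcC w x y) (flipcC _ z x) flipcK (flipcC w y z).
Qed.

End Links.
End Faces.

(** * Edge paths of strings, and homotopies *)

Section CubePaths.
Context {R : realType} (X : cubeComplex R).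
Implicit Types (c : cell X) (p q : seq (R -> X)) (l r : R).

Local Notation homot := (homotopic (@erev R X) (@square R X)).

Definition dest c (u : coord c -> bool) (w : seq (coord c)) :=
  foldr (fun a v => flipc v a) u w.

Fixpoint walk c (u : coord c -> bool) (w : seq (coord c)) : seq (R -> X) :=
  if w is a :: w' then dedge (X := X) (dest u w') a :: walk u w' else [::].

Definition cube_path c (u v : coord c -> bool) p :=
  exists2 w, v = dest u w & p = walk u w.

Lemma destE c (u : coord c -> bool) w :
  dest u w = fun x => u x (+) odd (count_mem x w).
Proof.
apply/funext => x; elim: w => [|a w IH] /=; first by rewrite addbF.
rewrite /flipc IH [x == a]eq_sym; case: eqP => _ //=.
by rewrite addbN.
Qed.

Lemma dest_rem c (u : coord c -> bool) a w : a \in w ->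
  dest u w = dest u (a :: rem a w).
Proof.
move=> aw; rewrite !destE; apply/funext => x; congr (_ (+) odd _).
by rewrite (seq.permP (perm_to_rem aw)).
Qed.

Lemma walk_rem c (u : coord c -> bool) a w : a \in w ->
  homot (walk u w) (walk u (a :: rem a w)).
Proof.
elim: w => // b w IH; rewrite inE [rem _ _]/=; case: eqVneq => [->|ab] /=.
  by move=> _; exact: homotopic_refl.
move=> aw.
apply: homotopic_trans (homotopic_cons _ (IH aw)) _.
rewrite (dest_rem u aw) /=.
apply: homotopic_swap; exists c, (dest u (rem a w)), a, b; split=> //.
exact/eqP.
Qed.

(** The 1-skeleton of a cube is a Cayley graph of a power of Z/2: [dest] sees only the parity of
    each direction. A direction that is repeated is cancelled; otherwise it is brought to the front
    of the other word and removed from both. *)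
Lemma walk_homotopic c (u : coord c -> bool) w w' : dest u w = dest u w' ->
  homot (walk u w) (walk u w').
Proof.
have [k] := ubnP (size w + size w'); elim: k => // k IHk in w w' *.
have red a v : a \in v -> homot (walk u (a :: v)) (walk u (rem a v)) /\
    dest u (a :: v) = dest u (rem a v).
  move=> av; have E : dest u (a :: v) = dest u (rem a v).
    by rewrite /= (dest_rem u av) /= flipcK.
  split=> //; apply: homotopic_trans (homotopic_cons _ (walk_rem u av)) _.
  rewrite /= (dest_rem u av)/= -erev_dedge; exact: homotopic_cancel.
have parity a v v' : a \notin v -> dest u (a :: v) = dest u v' -> a \in v'.
  move=> /count_memPn av; rewrite !destE => /(congr1 (fun F => F a))/addbI/=.
  by rewrite eqxx av; case: (boolP (a \in v')) => // /count_memPn ->.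
rewrite ltnS; case: w => [|a w] kw E.
  case: w' => [|a w'] in kw E *; first exact: homotopic_refl.
  have aw' : a \in w' by apply/negPn/negP => /parity/(_ (esym E)).
  have [h1 e1] := red _ _ aw'; apply: homotopic_sym.
  apply: homotopic_trans h1 _; apply: IHk; last by rewrite -e1.
  by move: kw; rewrite size_rem//=; lia.
have [aw|aw] := boolP (a \in w).
  have [h1 e1] := red _ _ aw; apply: homotopic_trans h1 _.
  apply: IHk; last by rewrite -e1.
  by move: kw; rewrite size_rem//=; lia.
have aw' := parity _ _ _ aw E.
apply: homotopic_sym; apply: homotopic_trans (walk_rem u aw') _.
have Ed : dest u w = dest u (rem a w').
  move: E; rewrite (dest_rem u aw') /= => /(congr1 (fun v => flipc v a)).
  by rewrite !flipcK.
rewrite /= -Ed; apply: homotopic_cons; apply: IHk => //.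
have sz : (0 < size w')%N by case: (w') aw'.
by move: kw; rewrite size_rem//=; lia.
Qed.

Lemma cube_path_homotopic c (u v : coord c -> bool) p q :
  cube_path u v p -> cube_path u v q -> homot p q.
Proof. by move=> [w -> ->] [w' E ->]; exact: walk_homotopic. Qed.

Lemma cube_path_ex c (u v : coord c -> bool) : exists p, cube_path u v p.
Proof.
pose w := [seq a <- enum (coord c) | u a != v a].
exists (walk u w), w => //; rewrite destE; apply/funext => x.
rewrite count_uniq_mem; last by rewrite filter_uniq ?enum_uniq.
rewrite mem_filter mem_enum andbT.
by case: (u x); case: (v x).
Qed.

Lemma cube_path_cat c (u v w : coord c -> bool) p q :
  cube_path u v p -> cube_path v w q -> cube_path u w (q ++ p).
Proof.
move=> [s -> ->] [t -> ->]; exists (t ++ s); first by rewrite /dest foldr_cat.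
by elim: t => //= a t ->; rewrite /dest foldr_cat.
Qed.

Lemma cube_path1 c (u : coord c -> bool) a :
  cube_path u (flipc u a) [:: dedge (X := X) u a].
Proof. by exists [:: a]. Qed.

Lemma cube_path_nil c (u : coord c -> bool) : cube_path u u [::].
Proof. by exists [::]. Qed.

Lemma face_cube_path c c' (m : cmap (coord c) (coord c')) u v p :
  face_map m -> cube_path u v p -> cube_path (evb m u) (evb m v) p.
Proof.
move=> fm [w -> ->]; have dm s : evb m (dest u s) = dest (evb m u) (map (cfun m) s).
  by elim: s => //= a s IH; rewrite evb_flipc IH.
exists (map (cfun m) w) => //.
by elim: w => //= a w ->; rewrite -dm (face_dedge _ _ fm).
Qed.

(** A canonical vertex for each point, the corner 0 of its open cell, seen in the cube [c]. Its
    image in [X] does not depend on [c], so the edge paths chosen for consecutive segments fit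
    together. *)
Definition base_corner c (x : coord c -> R) (u : coord c -> bool) :=
  exists c' (m : cmap (coord c') (coord c)) y,
    [/\ face_map m, open_cube R (coord c') y, ev m y = x
      & u = evb m (fun=> false)].

Lemma base_corner_ex c x : unit_cube R (coord c) x -> exists u, base_corner x u.
Proof.
by move=> /open_face[c' [m [y [fm oy E]]]]; exists (evb m (fun=> false)), c', m, y.
Qed.

(* A segment is replaced with an edge path of its cube joining the corners 0 of
   the open cells of its ends. *)
Definition seg_path (x y : X) l p := exists c (a b : coord c -> R) u v,
  [/\ unit_cube R (coord c) a /\ unit_cube R (coord c) b,
      chart X c a = x /\ chart X c b = y, l = edist a b,
      base_corner a u /\ base_corner b v & cube_path u v p].

Inductive spath (x : X) : X -> R -> seq (R -> X) -> Prop :=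
| spath_nil : spath x x 0 [::]
| spath_snoc y z l m p q : spath x y l p -> seg_path y z m q ->
    spath x z (l + m) (q ++ p).

Lemma spath_cat x y z l m p q :
  spath x y l p -> spath y z m q -> spath x z (l + m) (q ++ p).
Proof.
move=> xy; elim=> [|z1 z2 l1 l2 p1 p2 _ IH s]; first by rewrite addr0.
by rewrite addrA -catA; exact: spath_snoc IH s.
Qed.

Lemma spath_seg x y l p : seg_path x y l p -> spath x y l p.
Proof. by move=> /(spath_snoc (spath_nil x)); rewrite add0r cats0. Qed.

Lemma string_spath x y l : string_length x y l -> exists p, spath x y l p.
Proof.
elim=> [z|x1 y1 z1 l1 m1 [c [a [b [ha hb Ea Eb El]]]] _ [p pp]].
  by exists [::]; exact: spath_nil.
have [u ua] := base_corner_ex ha; have [v vb] := base_corner_ex hb.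
have [q qq] := cube_path_ex u v.
by exists (p ++ q); apply: spath_cat pp; apply: spath_seg; exists c, a, b, u, v.
Qed.

Lemma edist_ge0 (S : finType) (a b : S -> R) : 0 <= edist a b.
Proof. exact: sqrtr_ge0. Qed.

Lemma ler_edist (S : finType) (a b : S -> R) t : `|a t - b t| <= edist a b.
Proof.
rewrite -sqrtr_sqr /edist ler_wsqrtr// (bigD1 t)//= lerDl.
by apply: sumr_ge0 => *; exact: sqr_ge0.
Qed.

Lemma spath_ge0 x y l p : spath x y l p -> 0 <= l.
Proof.
elim=> // y1 z l1 m p1 q _ l0 [c [a [b [u [v [_ _ -> _ _]]]]]].
by apply: addr_ge0 => //; exact: edist_ge0.
Qed.

Section Near.
(** [A] contains 0, 1, the coordinates of [x0] and their reflections, thus all coordinates of copies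
    of [x0] in faces of cubes. Two such copies in one cube that are closer than the gap [delta]
    coincide. *)
Variables (A : set R) (delta : R).
Hypotheses (A0 : A 0) (A1 : A 1) (AB : forall v, A v -> A (1 - v)).
Hypothesis gap : forall v w, A v -> A w -> `|v - w| < delta -> v = w.
Variables (c0 : cell X) (x0 : coord c0 -> R).
Hypotheses (x0A : forall a, A (x0 a)) (ox0 : open_cube R (coord c0) x0).

Lemma ev_A c (m : cmap (coord c0) (coord c)) t : A (ev m x0 t).
Proof.
case: (cmapP m t) => [a ->|ne].
  by rewrite ev_in; case: (cflip m a); rewrite /flipr//; exact: AB.
by rewrite ev_out//; case: (cconst m t).
Qed.

(* The open cell of the point s has a face containing a copy of x0 close to s,
   and p is homotopic to an edge path in that cell joining the base corners. *)
Definition near_at (s : {c : cell X & coord c -> R}) r p :=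
  exists m : cmap (coord c0) (coord (projT1 s)),
    [/\ face_map m, forall t, `|projT2 s t - ev m x0 t| <= r &
        exists2 q, cube_path (evb m (fun=> false)) (fun=> false) q & homot p q].

Definition nearby (y : X) r p := forall s : {c : cell X & coord c -> R},
  open_cube R (coord (projT1 s)) (projT2 s) -> chart X (projT1 s) (projT2 s) = y ->
  near_at s r p.

Lemma nearby_rep c1 y1 r p : open_cube R (coord c1) y1 ->
  near_at (existT _ c1 y1) r p -> nearby (chart X c1 y1) r p.
Proof.
move=> oy n [c2 y2] /= o2 E; suff -> : existT (fun c => coord c -> R) c2 y2 =
  existT _ c1 y1 by []; exact: open_cell_inj.
Qed.

Lemma nearby_start : nearby (chart X c0 x0) 0 [::].
Proof.
apply: nearby_rep => //.
pose m := @CMap _ _ id (@inj_id (coord c0)) (fun=> false) (fun=> false).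
have em x : ev m x = x by apply/funext => t; rewrite (ev_in m x t).
exists m; split=> [x hx|t|]/=; first by rewrite em.
- by rewrite em subrr normr0.
- have [q qq] := cube_path_ex (evb m (fun=> false)) (fun=> false).
  exists q => //; apply: cube_path_homotopic qq.
  suff -> : evb m (fun=> false) = (fun=> false) by exact: cube_path_nil.
  by apply/funext => t; rewrite (evb_in m (fun=> false) t).
Qed.

(** The copy of [x0] near [a] is within [r + l] of [b]. Where [b] has a coordinate frozen at 0 or 1,
    the gap gives the copy the same coordinate, so the copy lies in the closed cell that has [b] in
    its interior. *)
Lemma nearby_step y z r l p q :
  0 <= r -> nearby y r p -> seg_path y z l q -> r + l < delta -> nearby z (r + l) (q ++ p).
Proof.
move=> r0 ny [c [a [b [u [v [[ha hb] [Ea Eb] El [ua vb] uv]]]]]] rl.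
have [c1 [m1 [y1 [fm1 oy1 my1 Eu]]]] := ua.
have [c2 [m2 [z1 [fm2 oz1 mz1 Ev]]]] := vb.
have cy1 : chart X c1 y1 = y by rewrite fm1 ?my1//; exact: open_cubeW.
have cz1 : chart X c2 z1 = z by rewrite fm2 ?mz1//; exact: open_cubeW.
rewrite -cz1; apply: nearby_rep => //.
have [/= m [fm nm [q0 pq0 pp]]] := ny (existT _ c1 y1) oy1 cy1.
pose n := ccomp m1 m; have fn : face_map n by exact: face_map_comp.
have na t : `|a t - ev n x0 t| <= r.
  rewrite -my1 ev_ccomp; case: (cmapP m1 t) => [s ->|ne].
    by rewrite !ev_in flipr_dist.
  by rewrite !ev_out// subrr normr0.
have nb t : `|b t - ev n x0 t| <= r + l.
  apply: le_trans (ler_distD (a t) _ _) _; rewrite addrC lerD//.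
  by rewrite distrC El ler_edist.
have [w hw mw] : exists2 w, unit_cube R (coord c2) w & ev m2 w = ev n x0.
  apply: ev_surj => [|t ne]; first exact/ev_cube/open_cubeW.
  have bt : b t = (cconst m2 t)%:R by rewrite -mz1 ev_out.
  rewrite -bt; apply: gap; first exact: ev_A.
    by rewrite bt; case: (cconst m2 t).
  by rewrite distrC; apply: le_lt_trans rl.
have [m' [fm' mw']] : exists m' : cmap (coord c0) (coord c2), face_map m' /\ ev m' x0 = w.
  by apply: lift_open => //; rewrite fm2// mw -fn//; exact: open_cubeW.
(* The copies of [x0] seen through [m1] and [m2] are one point of [c], so their corners 0 agree
   although the face maps were chosen separately. *)
have E0 : evb m2 (evb m' (fun=> false)) = evb m1 (evb m (fun=> false)).
  rewrite -!evb_ccomp; apply: (face_map_uniq _ fn ox0); first exact: face_map_comp.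
  by rewrite ev_ccomp mw' mw.
exists m'; split=> //= [t|].
  have := nb (cfun m2 t); rewrite -mz1 -mw -mw' !ev_in.
  by rewrite flipr_dist.
have [q' pq'] := cube_path_ex (evb m' (fun=> false)) (fun=> false).
exists q' => //; apply: homotopic_trans (homotopic_cat (homotopic_refl _ _ _) pp) _.
apply: cube_path_homotopic (face_cube_path fm2 pq').
rewrite E0 -Ev; apply: cube_path_cat uv.
by rewrite Eu; exact: face_cube_path pq0.
Qed.

Lemma spath_nearby y l p : spath (chart X c0 x0) y l p -> l < delta -> nearby y l p.
Proof.
move=> s; have := spath_ge0 s; elim: s => [_ _|y1 z l1 m1 p1 q s IH sq _ lt].
  exact: nearby_start.
have l10 := spath_ge0 s.
have m10 : 0 <= m1 by case: sq => [c [a [b [u [v [_ _ -> _ _]]]]]]; exact: edist_ge0.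
have l1d : l1 < delta by lra.
exact: nearby_step l10 (IH l10 l1d) sq lt.
Qed.

Lemma nearby_uniq y r r' p p' : nearby y r p -> nearby y r' p' -> r + r' < delta ->
  homot p p'.
Proof.
move=> ny ny' rr; have [c1 [y1 [oy1 Ey]]] := open_cell_cover y.
have [m [fm nm [q pq pp]]] := ny (existT _ c1 y1) oy1 Ey.
have [m' [fm' nm' [q' pq' pp']]] := ny' (existT _ c1 y1) oy1 Ey.
apply: homotopic_trans pp _; apply: homotopic_sym; apply: homotopic_trans pp' _.
apply: cube_path_homotopic pq' _.
suff -> : evb m' (fun=> false) = evb m (fun=> false) by [].
apply: (face_map_uniq fm' fm ox0); apply/funext => t.
apply: gap; [exact: ev_A|exact: ev_A|].
apply: le_lt_trans rr; apply: le_trans (ler_distD (y1 t) _ _) _.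
by rewrite addrC lerD// distrC.
Qed.

Lemma nearby_eq c1 y1 r p : open_cube R (coord c1) y1 -> (forall a, A (y1 a)) ->
  nearby (chart X c1 y1) r p -> r < delta -> chart X c1 y1 = chart X c0 x0.
Proof.
move=> oy1 yA ny rd; have [m [fm nm _]] := ny (existT _ c1 y1) oy1 erefl.
rewrite fm; last exact: open_cubeW.
congr chart; apply/funext => t; apply: gap => //; first exact: ev_A.
exact: le_lt_trans (nm t) rd.
Qed.

End Near.

Lemma finite_gap (s : seq R) : exists2 d : R, 0 < d &
  forall v w, v \in s -> w \in s -> `|v - w| < d -> v = w.
Proof.
have lower (t : seq R) : exists2 d : R, 0 < d & forall v, v \in t -> 0 < v -> d <= v.
  elim: t => [|v t [d d0 H]]; first by exists 1.
  have [v0|v0] := ltP 0 v; last first.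
    by exists d => // w; rewrite inE => /orP[/eqP ->|/H//]; rewrite ltNge v0.
  exists (Num.min d v); first by rewrite lt_min d0 v0.
  move=> w; rewrite inE => /orP[/eqP -> _|wt w0]; rewrite ge_min ?lexx ?orbT//.
  by rewrite H.
have [d d0 H] := lower [seq `|v - w| | v <- s, w <- s].
exists d => // v w vs ws; apply: contraTeq => vw.
by rewrite -leNgt; apply: H; rewrite ?normr_gt0 ?subr_eq0//; apply: allpairs_f.
Qed.

(** Local simple connectedness for edge paths, at a scale depending on the start [x]. The scale is
    half the gap because [nearby_uniq] adds the two lengths. *)
Lemma short_spath_homotopic (x : X) : exists2 d : R, 0 < d &
  forall y l l' p p', spath x y l p -> spath x y l' p' -> l < d -> l' < d ->
  homot p p'.
Proof.
have [c0 [x0 [ox0 Ex]]] := open_cell_cover x.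
pose s := [:: 0; 1] ++ [seq x0 a | a <- enum (coord c0)]
  ++ [seq 1 - x0 a | a <- enum (coord c0)].
have [d d0 gap] := finite_gap s.
have sB v : v \in s -> 1 - v \in s.
  rewrite !mem_cat !inE -!orbA => /or4P[/eqP ->|/eqP ->|/mapP[a _ ->]|/mapP[a _ ->]].
  - by rewrite subr0 eqxx orbT.
  - by rewrite subrr eqxx.
  - by apply/or4P; constructor 4; apply/mapP; exists a; rewrite ?mem_enum.
  - apply/or4P; constructor 3; apply/mapP; exists a; rewrite ?mem_enum//.
    by rewrite subKr.
have s0 : 0 \in s by rewrite inE eqxx.
have s1 : 1 \in s by rewrite !inE eqxx orbT.
have sx a : x0 a \in s by rewrite !mem_cat map_f ?orbT// mem_enum.
exists (d / 2); first by lra.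
rewrite -Ex => y l l' p p' sp sp' ld ld'.
have h : l < d by lra. have h' : l' < d by lra.
have n := spath_nearby (A := [set` s]) s0 s1 sB gap sx ox0 sp h.
have n' := spath_nearby (A := [set` s]) s0 s1 sB gap sx ox0 sp' h'.
by apply: (nearby_uniq (A := [set` s]) s0 s1 sB gap sx ox0 n n'); lra.
Qed.

End CubePaths.

(** * Homotopies of edge paths over a subdivided square *)

Section EdgeHomotopy.
Context {R : realType} (X : cubeComplex R).
Implicit Types (p q : seq (R -> X)) (l r d e : R).

Local Notation homot := (homotopic (@erev R X) (@square R X)).
Local Notation unit_square := (`[0, 1] `*` `[0, 1] : set (R * R)).

Definition inv_path p := rev (map (@erev R X) p).

Lemma inv_pathK p : homot (p ++ inv_path p) [::].
Proof.
elim: p => [|a p IH]; first exact: homotopic_refl.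
rewrite /inv_path /= rev_cons -cats1 catA.
apply: (@homotopic_trans _ _ _ _ (a :: [:: erev a])).
  apply: homotopic_cons; apply: (homotopic_cat IH (homotopic_refl _ _ [:: erev a])).
by rewrite -{1}[a]erevK; exact: homotopic_cancel.
Qed.

Lemma homotopic_catIr p q s : homot (p ++ s) (q ++ s) -> homot p q.
Proof.
move=> /homotopic_cat/(_ (homotopic_refl _ _ (inv_path s))) H.
have cancel t : homot t ((t ++ s) ++ inv_path s).
  rewrite -catA -[X in homot X]cats0; apply: homotopic_cat; first exact: homotopic_refl.
  exact/homotopic_sym/inv_pathK.
apply: homotopic_trans (cancel p) _; apply: homotopic_trans H _.
exact/homotopic_sym/cancel.
Qed.

Fixpoint concat (h : nat -> seq (R -> X)) n : seq (R -> X) :=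
  if n is k.+1 then h k ++ concat h k else [::].

Lemma concat_ext (f g : nat -> seq (R -> X)) k :
  (forall j, (j < k)%N -> f j = g j) -> concat f k = concat g k.
Proof.
elim: k => //= k IH fg; rewrite fg// IH// => j jk; apply: fg; exact: ltnW.
Qed.


Section Square.
Variable H : R * R -> X.
Hypothesis cH : {within unit_square, continuous H}.

Lemma compact_unit_square : compact unit_square.
Proof. by apply: compact_setX; exact: segment_compact. Qed.

Lemma near_square z e : unit_square z -> 0 < e -> exists2 r, 0 < r &
  forall z', unit_square z' -> `|z.1 - z'.1| < r -> `|z.2 - z'.2| < r ->
  length_ball (H z) e (H z').
Proof.
move=> Qz e0; have /subspace_continuousP/(_ z Qz) := cH.
move=> /(@cvg_ballP _ _)/(_ e e0).
rewrite /within /prop_near1/= => /nbhs_ballP[r r0 rH].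
exists r => // z' Qz' h1 h2; exact: rH.
Qed.

(** The Lebesgue number argument, used for the uniform continuity of [H] and for the scale of
    [short_spath_homotopic]. *)
Lemma unit_square_uniform (P : R -> R * R -> Prop) :
  (forall z, unit_square z -> exists2 r, 0 < r & forall d z', d < r -> 
    unit_square z' -> `|z.1 - z'.1| < r -> `|z.2 - z'.2| < r -> P d z') ->
  exists2 d, 0 < d & forall z, unit_square z -> P d z.
Proof.
have /compact_near_coveringP/near_covering_withinP cov := compact_unit_square.
move=> loc; have nearP : \forall d \near 0^'+, unit_square `<=` P d.
  apply: cov => z Qz; have [r r0 rP] := loc z Qz.
  exists (ball z r, [set d | d < r]) => /=.
    by split; [exact: nbhsx_ballx|exact: nbhs_right_lt].
  by move=> [z' d] /= [[h1 h2] dr] Qz'; exact: rP.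
have /filter_ex[d [d0 dP]] : \forall d \near (0 : R)^'+, 0 < d /\ unit_square `<=` P d.
  near=> d; split; [by near: d; exact: nbhs_right_gt|by near: d].
by exists d.
Unshelve. all: by end_near.
Qed.

Lemma uniform_near_square e : 0 < e -> exists2 d, 0 < d &
  forall z z', unit_square z -> unit_square z' ->
  `|z.1 - z'.1| < d -> `|z.2 - z'.2| < d -> length_ball (H z) e (H z').
Proof.
move=> e0.
have [|d d0 dP] := @unit_square_uniform (fun d z => forall z', unit_square z' ->
  `|z.1 - z'.1| < d -> `|z.2 - z'.2| < d -> length_ball (H z) e (H z')).
  move=> z Qz; have [|r r0 rH] := @near_square z (e / 2) Qz; first by lra.
  exists (r / 2); first by lra.
  move=> d z1 dr Qz1 h1 h2 z2 Qz2 h3 h4.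
  have -> : e = e / 2 + e / 2 by lra.
  apply: (@length_ball_triangle _ _ _ (H z)).
    by apply: length_ball_sym; apply: rH => //; lra.
  apply: rH => //.
    by have := ler_distD z1.1 z.1 z2.1; lra.
  by have := ler_distD z1.2 z.2 z2.2; lra.
by exists d => // z z' Qz Qz'; exact: dP.
Qed.

Lemma uniform_short_homotopic : exists2 d, 0 < d & forall z y l l' p p',
  unit_square z -> spath (H z) y l p -> spath (H z) y l' p' -> l < d -> l' < d ->
  homot p p'.
Proof.
have [|d d0 dP] := @unit_square_uniform (fun d z => forall y l l' p p',
  spath (H z) y l p -> spath (H z) y l' p' -> l < d -> l' < d -> homot p p').
  move=> z Qz; have [e e0 short] := short_spath_homotopic (H z).
  have [|r r0 rH] := @near_square z (e / 2) Qz; first by lra.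
  exists (Num.min r (e / 2)); first by rewrite lt_min r0; lra.
  move=> d z'; rewrite lt_min => /andP[dr de] Qz'; rewrite !lt_min.
  move=> /andP[h1 _] /andP[h2 _] y l l' p p' sp sp' ld ld'.
  have /length_ballP[m /string_spath[q sq] me] := rH _ Qz' h1 h2.
  (* [q] leads from [H z], where the local statement is available, to [H z']; it precedes both paths
     in the comparison and is cancelled afterwards. *)
  apply: (@homotopic_catIr _ _ q).
  by apply: (short _ _ _ _ _ (spath_cat sq sp) (spath_cat sq sp')); lra.
by exists d => // z y l l' p p' Qz; exact: dP.
Qed.

(** The two ways around a small square of the grid are short strings with common ends, hence
    homotopic. Strip by strip, [h0] is swept from the side where the first coordinate is 0 to the
    opposite one, where the path is empty. *)
Lemma grid_homotopic : exists2 d, 0 < d & forall n (h0 : nat -> seq (R -> X)),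
  (0 < n)%N -> n%:R^-1 < d ->
  (forall t, 0 <= t <= 1 -> [/\ H (1, t) = H (0, 0), H (t, 0) = H (0, 0)
     & H (t, 1) = H (0, 0)]) ->
  (forall j, (j < n)%N -> exists2 l, l < d &
     spath (H (0, j%:R / n%:R)) (H (0, j.+1%:R / n%:R)) l (h0 j)) ->
  homot (concat h0 n) [::].
Proof.
have [e e0 short] := uniform_short_homotopic.
have e2 : 0 < e / 2 by lra.
have [d d0 dball] := uniform_near_square e2.
exists (Num.min d (e / 2)); first by rewrite lt_min d0.
move=> n h0 n0; rewrite lt_min => /andP[nd ne] bd h0P.
have n0R : 0 < n%:R :> R by rewrite ltr0n.
have frac j : (j <= n)%N -> 0 <= (j%:R / n%:R : R) <= 1.
  move=> jn; rewrite divr_ge0 ?ler0n// ler_pdivrMr// mul1r ler_nat//.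
have fracS j : `|(j%:R / n%:R : R) - j.+1%:R / n%:R| < d.
  by rewrite -mulrBl -natr1 opprD addNKr mulN1r normrN ger0_norm// invr_ge0 ltW.
pose z i j : R * R := (i%:R / n%:R, j%:R / n%:R).
have Qz i j : (i <= n)%N -> (j <= n)%N -> unit_square (z i j).
  by move=> iin jn; split; rewrite /= in_itv/= frac.
pose good i j i' j' p := exists2 l, l < e / 2 & spath (H (z i j)) (H (z i' j')) l p.
(* On the sides where [H] is constant the path is chosen empty, so that nothing is left over at the
   ends of a strip. *)
have vertical i j : (i < n)%N -> (j <= n)%N -> exists p,
    good i j i.+1 j p /\ (j = 0%N \/ j = n -> p = [::]).
  move=> iin jn; have [bj|nbj] := pselect (j = 0%N \/ j = n).
    exists [::]; split=> //; exists 0 => //.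
    suff -> : H (z i.+1 j) = H (z i j) by exact: spath_nil.
    have [_ a1 a2] := bd _ (frac _ (ltnW iin)); have [_ b1 b2] := bd _ (frac _ iin).
    rewrite /z; case: bj => ->; first by rewrite mul0r a1 b1.
    by rewrite divff ?gt_eqF// a2 b2.
  have /length_ballP[l /string_spath[p sp] le] :
      length_ball (H (z i j)) (e / 2) (H (z i.+1 j)).
    apply: dball; [exact: Qz (ltnW iin) jn|exact: Qz|exact: fracS|].
    by rewrite /= subrr normr0.
  by exists p; split=> //; exists l.
have horizontal i j : (i <= n)%N -> (j < n)%N -> exists p,
    good i j i j.+1 p /\ (i = 0%N -> p = h0 j) /\ (i = n -> p = [::]).
  move=> iin jn; have [i0|i0] := eqVneq i 0%N.
    exists (h0 j); split; last by split=> //; rewrite i0 => n0'; rewrite -n0' in n0.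
    have [l ld sl] := h0P j jn; exists l; first by move: ld; rewrite lt_min => /andP[].
    by rewrite i0 /z mul0r.
  have [iN|nn] := eqVneq i n.
    exists [::]; split; last by split=> // E; rewrite E eqxx in i0.
    exists 0 => //; suff -> : H (z i j.+1) = H (z i j) by exact: spath_nil.
    rewrite /z iN divff ?gt_eqF//.
    by have [-> _ _] := bd _ (frac _ jn); have [-> _ _] := bd _ (frac _ (ltnW jn)).
  have /length_ballP[l /string_spath[p sp] le] :
      length_ball (H (z i j)) (e / 2) (H (z i j.+1)).
    apply: dball; [exact: Qz iin (ltnW jn)|exact: Qz| |exact: fracS].
    by rewrite /= subrr normr0.
  exists p; split; first by exists l.
  by split=> [E|E]; [rewrite E eqxx in i0|rewrite E eqxx in nn].
pose v i j := if pselect ((i < n)%N /\ (j <= n)%N) is left h then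
  projT1 (cid (vertical i j h.1 h.2)) else [::].
pose w i j := if pselect ((i <= n)%N /\ (j < n)%N) is left h then
  projT1 (cid (horizontal i j h.1 h.2)) else [::].
have vP i j : (i < n)%N -> (j <= n)%N ->
    good i j i.+1 j (v i j) /\ (j = 0%N \/ j = n -> v i j = [::]).
  move=> h1 h2; rewrite /v; case: pselect => [h|[]//].
  exact: (projT2 (cid (vertical i j h.1 h.2))).
have wP i j : (i <= n)%N -> (j < n)%N ->
    good i j i j.+1 (w i j) /\ (i = 0%N -> w i j = h0 j) /\ (i = n -> w i j = [::]).
  move=> h1 h2; rewrite /w; case: pselect => [h|[]//].
  exact: (projT2 (cid (horizontal i j h.1 h.2))).
have sq i j : (i < n)%N -> (j < n)%N ->
    homot (v i j.+1 ++ w i j) (w i.+1 j ++ v i j).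
  move=> iin jn.
  have [[[l1 s1 p1] _] [[l2 s2 p2] _]] := (wP i j (ltnW iin) jn, vP i j.+1 iin jn).
  have [[[l3 s3 p3] _] [[l4 s4 p4] _]] := (vP i j iin (ltnW jn), wP i.+1 j iin jn).
  apply: (short _ _ _ _ _ _ (Qz i j (ltnW iin) (ltnW jn)) (spath_cat p1 p2)
    (spath_cat p3 p4)); lra.
have strip i j : (i < n)%N -> (j <= n)%N ->
    homot (v i j ++ concat (w i) j) (concat (w i.+1) j ++ v i 0%N).
  move=> iin; elim: j => [_|j IH jn] /=; first by rewrite cats0; exact: homotopic_refl.
  rewrite catA; apply: homotopic_trans (homotopic_cat (sq i j iin jn) (homotopic_refl _ _ _)) _.
  rewrite -!catA; apply: homotopic_cat; [exact: homotopic_refl|exact/IH/ltnW].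
have rows i : (i <= n)%N -> homot (concat (w 0%N) n) (concat (w i) n).
  elim: i => [_|i IH iin]; first exact: homotopic_refl.
  apply: homotopic_trans (IH (ltnW iin)) _; have := strip i n iin (leqnn n).
  by rewrite (vP i n iin (leqnn n)).2 ?(vP i 0%N iin (leq0n n)).2 ?cats0//; [left|right].
rewrite (@concat_ext h0 (w 0%N) n) => [|j jn]; last by rewrite (wP 0%N j _ jn).2.1.
suff -> : [::] = concat (w n) n by exact: rows.
rewrite (@concat_ext (w n) (fun=> [::]) n) => [|j jn]; last by rewrite (wP n j _ jn).2.2.
by elim: (n).
Qed.

End Square.

End EdgeHomotopy.

(** * Edge paths in a simply connected complex *)

Section EdgePaths.
Context {R : realType} (X : cubeComplex R).
Implicit Types (p q : seq (R -> X)) (l r d : R) (v w : X).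

Local Notation homot := (homotopic (@erev R X) (@square R X)).

Fixpoint epath v p w : Prop :=
  if p is e :: q then [/\ is_edge e, e 1 = w & epath v q (e 0)] else v = w.

Lemma epath_cat v w z p q : epath v p w -> epath w q z -> epath v (q ++ p) z.
Proof.
by move=> vw; elim: q z => /= [z <-//|e q IH z [he ez /IH]]; split.
Qed.

Lemma epath_catP v z p q : epath v (q ++ p) z -> exists2 w, epath v p w & epath w q z.
Proof.
elim: q z => /= [z vz|e q IH z [he ez /IH[w vw wz]]]; first by exists z.
by exists w.
Qed.

Lemma epath_end v p w w' : epath v p w -> epath v p w' -> w = w'.
Proof. by case: p => [<-//|e p [_ <- _] [_ <-]]. Qed.

Lemma epath_rev v w p : epath v p w -> epath w (inv_path p) v.
Proof.
elim: p w => /= [w ->//|e p IH w [he ew /IH vp]].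
rewrite /inv_path /= rev_cons -cats1.
apply: (epath_cat (w := e 0)) vp; split; first exact: erev_edge.
  by rewrite /erev subrr.
by rewrite /= /erev subr0.
Qed.

Lemma epath_homotopic_loop v w p q :
  (forall x s, epath x s x -> homot s [::]) ->
  epath v p w -> epath v q w -> homot p q.
Proof.
move=> loops vp vq; apply: (@homotopic_catIr _ _ _ _ (inv_path q)).
apply: homotopic_trans (loops w _ _) _; first exact: epath_cat (epath_rev vq) vp.
exact/homotopic_sym/inv_pathK.
Qed.

(** The vertex behind [base_corner], without reference to a cube. It fixes the vertices of [X], so
    the edge path of a string between vertices has the same ends. *)
Definition base_point v : X :=
  let s := cid (open_cell_cover v) in chart X (projT1 s) (vtx (fun=> false)).

Lemma base_pointE c x : open_cube R (coord c) x ->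
  base_point (chart X c x) = chart X c (vtx (fun=> false)).
Proof.
move=> ox; rewrite /base_point; case: (cid _) => c' [x' [ox' E]] /=.
exact: (congr1 (fun s : {c & coord c -> R} => chart X (projT1 s) (vtx (fun=> false)))
  (open_cell_inj ox' ox E)).
Qed.

Lemma base_corner_point c x u : base_corner (X := X) x u ->
  chart X c (vtx u) = base_point (chart X c x).
Proof.
move=> [c' [m [y [fm oy <- ->]]]]; rewrite -fm; last exact: open_cubeW.
by rewrite base_pointE// fm ?ev_vtx//; exact: vtx_cube.
Qed.

Lemma base_corner_vtx (c : cell X) (u w : coord c -> bool) : base_corner (X := X) (vtx u) w -> w = u.
Proof.
move=> [c' [m [y [fm oy E ->]]]]; apply/funext => t.
have Et := congr1 (fun F => F t) E.
have out a : cfun m a != t.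
  apply/eqP => ta; have : 0 < ev m y t < 1 by apply/(in_open m t oy); exists a.
  by rewrite Et /vtx; case: (u t); rewrite ltxx ?andbF.
rewrite evb_out//; move: Et; rewrite ev_out// /vtx.
by case: (u t); case: (cconst m t) => // /eqP; rewrite ?oner_eq0// eq_sym oner_eq0.
Qed.

Lemma base_point_vertex v : is_vertex v -> base_point v = v.
Proof.
move=> [k <-]; have [u uk] := base_corner_ex (X := X) (vtx_cube (@corner_vtx _ _ k)).
by rewrite -(base_corner_point uk) (base_corner_vtx uk).
Qed.

Lemma cube_path_epath (c : cell X) (u w : coord c -> bool) p : cube_path (X := X) u w p ->
  epath (chart X c (vtx u)) p (chart X c (vtx w)).
Proof.
move=> [s -> ->]; elim: s => //= a s IH; split; last by rewrite dedge0.
  by exists c, (dest u s), a.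
by rewrite dedge1.
Qed.

Lemma spath_epath v w l p : spath v w l p -> epath (base_point v) p (base_point w).
Proof.
elim=> // y z l1 m1 p1 q _ vp [c [a [b [u [t [_ [Ea Eb] _ [ua tb] ut]]]]]].
apply: epath_cat vp _; rewrite -Ea -Eb -(base_corner_point ua) -(base_corner_point tb).
exact: cube_path_epath.
Qed.

Lemma epath_base v p w : epath v p w -> is_vertex w -> is_vertex v.
Proof.
elim: p w => /= [w ->//|e p IH w [[c [u [a ->]]] _ /IH vp] _].
by apply: vp; rewrite dedge0; exists (Corner u).
Qed.

Lemma concat_add (f : nat -> seq (R -> X)) m k :
  concat f (m + k) = concat (fun j => f (m + j)%N) k ++ concat f m.
Proof. by elim: k => [|k IH]; rewrite ?addn0// addnS /= IH catA. Qed.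

Lemma segment_along (c : cell X) (u : coord c -> bool) a (s t : R) :
  0 <= s -> s <= t -> t <= 1 -> edist (along u a s) (along u a t) = t - s.
Proof.
move=> s0 st t1; rewrite /edist (bigD1 a)//= big1 ?addr0; last first.
  by move=> b ba; rewrite /along (negPf ba) subrr expr0n.
rewrite /along eqxx sqrtr_sqr flipr_dist distrC ger0_norm// subr_ge0//.
Qed.

(** The grid requires short pieces. Their edge paths stay in the cube presenting [e] and lead from
    its corner [u] to [flipc u a], as [e] does. *)
Lemma edge_subdivision (e : R -> X) k : is_edge e -> (0 < k)%N ->
  exists2 f : nat -> seq (R -> X),
    forall i, (i < k)%N -> seg_path (e (i%:R / k%:R)) (e (i.+1%:R / k%:R)) (k%:R^-1) (f i) &
    homot (concat f k) [:: e].
Proof.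
move=> [c [u [a ->]]] k0; have k0R : 0 < k%:R :> R by rewrite ltr0n.
have frac i : (i <= k)%N -> 0 <= (i%:R / k%:R : R) <= 1.
  by move=> ik; rewrite divr_ge0 ?ler0n// ler_pdivrMr// mul1r ler_nat.
have corner i : exists w : coord c -> bool, (i <= k)%N -> base_corner (X := X) (along u a (i%:R / k%:R)) w.
  have [ik|] := leqP i k; last by exists u.
  have [w bw] := base_corner_ex (X := X) (along_cube u a (frac _ ik)).
  by exists w.
have [b bP] := choice corner.
have [f fP] := choice (fun i => cube_path_ex (X := X) (b i) (b i.+1)).
exists f => [i ik|].
  exists c, (along u a (i%:R / k%:R)), (along u a (i.+1%:R / k%:R)), (b i), (b i.+1).
  have f1 := frac _ (ltnW ik); have f2 := frac _ ik.
  split=> //.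
  - by split; exact: along_cube.
  - by rewrite /dedge !clamp_id.
  - rewrite segment_along; last by case/andP: f2.
    + by rewrite -mulrBl -natr1 addrAC subrr add0r mul1r.
    + by case/andP: f1.
    + by rewrite ler_pM2r ?invr_gt0// ler_nat.
  - by split; apply: bP; rewrite // ltnW.
have b0 : b 0%N = u.
  by apply: base_corner_vtx; rewrite -(along0 u a); have := bP 0%N (leq0n _); rewrite mul0r.
have bk : b k = flipc u a.
  by apply: base_corner_vtx; rewrite -along1; have := bP k (leqnn _); rewrite divff ?gt_eqF.
apply: cube_path_homotopic (cube_path1 u a); rewrite -bk -b0.
by elim: (k) => [|i IH] /=; [exact: cube_path_nil|exact: cube_path_cat IH (fP i)].
Qed.

(* Contrary to epath, the head of the list is the first edge. *)
Fixpoint chrono v (s : seq (R -> X)) w : Prop :=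
  if s is e :: t then [/\ is_edge e, e 0 = v & chrono (e 1) t w] else v = w.

Fixpoint param (s : seq (R -> X)) w (t : R) : X :=
  if s is e :: s' then if t <= 1 then e t else param s' w (t - 1) else w.

Lemma epath_chrono v p w : epath v p w -> chrono v (rev p) w.
Proof.
elim: p w => //= e p IH w [he <- /IH]; rewrite rev_cons -cats1 => {IH}.
elim: (rev p) v => /= [v ->//|f s IH v [hf <- /IH]]; by split.
Qed.

Lemma param0 v s w : chrono v s w -> param s w 0 = v.
Proof. by case: s => [//|e s] /= [_ <- _]; rewrite ler01. Qed.

Lemma param_tail v e s w t : chrono v (e :: s) w -> 1 <= t ->
  param (e :: s) w t = param s w (t - 1).
Proof.
move=> /= [_ _ es] t1; case: ifP => // tle.
have -> : t = 1 by lra.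
by rewrite subrr (param0 es).
Qed.

Lemma param_end v s w : chrono v s w -> param s w (size s)%:R = w.
Proof.
elim: s v => [//|e s IH] v es; rewrite (param_tail es) ?ler1n//.
by case: es => _ _ /IH; rewrite /= -natr1 addrK.
Qed.

Lemma param_segment (e : R -> X) (s t : R) : is_edge e -> 0 <= s -> s <= t -> t <= 1 ->
  segment_length (e s) (e t) (t - s).
Proof.
move=> [c [u [a ->]]] s0 st t1; exists c, (along u a s), (along u a t).
have hs : 0 <= s <= 1 by rewrite s0/=; lra.
have ht : 0 <= t <= 1 by rewrite t1 andbT; lra.
by split; rewrite ?segment_along// /dedge ?clamp_id//; exact: along_cube.
Qed.

Lemma param_string v p w s t : chrono v p w -> 0 <= s -> s <= t -> t <= (size p)%:R ->
  string_length (param p w s) (param p w t) (t - s).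
Proof.
elim: p v s t => [|e p IH] v s t vp s0 st.
  by rewrite /= => t0; have -> : t - s = 0; [lra|exact: string_nil].
rewrite [size _]/= -natr1 => tp; have [he _ ep] := vp.
have [s1|s1] := leP 1 s.
  rewrite !(param_tail vp)//; last by lra.
  by have -> : t - s = (t - 1) - (s - 1); [lra|apply: IH ep _ _ _; lra].
have [t1|t1] := leP t 1.
  rewrite /= t1 ltW// -[t - s]addr0; apply: string_cons (string_nil _).
  exact: param_segment.
have -> : t - s = (1 - s) + ((t - 1) - 0) by lra.
rewrite (param_tail vp (ltW t1)); apply: (@string_cons _ _ _ (e 1)).
  by rewrite /= ltW//; apply: param_segment => //; lra.
by rewrite -(param0 ep); apply: IH ep _ _ _; lra.
Qed.

Lemma chrono_subdivision v p w k : chrono v p w -> (0 < k)%N ->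
  exists2 f : nat -> seq (R -> X),
    forall i, (i < size p * k)%N ->
      seg_path (param p w (i%:R / k%:R)) (param p w (i.+1%:R / k%:R)) (k%:R^-1) (f i) &
    homot (concat f (size p * k)) (rev p).
Proof.
move=> vp k0; have k0R : 0 < k%:R :> R by rewrite ltr0n.
elim: p v vp => [|e p IH] v vp; first by exists (fun=> [::]) => //; exact: homotopic_refl.
have [he _ ep] := vp.
have [f fP fe] := edge_subdivision he k0; have [g gP gp] := IH _ ep.
exists (fun i => if (i < k)%N then f i else g (i - k)%N) => [i ik|].
  case: ifP => [lik|/negbT]; last rewrite -leqNgt => kik.
    have small j : (j <= k)%N -> param (e :: p) w (j%:R / k%:R) = e (j%:R / k%:R).
      by move=> jk; rewrite /= ler_pdivrMr// mul1r ler_nat jk.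
    by rewrite !small//; [exact: fP|exact: ltnW].
  have large j : (k <= j)%N -> param (e :: p) w (j%:R / k%:R) = param p w ((j - k)%N%:R / k%:R).
    move=> kj; rewrite (param_tail vp); last by rewrite ler_pdivlMr// mul1r ler_nat.
    by rewrite natrB// mulrBl divff// gt_eqF.
  rewrite !large//; last exact: leqW.
  rewrite subSn//; apply: gP.
  by move: ik; rewrite /= mulSn; lia.
rewrite /= mulSn concat_add rev_cons -cats1; apply: homotopic_cat.
  suff -> : concat (fun j => if (k + j < k)%N then f (k + j)%N else g (k + j - k)%N) (size p * k)
    = concat g (size p * k) by [].
  by apply: concat_ext => j _; rewrite ltnNge leq_addr/= addKn.
suff -> : concat (fun i => if (i < k)%N then f i else g (i - k)%N) k = concat f k by [].
by apply: concat_ext => j ->.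
Qed.

Lemma string_ball v w l d : string_length v w l -> l < d -> length_ball v d w.
Proof. by move=> s ld; apply/length_ballP; exists l. Qed.

(** The loop is run at constant speed and its contraction is cut into [size s * k.+1] strips each
    way: the vertices of the loop become grid points, a step along the loop has length [k.+1%:R^-1],
    and this and the mesh are below [d]. *)
Theorem epath_loop_homotopic v p : simply_connected R X -> epath v p v -> homot p [::].
Proof.
move=> [_ _ contract] vp; have cp := epath_chrono vp.
have [->|p0] := eqVneq p [::]; first exact: homotopic_refl.
set s := rev p in cp; have s0 : (0 < size s)%N by rewrite size_rev; case: (p) p0.
have sR : 0 < (size s)%:R :> R by rewrite ltr0n.
pose gamma t : X := param s v ((size s)%:R * t).
have string t t' : 0 <= t -> t <= t' -> t' <= 1 ->
    string_length (gamma t) (gamma t') ((size s)%:R * (t' - t)).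
  move=> t0 tt' t1; rewrite mulrBr; apply: param_string cp _ _ _.
  - by rewrite mulr_ge0// ltW.
  - by rewrite ler_pM2l.
  - by rewrite -[X in _ <= X]mulr1 ler_pM2l.
have cgamma : {within `[0, 1], continuous gamma}.
  apply/subspace_continuousP => t; rewrite /= in_itv/= => /andP[t0 t1].
  apply/cvg_ballP => e e0; rewrite /within /prop_near1/=; apply/nbhs_ballP.
  exists (e / (size s)%:R) => [|t' /= tt']; first by rewrite /= divr_gt0.
  rewrite in_itv/= => /andP[t0' t1']; move: tt'.
  rewrite /ball/= ltr_pdivlMr// mulrC => tt'.
  have [le|/ltW le] := leP t t'.
    apply: string_ball (string _ _ t0 le t1') _.
    by apply: le_lt_trans tt'; rewrite ler_pM2l// distrC ler_norm.
  apply: length_ball_sym; apply: string_ball (string _ _ t0' le t1) _.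
  by apply: le_lt_trans tt'; rewrite ler_pM2l// ler_norm.
have g0 : gamma 0 = v by rewrite /gamma mulr0 (param0 cp).
have g1 : gamma 1 = v by rewrite /gamma mulr1 (param_end cp).
have [H [cH bH]] := contract _ cgamma (etrans g0 (esym g1)).
have [d d0 grid] := grid_homotopic cH.
have [k kd] : exists k : nat, k.+1%:R^-1 < d :> R.
  have [k /= kd] := ltr_add_invr d0.
  by exists k; rewrite add0r in kd.
have k0R : 0 < k.+1%:R :> R by rewrite ltr0n.
have [f fP fs] := chrono_subdivision cp (ltn0Sn k).
rewrite -[p]revK; apply: homotopic_trans (homotopic_sym fs) _.
have H0 t : 0 <= t <= 1 -> H (0, t) = gamma t by move=> /bH[].
apply: grid.
- by rewrite muln_gt0 s0.
- apply: le_lt_trans kd; rewrite lef_pV2 ?posrE ?ltr0n ?muln_gt0 ?s0// ler_nat.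
  by rewrite leq_pmull.
- move=> t t01; have [_ a b c] := bH t t01; rewrite a b c.
  by rewrite (H0 0) ?lexx ?ler01.
move=> j jn; exists (k.+1%:R^-1) => //.
have pt i : (i <= size s * k.+1)%N -> H (0, i%:R / (size s * k.+1)%N%:R) =
    param s v (i%:R / k.+1%:R).
  move=> iin; rewrite H0.
    by rewrite /gamma natrM; congr param; field; rewrite !gt_eqF.
  rewrite divr_ge0 ?ler0n// ler_pdivrMr ?ltr0n ?muln_gt0 ?s0//.
  by rewrite mul1r ler_nat.
by rewrite !pt//; [apply: spath_seg; exact: fP|exact: ltnW].
Qed.

Theorem epath_connected v w : simply_connected R X -> is_vertex v -> is_vertex w ->
  exists p, epath v p w.
Proof.
move=> [_ connected _] vv vw; have [gamma [cg g0 g1]] := connected v w.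
(* The path is viewed as a map of the square, to which [uniform_near_square] applies. *)
pose H (z : R * R) := gamma z.2.
have cH : {within `[0, 1] `*` `[0, 1] : set (R * R), continuous H}.
  apply/subspace_continuousP => -[s t] [/= s01 t01].
  have /subspace_continuousP/(_ t t01) cgt := cg.
  apply/cvg_ballP => e e0; have /cvg_ballP/(_ e e0) := cgt.
  rewrite /within /prop_near1/= => /nbhs_ballP[r r0 rP].
  apply/nbhs_ballP; exists r => // -[s' t'] /= [_ tt'] [_ t01']; exact: rP.
have [d d0 dP] := uniform_near_square cH ltr01.
have [k kd] : exists k : nat, k.+1%:R^-1 < d :> R.
  have [k /= kd] := ltr_add_invr d0.
  by exists k; rewrite add0r in kd.
have k0R : 0 < k.+1%:R :> R by rewrite ltr0n.
have path i : (i <= k.+1)%N -> exists p, epath v p (base_point (gamma (i%:R / k.+1%:R))).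
  elim: i => [_|i IH ik]; first by exists [::]; rewrite /= mul0r g0 base_point_vertex.
  have [p vp] := IH (ltnW ik).
  have frac j : (j <= k.+1)%N -> 0 <= (j%:R / k.+1%:R : R) <= 1.
    by move=> jk; rewrite divr_ge0 ?ler0n// ler_pdivrMr// mul1r ler_nat.
  have /length_ballP[l /string_spath[q sq] _] :
     length_ball (H (0, i%:R / k.+1%:R)) 1 (H (0, i.+1%:R / k.+1%:R)).
    apply: dP; rewrite /= ?subrr ?normr0//.
    + by split; rewrite /= in_itv/= ?lexx ?ler01// frac// ltnW.
    + by split; rewrite /= in_itv/= ?lexx ?ler01// frac.
    + by rewrite -mulrBl -natr1 opprD addNKr mulN1r normrN ger0_norm// invr_ge0 ltW.
  by exists (q ++ p); apply: epath_cat vp (spath_epath sq).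
have [p vp] := path _ (leqnn _).
by exists p; move: vp; rewrite divff ?gt_eqF// g1 base_point_vertex.
Qed.

End EdgePaths.

(** * Finiteness of the vertices in a compact set and of the edges at a vertex *)

Lemma finite_image_inj (T U : Type) (A : set T) (f : T -> U) :
  (forall x y, A x -> A y -> f x = f y -> x = y) ->
  finite_set (f @` A) -> finite_set A.
Proof.
move=> inj fA; have /inj_card_eq/eq_finite_set <- // : {in A &, injective f}.
by move=> x y /set_mem Ax /set_mem Ay; exact: inj.
Qed.

Section Finiteness.
Context {R : realType} (X : cubeComplex R).
Implicit Types (v w : X) (e : R -> X).

(** Points with coordinates in a discrete set [A] are uniformly separated, which turns compactness
    into finiteness. [A] is adapted to vertices and to marked points of edges. *)
Lemma discrete_eq (A : set R) (delta : R) (c0 c1 : cell X) x0 x1 :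
  A 0 -> A 1 -> (forall s, A s -> A (1 - s)) ->
  (forall s t, A s -> A t -> `|s - t| < delta -> s = t) ->
  open_cube R (coord c0) x0 -> open_cube R (coord c1) x1 ->
  (forall a, A (x0 a)) -> (forall a, A (x1 a)) ->
  length_ball (chart X c0 x0) delta (chart X c1 x1) ->
  chart X c1 x1 = chart X c0 x0.
Proof.
move=> A0 A1 AB gap ox0 ox1 A0x A1x /length_ballP[l /string_spath[p sp] ld].
have n := spath_nearby A0 A1 AB gap A0x ox0 sp ld.
exact: (nearby_eq A0 A1 AB gap A0x ox0 ox1 A1x n ld).
Qed.

Lemma finite_separated (U S : set X) (d : R) : compact U -> S `<=` U -> 0 < d ->
  (forall v w, S v -> S w -> length_ball v d w -> v = w) -> finite_set S.
Proof.
move=> cU SU d0 sep; apply/finite_setPn => /card_leP[u].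
pose v k : X := val (u (SigSub (in_setT k))).
have Sv k : S (v k) by exact/set_mem/valP.
have vI : injective v.
  move=> i j /val_inj/inj E; have := E (in_setT _) (in_setT _).
  by move=> /(congr1 val).
have [] := cU (v @ \oo) _ _.
  by exists 0%N => // k _; exact: SU (Sv k).
move=> x [_ clx]; have d2 : 0 < d / 2 by lra.
have nx : nbhs x (ball x (d / 2)) by exact: nbhsx_ballx.
have [_ [[i _ <-] xi]] : (range v `&` ball x (d / 2)) !=set0.
  by apply: clx nx; exists 0%N => // k _; exists k.
have [_ [[k ik <-] xk]] : ((v @` [set k | (i < k)%N]) `&` ball x (d / 2)) !=set0.
  by apply: clx nx; exists i.+1 => // k ik; exists k.
have /vI E : v i = v k.
  apply: sep => //; have -> : d = d / 2 + d / 2 by lra.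
  by apply: length_ball_triangle xk; exact: length_ball_sym.
by move: ik; rewrite /= E ltnn.
Qed.

Lemma vertex_open v : is_vertex v -> exists c (x : coord c -> R),
  [/\ open_cube R (coord c) x, chart X c x = v & coord c -> False].
Proof.
move=> [k <-]; have [c [m [y [fm oy E]]]] := open_face (X := X) (vtx_cube (@corner_vtx _ _ k)).
exists c, y; split=> //; first by rewrite fm ?E//; exact: open_cubeW.
move=> a; have /(in_open m _ oy) : exists b, cfun m a = cfun m b by exists a.
by rewrite E /vtx; case: (corner_vtx _); rewrite ltxx ?andbF.
Qed.

Lemma finite_vertices (U : set X) : compact U -> finite_set [set v | U v /\ is_vertex v].
Proof.
move=> cU; apply: (finite_separated cU (d := 1)) => //= [v []//|v w [_ vv] [_ vw]].
have [c [x [ox Ex nc]]] := vertex_open vv; have [c' [x' [ox' Ex' nc']]] := vertex_open vw.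
rewrite -Ex -Ex' => /(discrete_eq (A := [set t | t = 0 \/ t = 1])) ->//=.
- by left.
- by right.
- by move=> t [->|->]; [right; rewrite subr0|left; rewrite subrr].
- move=> s t [->|->] [->|->] //; rewrite ?subr0 ?sub0r ?normrN normr1 ltxx//.
Qed.

Definition edges_from v : set (R -> X) := [set e | is_edge e /\ e 0 = v].

(** An edge is represented by its point at the parameter [t], small enough to stay in a compact
    neighbourhood of [v], and below 1/2 so as to determine the oriented edge. The separation comes
    from the gaps between 0, 1, [t] and [1 - t]. *)
Lemma finite_edges_from v : locally_compact [set: X] -> finite_set (edges_from v).
Proof.
move=> /(_ v I)[U nU [cU _]].
have [r r0 rU] : exists2 r : R, 0 < r & forall w, length_ball v r w -> U w.
  move: nU; rewrite /within/= /prop_near1 => /nbhs_ballP[r r0 rU].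
  by exists r => // w vw; exact: rU.
pose t := Num.min (r / 2) (1 / 3).
have t01 : 0 < t < 1 / 2.
  by rewrite /t lt_min gt_min; apply/andP; split; [apply/andP; split; lra|apply/orP; right; lra].
have tr : t < r by rewrite /t gt_min; apply/orP; left; lra.
apply: (@finite_image_inj _ _ _ (fun e => e t)) => [e e' [he _] [he' _]|].
  exact: edge_point_inj.
have [d d0 gap] := finite_gap [:: 0; 1; t; 1 - t].
pose A := [set` [:: 0; 1; t; 1 - t]].
apply: (finite_separated cU (d := d)) => //=.
  move=> _ [e [he ev] <-]; apply: rU; rewrite -ev; apply: (string_ball (l := t + 0)); last by rewrite addr0.
  apply: string_cons (string_nil _); rewrite -[X in segment_length _ _ X]subr0.
  by apply: param_segment => //; lra.
move=> _ _ [e [/edge_corner_ex[k ke] _] <-] [e' [/edge_corner_ex[k' ke'] _] <-].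
have [x [ox -> xA _]] := edge_corner_open ke t01.
have [x' [ox' -> xA' _]] := edge_corner_open ke' t01.
move=> /(discrete_eq (A := A)) -> //.
- by rewrite /A/= inE eqxx.
- by rewrite /A/= !inE eqxx orbT.
- move=> s; rewrite /A/= !inE => /or4P[]/eqP->;
    by rewrite ?subrr ?subr0 ?subKr eqxx ?orbT.
- by move=> a; rewrite /A/= !inE; case: (xA a) => ->; rewrite eqxx ?orbT.
- by move=> a; rewrite /A/= !inE; case: (xA' a) => ->; rewrite eqxx ?orbT.
Qed.

Lemma finite_reach v n : locally_compact [set: X] ->
  finite_set [set w | exists2 p, epath v p w & (size p <= n)%N].
Proof.
move=> lc; elim: n => [|n IH].
  apply: (@sub_finite_set _ _ [set v]); last exact: finite_set1.
  by move=> w [[|//]/= ->].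
set S := [set w | _] in IH.
apply: (@sub_finite_set _ _ (S `|` \bigcup_(w in S) (fun e => e 1) @` edges_from w)).
  move=> w [[|e p] /=]; first by move=> <- _; left; exists [::].
  move=> [he <- vp] pn; right; exists (e 0); first by exists p.
  by exists e.
rewrite finite_setU; split=> //; apply: bigcup_finite => // w _.
exact/finite_image/finite_edges_from.
Qed.

End Finiteness.

(** * Cubical isomorphisms *)

Section Isomorphisms.
Context {R : realType} (X Z : cubeComplex R) (f : X -> Z).
Hypothesis isof : cubical_iso f.

Lemma iso_inj : injective f.
Proof. exact: bij_inj isof.1. Qed.

Lemma iso_cell c : exists c' (m : cmap (coord c) (coord c')),
  (forall x, unit_cube R (coord c) x -> f (chart X c x) = chart Z c' (ev m x)) /\
  forall t, exists a, t = cfun m a.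
Proof.
have [c' [h [hi fh]]] := isof.2 c; exists c'.
have fE : cube_face (fun=> None) = unit_cube R (coord c').
  by apply/seteqP; split=> [x []//|x hx]; split.
rewrite -fE in hi; have [m [mh _ m2 _]] := isometry_cmap hi.
exists m; split=> [x hx|t]; first by rewrite fh// mh.
exact: m2.
Qed.

Lemma iso_dedge c : exists c' (m : cmap (coord c) (coord c')),
  (forall u, f (chart X c (vtx u)) = chart Z c' (vtx (evb m u))) /\
  forall u a, f \o dedge (X := X) u a = dedge (X := Z) (evb m u) (cfun m a).
Proof.
have [c' [m [fm _]]] := iso_cell c; exists c', m; split=> [u|u a].
  by rewrite fm ?ev_vtx//; exact: vtx_cube.
by apply/funext => t; rewrite /= /dedge fm ?ev_along//; exact/along_cube/clamp01.
Qed.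

Lemma iso_edge e : is_edge e -> is_edge (f \o e).
Proof.
by move=> [c [u [a ->]]]; have [c' [m [_ ->]]] := iso_dedge c;
  exists c', (evb m u), (cfun m a).
Qed.

Lemma iso_square e f' g e' : square e f' g e' ->
  square (f \o e) (f \o f') (f \o g) (f \o e').
Proof.
move=> [c [u [a [b [ab -> -> -> ->]]]]]; have [c' [m [_ fm]]] := iso_dedge c.
exists c', (evb m u), (cfun m a), (cfun m b); rewrite !fm !evb_flipc; split=> //.
by move=> /cfun_inj.
Qed.

Lemma iso_vertex v : is_vertex v -> is_vertex (f v).
Proof.
move=> [[c u] <-]; have [c' [m [fm _]]] := iso_dedge c.
by exists (Corner (evb m u)); rewrite /= fm.
Qed.

Lemma iso_epath v p w : epath v p w -> epath (f v) (map (fun e => f \o e) p) (f w).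
Proof.
elim: p w => /= [w ->//|e p IH w [he <- /IH]]; split=> //; exact: iso_edge.
Qed.

(** The centre of [c] is pulled back to [X]; the open cell found there is mapped onto an open cell
    meeting that of [c], which therefore is the open cell of [c]. *)
Lemma iso_cell_surj c : exists d (m : cmap (coord d) (coord c)),
  (forall x, unit_cube R (coord d) x -> f (chart X d x) = chart Z c (ev m x)) /\
  forall t, exists a, t = cfun m a.
Proof.
have [g fK gK] := isof.1.
pose z : coord c -> R := fun=> 1 / 2; have oz : open_cube R (coord c) z by move=> a; rewrite /z; lra.
have [d [x [ox Ex]]] := open_cell_cover (g (chart Z c z)).
have [c' [m [fm sm]]] := iso_cell d.
have omx : open_cube R (coord c') (ev m x).
  by move=> t; have [a ->] := sm t; rewrite ev_in; have := ox a; case: (cflip m a); rewrite /flipr//; lra.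
have E : chart Z c' (ev m x) = chart Z c z.
  by rewrite -fm ?Ex ?gK//; exact: open_cubeW.
have cc : c' = c by have /(congr1 (@projT1 _ _)) := open_cell_inj omx oz E.
by subst c'; exists d, m.
Qed.

End Isomorphisms.

(** * Products *)

Section ProductEdges.
Context {R : realType} (n : nat) (Y : 'I_n -> cubeComplex R).
Local Notation Z := (cube_product Y).

Definition corner_slice (c : cell Z) (u : coord c -> bool) i : coord (c i) -> bool :=
  fun b => u (Tagged (fun i => coord (c i)) b).

Lemma product_dedge (c : cell Z) (u : coord c -> bool) i (a : coord (c i)) t :
  dedge (X := Z) u (Tagged (fun i => coord (c i)) a) t i
    = dedge (X := Y i) (corner_slice u (i := i)) a t.
Proof.
rewrite /dedge; congr chart; apply/funext => b; rewrite /slice /along.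
by rewrite eq_Tagged.
Qed.

Lemma product_dedge_ne (c : cell Z) (u : coord c -> bool) s t j : tag s != j ->
  dedge (X := Z) u s t j = chart (Y j) (c j) (vtx (corner_slice u (i := j))).
Proof.
move=> sj; rewrite /dedge; congr chart; apply/funext => b; rewrite /slice /along.
by case: eqP => // E; rewrite -E eqxx in sj.
Qed.

End ProductEdges.

Section Factors.
Context {R : realType} (n : nat) (Y : 'I_n -> cubeComplex R) (X : cubeComplex R).
Variable f : X -> cube_product Y.
Hypothesis isof : cubical_iso f.
Implicit Types (i j k : 'I_n) (e : R -> X) (v w : X).

Definition pos v i : Y i := f v i.

Lemma pos_inj v w : (forall i, pos v i = pos w i) -> v = w.
Proof.
by move=> vw; apply: (iso_inj isof); apply/functional_extensionality_dep.
Qed.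

(** Read off from the coordinates of the path, not from a presentation in a cube, so that the type
    belongs to the edge itself. *)
Definition typed e i := is_edge e /\
  (exists c (u : coord c -> bool) a, forall t, pos (e t) i = dedge (X := Y i) u a t) /\
  forall j, j <> i -> forall t, pos (e t) j = pos (e 0) j.

Lemma typed_edge e i : typed e i -> is_edge e.
Proof. by case. Qed.

Lemma dedge_typed c : exists ty : coord c -> 'I_n,
  forall u a, typed (dedge (X := X) u a) (ty a).
Proof.
have [c' [m [_ fm]]] := iso_dedge isof c; exists (fun a => tag (cfun m a)) => u a.
have D t : f (dedge (X := X) u a t) = dedge (X := cube_product Y) (evb m u) (cfun m a) t.
  by rewrite -fm.
move: D; case: (cfun m a) => i b D; rewrite [tag _]/=.
split; first by exists c, u, a.
split; first by exists (c' i), (corner_slice (evb m u) (i := i)), b => t; rewrite /pos D; exact: product_dedge.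
move=> k /eqP; rewrite eq_sym => ki t; rewrite /pos !D.
by rewrite !product_dedge_ne.
Qed.

Lemma edge_typed e : is_edge e -> exists i, typed e i.
Proof. by move=> [c [u [a ->]]]; have [ty tyP] := dedge_typed c; exists (ty a). Qed.

Lemma edge_nonconstant e : is_edge e -> ~ (forall t, e t = e 0).
Proof.
move=> /edge_corner_ex[k ke] cst.
have q1 : 0 < (1 / 4 : R) < 1 / 2 by apply/andP; split; lra.
have q2 : 0 < (1 / 3 : R) < 1 / 2 by apply/andP; split; lra.
have [x [ox Ex xA _]] := edge_corner_open ke q1.
have [x' [ox' Ex' xA' _]] := edge_corner_open ke q2.
have xx : x = x' by apply: (open_inj ox ox'); rewrite -Ex -Ex' !cst.
have [a _] := dim1P ke.1; subst x'.
by case: (xA a) (xA' a) => -> [] ?; lra.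
Qed.

Lemma typed_uniq e i j : typed e i -> typed e j -> i = j.
Proof.
move=> [he [_ ei]] [_ [_ ej]]; apply/eqP; apply: contra_notT (edge_nonconstant he).
move=> /eqP ij t; apply: pos_inj => k.
by have [->|/eqP ki] := eqVneq k i; [exact: ej|exact: ei].
Qed.

Lemma typed_erev e i : typed e i -> typed (erev e) i.
Proof.
move=> te; have [c [u [a E]]] := typed_edge te.
have [ty tyP] := dedge_typed c.
have -> : i = ty a by apply: (typed_uniq te); rewrite E.
by rewrite E erev_dedge.
Qed.

Lemma square_typed e f' g e' i : square e f' g e' -> typed e i -> typed e' i.
Proof.
move=> [c [u [a [b [_ -> _ _ ->]]]]] te; have [ty tyP] := dedge_typed c.
by have -> : i = ty a by exact: typed_uniq te (tyP _ _).
Qed.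

Lemma square_typedV e f' g e' i : square e f' g e' -> typed e' i -> typed e i.
Proof.
move=> s te'; have [he _ _ _] := square_edges s; have [k tk] := edge_typed he.
by have <- : k = i by exact: typed_uniq (square_typed s tk) te'.
Qed.

Lemma typed_pos e i j : typed e i -> j <> i -> pos (e 1) j = pos (e 0) j.
Proof. by move=> [_ [_ ej]] ji; exact: ej. Qed.

Lemma vertex_corner v i : is_vertex v ->
  exists c (u : coord c -> bool), chart (Y i) c (vtx u) = pos v i.
Proof.
move=> [[c u] <-]; have [c' [m [fm _]]] := iso_dedge isof c.
by exists (c' i), (corner_slice (evb m u) (i := i)); rewrite /pos /= fm.
Qed.

(** Corners chosen independently in the factors come from one cube of [X]. This is the source of
    squares, of translated edges and of vertices with prescribed coordinates. *)
Lemma product_corner (s : forall i, {c : cell (Y i) & coord c -> bool}) :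
  exists d (w : coord d -> bool),
    (forall i, pos (chart X d (vtx w)) i = chart (Y i) _ (vtx (projT2 (s i)))) /\
    forall i a, exists b, typed (dedge (X := X) w b) i /\
      forall t, pos (dedge (X := X) w b t) i = dedge (projT2 (s i)) a t.
Proof.
pose c'' : cell (cube_product Y) := fun i => projT1 (s i).
pose u'' : coord c'' -> bool := fun t => projT2 (s (tag t)) (tagged t).
have [d [m [fm sm]]] := iso_cell_surj isof c''.
pose w b := cflip m b (+) u'' (cfun m b).
have mw : evb m w = u''.
  apply/funext => t; have [b ->] := sm t.
  by rewrite evb_in addbA addbb.
have fw : f (chart X d (vtx w)) = chart (cube_product Y) c'' (vtx u'').
  by rewrite fm ?ev_vtx ?mw//; exact: vtx_cube.
exists d, w; split=> [i|i a]; first by rewrite /pos fw.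
have [b Eb] := sm (Tagged (fun i => coord (c'' i)) a); exists b.
have D t : f (dedge (X := X) w b t) = dedge (X := cube_product Y) u'' (cfun m b) t.
  by rewrite /dedge fm ?ev_along ?mw//; exact/along_cube/clamp01.
have P t : pos (dedge (X := X) w b t) i = dedge (projT2 (s i)) a t.
  by rewrite /pos D -Eb product_dedge.
split=> //; split; first by exists d, w, b.
split; first by exists (c'' i), (projT2 (s i)), a.
by move=> k /eqP; rewrite eq_sym => ki t; rewrite /pos !D -Eb !product_dedge_ne.
Qed.

(** In factor [i] the corner carrying [e] is taken, in factor [j] the one carrying [g], elsewhere
    any corner presenting the vertex; the cube over them contains both edges. *)
Lemma typed_square e g i j : typed e i -> typed g j -> i <> j -> e 0 = g 0 ->
  exists f' e', square e f' g e'.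
Proof.
move=> te tg ij eg.
have [_ [[ci [ui [ai Ei]]] Ee]] := te; have [_ [[cj [uj [aj Ej]]] Eg]] := tg.
have ve : is_vertex (e 0).
  by have [c [u [a ->]]] := typed_edge te; rewrite dedge0; exists (Corner u).
have step k : exists s : {c : cell (Y k) & coord c -> bool},
    [/\ chart (Y k) _ (vtx (projT2 s)) = pos (e 0) k,
     k = i -> exists a, forall t, pos (e t) k = dedge (projT2 s) a t &
     k = j -> exists a, forall t, pos (g t) k = dedge (projT2 s) a t].
  have [->|/eqP ki] := eqVneq k i.
    exists (existT _ ci ui); split=> //; last by exists ai.
    by rewrite Ei dedge0.
  have [->|/eqP kj] := eqVneq k j.
    exists (existT _ cj uj); split=> // [|/esym//|_]; last by exists aj.
    by rewrite eg Ej dedge0.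
  by have [c [u E]] := vertex_corner k ve; exists (existT _ c u).
pose s k := projT1 (cid (step k)).
have [sv [si sj]] : (forall k, chart (Y k) _ (vtx (projT2 (s k))) = pos (e 0) k) /\
    (exists a, forall t, pos (e t) i = dedge (projT2 (s i)) a t) /\
    (exists a, forall t, pos (g t) j = dedge (projT2 (s j)) a t).
  split; first by move=> k; have [] := projT2 (cid (step k)).
  by split; [have [_ + _] := projT2 (cid (step i))|have [_ _ +] := projT2 (cid (step j))]; exact.
have [d [w [dw dirs]]] := product_corner s.
have same k h a b : typed h k -> h 0 = e 0 -> (forall t, pos (h t) k = dedge (projT2 (s k)) a t) ->
    typed (dedge (X := X) w b) k ->
    (forall t, pos (dedge (X := X) w b t) k = dedge (projT2 (s k)) a t) ->
    h = dedge (X := X) w b.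
  move=> [_ [_ hc]] h0 ha [_ [_ bc]] ba; apply/funext => t; apply: pos_inj => l.
  have [->|/eqP lk] := eqVneq l k; first by rewrite ha ba.
  by rewrite hc// bc// h0 dedge0 dw sv.
have [a Ea] := si; have [b [tb Eb]] := dirs i a.
have [a' Ea'] := sj; have [b' [tb' Eb']] := dirs j a'.
exists (dedge (flipc w b) b'), (dedge (flipc w b') b), d, w, b, b'; split=> //.
- by move=> bb; apply: ij; apply: typed_uniq tb _; rewrite bb.
- exact: same te erefl Ea tb Eb.
- exact: same tg (esym eg) Ea' tb' Eb'.
Qed.

Lemma translate_edge e i v : typed e i -> is_vertex v -> pos v i = pos (e 0) i ->
  exists e', [/\ typed e' i, e' 0 = v & pos (e' 1) i = pos (e 1) i].
Proof.
move=> te vv vi; have [_ [[ci [ui [ai Ei]]] Ee]] := te.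
have step k : exists s : {c : cell (Y k) & coord c -> bool},
    chart (Y k) _ (vtx (projT2 s)) = pos v k /\
    (k = i -> exists a, forall t, pos (e t) k = dedge (projT2 s) a t).
  have [->|/eqP ki] := eqVneq k i.
    exists (existT _ ci ui); split=> //; last by exists ai.
    by rewrite vi Ei dedge0.
  by have [c [u E]] := vertex_corner k vv; exists (existT _ c u).
pose s k := projT1 (cid (step k)).
have sv k : chart (Y k) _ (vtx (projT2 (s k))) = pos v k.
  by have [] := projT2 (cid (step k)).
have [a Ea] : exists a, forall t, pos (e t) i = dedge (projT2 (s i)) a t.
  by have [_ +] := projT2 (cid (step i)); exact.
have [d [w [dw dirs]]] := product_corner s.
have [b [tb Eb]] := dirs i a; exists (dedge w b); split=> //.
  by rewrite dedge0; apply: pos_inj => k; rewrite dw sv.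
by rewrite Eb Ea.
Qed.

Lemma vertex_of (v : 'I_n -> X) : (forall i, is_vertex (v i)) ->
  exists2 w, is_vertex w & forall i, pos w i = pos (v i) i.
Proof.
move=> vv; have step k : exists s : {c : cell (Y k) & coord c -> bool},
    chart (Y k) _ (vtx (projT2 s)) = pos (v k) k.
  by have [c [u E]] := vertex_corner k (vv k); exists (existT _ c u).
have [d [w [dw _]]] := product_corner (fun k => projT1 (cid (step k))).
exists (chart X d (vtx w)); first by exists (Corner w).
by move=> i; rewrite dw; exact: projT2 (cid (step i)).
Qed.

Definition type_count i p := count (fun e => `[< typed e i >]) p.

Lemma epath_vertex0 v p w : epath v p w -> is_vertex v -> is_vertex w.
Proof.
by move=> /epath_rev /epath_base.
Qed.

Lemma project_path i a p b v : epath a p b -> is_vertex v -> pos v i = pos a i ->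
  exists s w, [/\ epath v s w, forall j, (0 < type_count j s)%N -> j = i, 
    size s = type_count i p, pos w i = pos b i & forall j, j <> i -> pos w j = pos v j].
Proof.
move=> + vv va; elim: p b => /= [b ab|e p IH b [he <- ap]].
  by exists [::], v; split=> //=; rewrite va ab.
have [s [w [vs ts ss wi wj]]] := IH _ ap.
have [j tj] := edge_typed he; rewrite /type_count /=.
have [Eij|ij] := eqVneq j i; last first.
  exists s, w; split=> //.
    rewrite ss; case: asboolP => // ti.
    by move: ij; rewrite (typed_uniq tj ti) eqxx.
  by rewrite wi (typed_pos tj)//; apply/nesym/eqP.
rewrite {j}Eij in tj.
have [e' [te' e'0 e'1]] := translate_edge tj (epath_vertex0 vs vv) wi.
exists (e' :: s), (e' 1); split.
- by split=> //; [exact: typed_edge te'|rewrite e'0].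
- move=> j; rewrite /type_count/=; case: asboolP => [te'j _|_].
    exact: typed_uniq te'j te'.
  by rewrite add0n; exact: ts.
- by rewrite /= ss (asboolT tj).
- exact: e'1.
- by move=> j ji; rewrite (typed_pos te')// e'0; exact: wj.
Qed.

(** The coordinates are changed one by one, the [i]-th by the edges of type [i] of [p i]; [J] lists
    those already changed. Only the [i]-th coordinates of [a i] and [b i] matter, so paths from
    different parts of [X] can be combined. *)
Lemma splice_paths (a b : 'I_n -> X) (p : 'I_n -> seq (R -> X)) v w :
  (forall i, epath (a i) (p i) (b i)) -> is_vertex v ->
  (forall i, pos v i = pos (a i) i) -> (forall i, pos w i = pos (b i) i) ->
  exists s, [/\ epath v s w, size s = (\sum_i type_count i (p i))%N &
    forall i, (0 < type_count i s)%N -> (0 < type_count i (p i))%N].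
Proof.
move=> ep vv va wb.
suff H (J : seq 'I_n) : uniq J -> exists s z, [/\ epath v s z, 
    size s = (\sum_(i <- J) type_count i (p i))%N,
    forall i, (0 < type_count i s)%N -> (0 < type_count i (p i))%N,
    forall i, i \in J -> pos z i = pos w i & forall i, i \notin J -> pos z i = pos v i].
  have [s [z [vz ss ts zw _]]] := H _ (enum_uniq 'I_n).
  have <- : z = w by apply: pos_inj => i; apply: zw; rewrite mem_enum.
  by exists s; split=> //; rewrite ss big_enum.
elim: J => [_|i J IH /= /andP[iJ uJ]].
  by exists [::], v; split=> //=; rewrite big_nil.
have [s [z [vz ss ts zw zv]]] := IH uJ.
have [s' [z' [zz ts' ss' z'i z'j]]] := project_path (ep i) (epath_vertex0 vz vv)
  (etrans (zv i iJ) (va i)).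
exists (s' ++ s), z'; split.
- exact: epath_cat vz zz.
- by rewrite size_cat ss' ss big_cons.
- move=> j; rewrite /type_count count_cat addn_gt0 => /orP[h|]; last exact: ts.
  have E := ts' j h; subst j; apply: leq_trans h _; rewrite -/(type_count i (p i)) -ss'.
  exact: count_size.
- move=> j; rewrite inE; have [->|/eqP ji] := eqVneq j i; first by rewrite z'i wb.
  by move=> /= jJ; rewrite z'j//; exact: zw.
- move=> j; rewrite inE negb_or => /andP[/eqP ji jJ].
  by rewrite z'j//; exact: zv.
Qed.

End Factors.

(** * Finite sets and the pigeonhole principle *)

Lemma finite_seq_cover (T : Type) (A : set T) : finite_set A ->
  exists s : seq {classic T}, forall x, A x <-> (x : {classic T}) \in s.
Proof.
move=> fA; have [s sE] := (@finite_seqP {classic T} A).1 fA.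
by exists s => x; rewrite sE.
Qed.

Lemma finite_pigeonhole (T : Type) (A : set T) : finite_set A ->
  exists N, forall F : nat -> T, (forall k, (k <= N)%N -> A (F k)) ->
  exists k l, [/\ (k < l)%N, (l <= N)%N & F k = F l].
Proof.
move=> /finite_seq_cover[s sA]; exists (size s) => F FA.
pose t := [seq (F k : {classic T}) | k <- iota 0 (size s).+1].
have /uniqPn : ~~ uniq t.
  apply/negP => /uniq_leq_size sub.
  have /sub : {subset t <= s}.
    by move=> x /mapP[k]; rewrite mem_iota => /andP[_ ks] ->; apply/sA/FA.
  by rewrite size_map size_iota ltnn.
move=> /(_ (F 0%N))[k [l [kl lt]]].
rewrite size_map size_iota in lt.
rewrite !(nth_map 0%N) ?size_iota//; last exact: ltn_trans lt.
by rewrite !nth_iota ?add0n//; [exists k, l|exact: ltn_trans lt].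
Qed.

Lemma finite_card_bound (T : Type) (A : set T) : finite_set A ->
  exists N, forall (S : finType) (h : S -> T), injective h -> (forall a, A (h a)) ->
  (#|S| <= N)%N.
Proof.
move=> /finite_seq_cover[s sA]; exists (size s) => S h hI hA.
rewrite cardE -(size_map (h : S -> {classic T})); apply: uniq_leq_size.
  by rewrite map_inj_uniq ?enum_uniq.
by move=> x /mapP[a _ ->]; exact/sA.
Qed.

Lemma finite_subsets (T : Type) (A : set T) : finite_set A ->
  finite_set [set B | B `<=` A].
Proof.
move=> /finite_seq_cover[s sA].
pose g (phi : {ffun 'I_(size s) -> bool}) : set T :=
  [set x | exists2 i, phi i & tnth (in_tuple s) i = x].
apply: (@sub_finite_set _ _ (g @` setT)); last exact/finite_image/finite_finset.
move=> B BA; exists [ffun i => `[< B (tnth (in_tuple s) i) >]] => //.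
apply/seteqP; split=> x; first by move=> [i]; rewrite ffunE => /asboolP + <-.
move=> Bx; have [i xi] := seq_tnthP ((sA x).1 (BA _ Bx)).
by exists i => //; rewrite ffunE; apply/asboolP; rewrite -xi.
Qed.

Section ReducedPaths.
Context {R : realType} (X : cubeComplex R).
Implicit Types (p q : seq (R -> X)) (e : R -> X) (v w : X).
Local Notation flips := (flips (@square R X)).
Local Notation reduced := (reduced (@erev R X) (@square R X)).
Local Notation normal_form := (normal_form (@erev R X) (@square R X)).

Lemma flips_epath v p q w : flips p q -> epath v p w -> epath v q w.
Proof.
move=> pq; elim: pq v w => {p q} //=.
- by move=> p q r _ IH1 _ IH2 v w /IH1/IH2.
- move=> e f' f e' p s v w [_ <- [_ _ vp]].
  have [_ _ hf he'] := square_edges s; have [s1 s2 s3 s4] := square_ends s.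
  by split=> //; split=> //; rewrite -s1.
- by move=> e p q _ IH v w [he ew /IH]; split.
Qed.

Lemma normal_form_epath v p q w : normal_form p q -> epath v p w -> epath v q w.
Proof.
elim: p q w => /= [q w /(flips_sym (@square_sym R X))/flips_epath h vw|e p IH q w]; first exact: h.
move=> [q0 pq0 aq] [he <- /(IH _ _ pq0) vq0].
case: aq => [[_ /(flips_sym (@square_sym R X)) f]|f].
  by apply: flips_epath f _; split.
have /= [_ _] := flips_epath f vq0.
by rewrite /erev subr0.
Qed.

Lemma reduced_suffix p q : reduced (q ++ p) -> reduced p.
Proof. by elim: q => //= e q IH [/IH]. Qed.

End ReducedPaths.

(** * Reduced paths with many edges of each type *)

Section Diagonal.
Context {R : realType} (n : nat) (Y : 'I_n -> cubeComplex R) (X : cubeComplex R).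
Variable f : X -> cube_product Y.
Hypotheses (isof : cubical_iso f) (cat0 : CAT0_cube_complex X).
Implicit Types (i j : 'I_n) (p q : seq (R -> X)) (e : R -> X) (v w : X).

Local Notation flips := (flips (@square R X)).
Local Notation last_edges := (last_edges (@square R X)).
Local Notation reduced := (reduced (@erev R X) (@square R X)).
Local Notation homot := (homotopic (@erev R X) (@square R X)).
Local Notation pos := (pos f).
Local Notation typed := (typed f).
Local Notation type_count := (type_count f).

Let loops v p : epath v p v -> homot p [::].
Proof. exact: epath_loop_homotopic cat0.1. Qed.
Let joined v w : is_vertex v -> is_vertex w -> exists p, epath v p w.
Proof. exact: epath_connected cat0.1. Qed.
Let links := cat0.2.

Lemma type_count_cat i p q : type_count i (p ++ q) = (type_count i p + type_count i q)%N.
Proof. exact: count_cat. Qed.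

Lemma flips_type_count i p q : flips p q -> type_count i p = type_count i q.
Proof.
apply: flips_count; first exact: square_sym.
move=> e f' g e' s; apply/asboolP/asboolP; first exact: square_typed s.
exact: square_typedV s.
Qed.

Lemma homotopic_type_count i p q : homot p q -> reduced q ->
  (type_count i q <= type_count i p)%N.
Proof.
apply: homotopic_reduced_count.
- exact: erevK.
- exact: square_sym.
- exact: square_rot.
- exact: (square_det links).
- exact: (square_neq links).
- exact: (square_cube links).
- move=> e; apply/asboolP/asboolP; last exact: typed_erev.
  by move=> /(typed_erev isof); rewrite erevK.
- move=> e f' g e' s; apply/asboolP/asboolP; first exact: square_typed s.
  exact: square_typedV s.
Qed.

Lemma reduced_path v w : is_vertex v -> is_vertex w ->
  exists2 p, epath v p w & reduced p.
Proof.
move=> vv vw; have [p vp] := joined vv vw.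
have [q pq] := normal_form_ex (@erevK R X) (@square_sym R X) (@square_rot R X)
  (square_det links) (square_neq links) (square_cube links) p.
exists q; first exact: normal_form_epath pq vp.
exact: (normal_form_reduced (@erevK R X) (@square_sym R X) (@square_rot R X)
  (square_det links) (square_neq links) (square_cube links) pq).
Qed.

Lemma flips_reducedX p q : flips p q -> reduced p -> reduced q.
Proof.
exact: (flips_reduced (@erevK R X) (@square_sym R X) (@square_rot R X)
  (square_det links) (square_neq links) (square_cube links)).
Qed.

Lemma last_edges_consX e p g : last_edges (e :: p) g <->
  g = e \/ exists2 a, last_edges p a & exists b, square a e b g.
Proof.
exact: (last_edges_cons (@square_sym R X) (@square_rot R X)
  (square_det links) (square_cube links)).
Qed.

(** [splice_paths], with the empty path in factor [i] and one path from [v] to [w] in all the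
    others. *)
Lemma fiber_path i v w : is_vertex v -> is_vertex w -> pos v i = pos w i ->
  exists2 p, epath v p w & type_count i p = 0%N.
Proof.
move=> vv vw vwi; have [c vc] := joined vv vw.
have [|||s [vs _ ts]] := @splice_paths _ _ _ _ _ isof (fun=> v)
  (fun k => if k == i then v else w) (fun k => if k == i then [::] else c) v w _ vv.
- by move=> k; case: eqP.
- by [].
- by move=> k; case: eqP => [->|].
exists s => //; apply/eqP; rewrite -leqn0 leqNgt; apply/negP => /ts.
by rewrite eqxx.
Qed.

Lemma pos_string i v p w : epath v p w -> exists2 l, l <= (type_count i p)%:R &
  string_length (pos v i) (pos w i) l.
Proof.
elim: p w => /= [w ->|e p IH w [he <- /IH[l lp sl]]].
  by exists 0 => //; exact: string_nil.
rewrite /type_count/=; case: asboolP => [ti|nti].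
  have [_ [[c [u [a Ea]]] _]] := ti.
  exists (l + 1); first by rewrite natrD addrC lerD.
  have seg : segment_length (pos (e 0) i) (pos (e 1) i) 1.
    rewrite !Ea -[X in segment_length _ _ X]subr0; apply: param_segment => //.
    by exists c, u, a.
  by apply: string_cat sl _; have := string_cons seg (string_nil _); rewrite addr0.
have [j tj] := edge_typed isof he.
rewrite add0n (typed_pos tj); first by exists l.
by move=> ij; apply: nti; rewrite ij.
Qed.

Lemma factor_dim_bound D i (c : cell (Y i)) v : is_vertex v ->
  (forall d : cell X, #|coord d| <= D)%N -> (#|coord c| <= D)%N.
Proof.
move=> vv bD.
have step k : exists s : cell (Y k), k = i -> (#|coord c| <= #|coord s|)%N.
  have [->|/eqP ki] := eqVneq k i; first by exists c.
  by have [s _] := vertex_corner isof k vv; exists s.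
pose s : cell (cube_product Y) := fun k => projT1 (cid (step k)).
have [d [m [_ sm]]] := iso_cell_surj isof s.
apply: leq_trans (bD d); apply: leq_trans (projT2 (cid (step i)) erefl) _.
pose g (a : coord (s i)) : coord d := projT1 (cid (sm (Tagged (fun k => coord (s k)) a))).
have gI : injective g.
  move=> a b E; have Ea := projT2 (cid (sm (Tagged (fun k => coord (s k)) a))).
  have Eb := projT2 (cid (sm (Tagged (fun k => coord (s k)) b))).
  have : Tagged (fun k => coord (s k)) a == Tagged (fun k => coord (s k)) b.
    by rewrite Ea Eb -/(g a) -/(g b) E.
  by rewrite eq_Tagged => /eqP.
exact: leq_card gI.
Qed.

Lemma edist_cube (S : finType) (x y : S -> R) : unit_cube R S x -> unit_cube R S y ->
  edist x y <= #|S|%:R.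
Proof.
move=> hx hy; have le : \sum_a (x a - y a) ^+ 2 <= #|S|%:R.
  rewrite -sumr_const; apply: ler_sum => a _; have := hx a; have := hy a.
  move: (x a) (y a) => s t /andP[t0 t1] /andP[s0 s1].
  have : 0 <= (1 - s + t) * (1 + s - t) by apply: mulr_ge0; lra.
  by rewrite expr2; lra.
apply: le_trans (ler_wsqrtr le) _.
have [->|S0] := eqVneq #|S| 0%N; first by rewrite sqrtr0.
rewrite -[X in _ <= X]ger0_norm// -sqrtr_sqr; apply: ler_wsqrtr.
by rewrite expr2 -natrM ler_nat leq_pmulr// lt0n.
Qed.

Lemma pos_vertex i (c : cell (Y i)) (u : coord c -> bool) v : is_vertex v ->
  exists2 w, is_vertex w & pos w i = chart (Y i) c (vtx u).
Proof.
move=> vv; have step k : exists s : {c : cell (Y k) & coord c -> bool},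
    forall E : k = i, chart (Y k) _ (vtx (projT2 s)) =
      eq_rect_r (fun k => Y k : Type) (chart (Y i) c (vtx u)) E.
  have [E|/eqP ki] := eqVneq k i; last first.
    by have [d [w _]] := vertex_corner isof k vv; exists (existT _ d w).
  subst k; exists (existT _ c u) => E.
  by rewrite (Prop_irrelevance E erefl).
have [d [w [dw _]]] := product_corner isof (fun k => projT1 (cid (step k))).
exists (chart X d (vtx w)); first by exists (Corner w).
by rewrite dw (projT2 (cid (step i)) erefl).
Qed.

Lemma far_vertex_type N D i v : is_vertex v -> unbounded (Y i) ->
  (forall d : cell X, #|coord d| <= D)%N ->
  exists2 w, is_vertex w & forall p, epath v p w -> (N <= type_count i p)%N.
Proof.
move=> vv unb bD; pose K : R := (N + D)%:R.
have [z noz] : exists z : Y i, forall l, string_length (pos v i) z l -> K < l.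
  (* Of two points farther apart than [K + K], one is farther than [K] from [pos v i]. *)
  have [x [y xy]] := unb (K + K); apply: contrapT => no.
  have close z : exists2 l, string_length (pos v i) z l & l <= K.
    apply: contrapT => noz; apply: no; exists z => l sl; rewrite ltNge.
    by apply/negP => lK; apply: noz; exists l.
  have [l1 s1 l1K] := close x; have [l2 s2 l2K] := close y.
  move: xy; rewrite ltNge => /negP; apply.
  apply: (@le_trans _ _ (l1 + l2)%:E); last by rewrite lee_fin lerD.
  by apply: ereal_inf_lbound; exists (l1 + l2) => //; exact: string_cat (string_sym s1) s2.
have [c [x [ox Ex]]] := open_cell_cover z.
have [w vw wi] := pos_vertex (c := c) (fun=> false) vv.
exists w => // p vp; have [l lp sl] := pos_string i vp.
have seg : segment_length (pos w i) z (edist (vtx (fun=> false)) x).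
  exists c, (vtx (fun=> false)), x; split=> //; [exact: vtx_cube|exact: open_cubeW].
have := noz _ (string_cat sl (string_cons seg (string_nil _))).
have : edist (vtx (fun=> false)) x <= D%:R :> R.
  apply: le_trans (edist_cube _ _) _; [exact: vtx_cube|exact: open_cubeW|].
  by rewrite ler_nat; exact: factor_dim_bound vv bD.
rewrite /K natrD => h1 h2; rewrite -(ler_nat R); lra.
Qed.

(** The vertex [w] is assembled from the [i]-th coordinates of the vertices [g i], each far in its
    own factor. From any [p] leading to [w], [project_path] and [fiber_path] make a path to [g i]
    with no more edges of type [i]. *)
Lemma far_vertex N D v : is_vertex v -> (forall i, unbounded (Y i)) ->
  (forall d : cell X, #|coord d| <= D)%N ->
  exists2 w, is_vertex w & forall p i, epath v p w -> (N <= type_count i p)%N.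
Proof.
move=> vv unb bD.
have H i : exists w, is_vertex w /\ forall p, epath v p w -> (N <= type_count i p)%N.
  by have [w vw wP] := far_vertex_type N vv (unb i) bD; exists w.
have [g gP] := choice H.
have [w vw wg] := vertex_of isof (fun i => (gP i).1).
exists w => // p i vp; have [s [z [vs _ ss zi _]]] := project_path isof vp vv (erefl (pos v i)).
have vz := epath_vertex0 vs vv.
have [q zq qi] := fiber_path vz (gP i).1 (etrans zi (wg i)).
apply: leq_trans ((gP i).2 _ (epath_cat vs zq)) _.
by rewrite type_count_cat qi add0n -ss; exact: count_size.
Qed.

(** Edges of different types at a vertex span a square, so the last edge of type [i] can be flipped
    past all later ones. *)
Lemma extract_type i v p w : epath v p w -> (0 < type_count i p)%N ->
  exists e q, flips p (e :: q) /\ typed e i.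
Proof.
elim: p w => //= e p IH w [he ew vp]; rewrite /type_count/=.
have [ti _|nti] := pselect (typed e i).
  by exists e, p; split=> //; exact: flips_refl.
rewrite (asboolF nti) add0n => /(IH _ vp)[g [q [pq tg]]].
have [j tj] := edge_typed isof he.
have [hg ge _] := flips_epath pq vp.
have ji : j <> i by move=> ji; apply: nti; rewrite -ji.
have [|f' [e' s]] := typed_square isof tj (typed_erev isof tg) ji.
  by rewrite /erev subr0 ge.
have s' := square_rot (square_sym s); rewrite erevK in s'.
exists (erev f'), (e' :: q); split.
  apply: flips_trans (flips_cons _ pq) _; apply: flips_swap; exact: s'.
exact: (square_typed isof s' tg).
Qed.

Lemma extract_block v p w (J : seq 'I_n) : uniq J -> epath v p w ->
  (forall i, i \in J -> (0 < type_count i p)%N) ->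
  exists b q, flips p (b ++ q) /\ forall i, type_count i b = (i \in J).
Proof.
elim: J p w => [p w _ vp _|i J IH p w /= /andP[iJ uJ] vp pJ].
  by exists [::], p; split=> //; exact: flips_refl.
have [e [q [pq te]]] := extract_type vp (pJ i (mem_head _ _)).
have [_ _ vq] := flips_epath pq vp.
have te' j : `[< typed e j >] = (j == i).
  apply/asboolP/eqP => [tj|->//]; exact: typed_uniq tj te.
have [j jJ|b [q' [qq' bJ]]] := IH q _ uJ vq.
  have := pJ j; rewrite inE jJ orbT => /(_ isT).
  rewrite (flips_type_count j pq) /type_count/= te'.
  by case: eqP => // ji; rewrite -ji jJ in iJ.
exists (e :: b), q'; split; first exact: flips_trans pq (flips_cons _ qq').
move=> j; have := bJ j; rewrite /type_count/= te' inE => ->.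
by case: eqP => // ->; rewrite (negPf iJ).
Qed.

(** [P 0] keeps the surplus edges. All [P k] with [k <= N] begin the same rearranged path, so they
    are reduced when [p] is. *)
Lemma block_path N v p w : epath v p w -> (forall i, (N <= type_count i p)%N) ->
  exists P : nat -> seq (R -> X), flips p (P N) /\
  forall k, (k < N)%N -> exists2 b, P k.+1 = b ++ P k & forall i, type_count i b = 1%N.
Proof.
elim: N p w => [p w vp _|N IH p w vp pN].
  by exists (fun=> p); split=> //; exact: flips_refl.
have [|b [q [pq b1]]] := extract_block (enum_uniq 'I_n) vp.
  by move=> i _; exact: leq_ltn_trans (pN i).
have {}b1 i : type_count i b = 1%N by rewrite b1 mem_enum.
have [z vq zw] := epath_catP (flips_epath pq vp).
have [|P [qP PP]] := IH q z vq.
  by move=> i; have := pN i; rewrite (flips_type_count i pq) type_count_cat b1.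
exists (fun k => if (k <= N)%N then P k else b ++ P N); rewrite ltnn; split.
  apply: flips_trans pq _; elim: (b) => //= e s IHs; exact: flips_cons.
move=> k; rewrite ltnS => kN; rewrite kN; case: ltnP => kN'; first exact: PP.
have -> : k = N by lia.
by exists b.
Qed.

End Diagonal.

(** * The group action *)

Section IntegerPowers.
Variable G : groupType.
Implicit Types (g h : G) (z : int).

Definition zpow g z : G :=
  match z with Posz k => (g ^+ k)%g | Negz k => (g ^- k.+1)%g end.

Lemma zpowS g z : zpow g (z + 1) = (zpow g z * g)%g.
Proof.
case: z => [k|[|k]].
- have -> : Posz k + 1 = Posz k.+1 by lia.
  by rewrite /= expgSr.
- by rewrite /= expg1 mulVg.
have -> : Negz k.+1 + 1 = Negz k by rewrite !NegzE; lia.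
by rewrite /= (expgS g k.+1) invgM mulgVK.
Qed.

Lemma zpowD g (x y : int) : zpow g (x + y) = (zpow g x * zpow g y)%g.
Proof.
elim: y => [|k IH|k IH]; first by rewrite addr0 mulg1.
  by rewrite -addn1 PoszD addrA !zpowS IH mulgA.
apply: (mulIg g); rewrite -zpowS -mulgA -zpowS.
have -> : - k.+1%:Z + 1 = - k%:Z by lia.
by rewrite -IH; congr zpow; lia.
Qed.

Lemma zpow_commute g h (x : int) : commute g h -> commute g (zpow h x).
Proof.
by move=> gh; case: x => k; [exact: commuteX|apply: commuteV; exact: commuteX].
Qed.

Section Action.
Variables (T : Type) (act : G -> T -> T).
Hypotheses (act1 : forall x, act 1%g x = x)
  (actM : forall g h x, act (g * h)%g x = act g (act h x)).

Lemma actK g x : act g^-1%g (act g x) = x.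
Proof. by rewrite -actM mulVg act1. Qed.

Lemma actKV g x : act g (act g^-1%g x) = x.
Proof. by rewrite -actM mulgV act1. Qed.

Definition shift n (u : 'I_n -> int) (i : 'I_n) (z : int) : 'I_n -> int :=
  fun j => u j + (if j == i then z else 0).

Variables (n : nat) (c : 'I_n -> G) (P : ('I_n -> int) -> T) (m : 'I_n -> nat).
Hypotheses (Pinj : injective P) (m0 : forall i, (0 < m i)%N).
Hypothesis cP : forall i u, act (c i) (P u) = P (shift u i (m i)%:Z).
Hypothesis stab : finite_set [set g | act g (P (fun=> 0)) = P (fun=> 0)].

Lemma act_zpow i u z : act (zpow (c i) z) (P u) = P (shift u i (z * (m i)%:Z)).
Proof.
have nat k v : act (c i ^+ k)%g (P v) = P (shift v i (k%:Z * (m i)%:Z)).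
  elim: k => [|k IH]; rewrite ?expg0 ?act1 ?expgS ?actM ?IH ?cP;
    congr P; apply/funext => j; rewrite /shift; case: (j == i); lia.
case: z => k /=; first exact: nat.
rewrite -[RHS](actK (c i ^+ k.+1)%g) nat; congr (act _ (P _)).
by apply/funext => j; rewrite /shift NegzE; case: (j == i); lia.
Qed.

(** The [q k] are commutators of [c j] with powers of [c i]. Translations of the grid commute, so
    the [q k] fix its origin; two of them coincide as the stabilizer is finite, and [q k = q l] says
    that [c i ^+ (l - k)] commutes with [c j]. *)
Lemma commuting_power i j : exists r, (0 < r)%N /\ commute (c i ^+ r)%g (c j).
Proof.
pose q k := ((c j)^-1 * ((c i ^+ k)^-1 * (c j * c i ^+ k)))%g.
have [N pig] := finite_pigeonhole stab.
have [k _|k [l [kl _ qq]]] := pig q.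
  have ci v : act (c i ^+ k)%g (P v) = P (shift v i (k%:Z * (m i)%:Z)).
    exact: (act_zpow i v k).
  have sC : shift (shift (fun=> 0) i (k%:Z * (m i)%:Z)) j (m j)%:Z =
      shift (shift (fun=> 0) j (m j)%:Z) i (k%:Z * (m i)%:Z).
    by apply/funext => a; rewrite /shift; case: (a == i); case: (a == j); lia.
  by rewrite /= /q !actM ci cP sC -ci actK -cP actK.
exists (l - k)%N; split; first by rewrite subn_gt0.
set s := (c i ^+ k)%g in qq *.
have cl : (c i ^+ l = c i ^+ (l - k) * s)%g by rewrite -expgnDr subnK// ltnW.
move: qq; rewrite /q cl -/s; set t := (c i ^+ (l - k))%g => /mulgI.
move=> /(congr1 (fun x => (t * s) * x)%g); rewrite mulVKg -mulgA mulVKg !mulgA.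
exact: mulIg.
Qed.

Theorem grid_free_abelian : has_subgroup_isomorphic_to_Zn G n.
Proof.
have [r rP] := choice (fun ij : 'I_n * 'I_n => commuting_power ij.1 ij.2).
(* A common multiple of all the exponents [r], so that the powers [d i] commute with each other. *)
pose K := (\prod_ij r ij)%N; pose d i := (c i ^+ K)%g.
have K0 : (0 < K)%N by apply: prodn_gt0 => ij; case: (rP ij).
have dd i j : commute (d i) (d j).
  have -> : d i = ((c i ^+ r (i, j)) ^+ (\prod_(ij | ij != (i, j)) r ij))%g.
    by rewrite -expgnA /d /K (bigD1 (i, j)).
  apply: commuteX; apply: commute_sym; apply: commuteX; apply: commute_sym.
  by case: (rP (i, j)).
have actd i z u : act (zpow (d i) z) (P u) = P (shift u i (z * (K * m i)%N%:Z)).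
  have nat k v : act (d i ^+ k)%g (P v) = P (shift v i (k%:Z * (K * m i)%N%:Z)).
    rewrite /d -expgnA (act_zpow i v (K * k)%N); congr P; congr shift.
    by rewrite !PoszM mulrA [Posz k * _]mulrC.
  case: z => k /=; first exact: nat.
  rewrite -[RHS](actK (d i ^+ k.+1)%g) nat; congr (act _ (P _)).
  by apply/funext => j; rewrite /shift NegzE; case: (j == i); lia.
pose f (u : 'rV[int]_n) : G := (\prod_i zpow (d i) (u ord0 i))%g.
have fD : {morph f : u v / u + v >-> (u * v)%g}.
  move=> u v; rewrite /f -prodgM_commute; last first.
    move=> i j *; apply: zpow_commute; apply: commute_sym.
    by apply: zpow_commute; exact: dd.
  by apply: eq_bigr => i _; rewrite mxE zpowD.
have actf (z : 'I_n -> int) (s : seq 'I_n) u :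
    act (\prod_(i <- s) zpow (d i) (z i))%g (P u) =
    P (fun j => u j + \sum_(i <- s) (if j == i then z i * (K * m i)%N%:Z else 0)).
  elim: s => [|i s IH].
    by rewrite big_nil act1; congr P; apply/funext => j; rewrite big_nil addr0.
  rewrite big_cons actM IH actd; congr P; apply/funext => j.
  by rewrite big_cons /shift addrAC addrA.
(* [f u] moves the origin of the grid by [u ord0 j * (K * m j)] in each direction [j], which
   recovers [u]. *)
have fI : injective f.
  move=> u v uv; apply/rowP => j.
  have := actf (fun i => u ord0 i) (index_enum 'I_n) (fun=> 0).
  rewrite -/(f u) uv (actf (fun i => v ord0 i)) => /Pinj/(congr1 (fun F => F j)).
  have one (w : 'rV[int]_n) : \sum_i (if j == i then w ord0 i * (K * m i)%N%:Z else 0) =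
      w ord0 j * (K * m j)%N%:Z.
    rewrite (bigD1 j)//= eqxx big1 ?addr0// => i ij.
    by rewrite eq_sym (negPf ij).
  rewrite !one !add0r => /mulIf -> //.
  by rewrite -lt0n muln_gt0 K0 m0.
have f0 : f 0 = 1%g.
  by apply: (mulgI (f 0)); rewrite -fD addr0 mulg1.
pose S : pred G := fun g => `[< exists u, f u = g >].
have S1 : (1%g : G) \in S by apply/asboolP; exists 0.
have SM g h : g \in S -> h \in S -> (g * h)%g \in S.
  by move=> /asboolP[u <-] /asboolP[v <-]; apply/asboolP; exists (u + v); rewrite fD.
have SV g : g \in S -> (g^-1)%g \in S.
  move=> /asboolP[u <-]; apply/asboolP; exists (- u).
  by apply: (mulgI (f u)); rewrite -fD subrr mulgV.
pose mixV := isInvClosed.Build G S SV.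
pose mix1 := isMul1Closed.Build G S S1.
pose mixM := isMulClosed.Build G S SM.
pose H : groupClosed G := HB.pack S mixV mix1 mixM.
exists H, f; split=> //; split.
- by move=> u _; apply/asboolP; exists u.
- by move=> u v _ _; exact: fI.
- by move=> g /asboolP[u <-]; exists u.
Qed.

End Action.
End IntegerPowers.

(** * From the cocompact action to the grid *)

Section ProductAction.
Context {R : realType} (n : nat) (Y : 'I_n -> cubeComplex R) (X : cubeComplex R).
Variables (f : X -> cube_product Y) (Gamma : groupType) (act : Gamma -> X -> X).
Hypotheses (isof : cubical_iso f) (cat0 : CAT0_cube_complex X).
Hypotheses (lc : locally_compact [set: X]) (cact : cubical_action act).
Hypotheses (pact : proper_action act) (coact : cocompact_action act).
Hypothesis unb : forall i, unbounded (Y i).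
Implicit Types (i j : 'I_n) (p q : seq (R -> X)) (e : R -> X) (v w : X).
Implicit Types (g h : Gamma).

Local Notation last_edges := (last_edges (@square R X)).
Local Notation reduced := (reduced (@erev R X) (@square R X)).
Local Notation pos := (pos f).
Local Notation typed := (typed f).
Local Notation type_count := (type_count f).

Let act1 v : act 1%g v = v. Proof. by case: cact. Qed.
Let actM g h v : act (g * h)%g v = act g (act h v). Proof. by case: cact. Qed.
Let isog g : cubical_iso (act g). Proof. by case: cact. Qed.
Let actgK g v : act g^-1%g (act g v) = v. Proof. exact: actK. Qed.
Let actgKV g v : act g (act g^-1%g v) = v. Proof. exact: actKV. Qed.

Definition move g e : R -> X := act g \o e.

Lemma moveK g e : move g^-1%g (move g e) = e.
Proof. by apply/funext => t; rewrite /move/= actgK. Qed.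

Lemma moveKV g e : move g (move g^-1%g e) = e.
Proof. by apply/funext => t; rewrite /move/= actgKV. Qed.

Lemma moveM g h e : move (g * h)%g e = move g (move h e).
Proof. by apply/funext => t; rewrite /move/= actM. Qed.

Lemma move_edge g e : is_edge e -> is_edge (move g e).
Proof. exact: iso_edge (isog g) e. Qed.

Lemma move_square g e f' e' e'' : square e f' e' e'' ->
  square (move g e) (move g f') (move g e') (move g e'').
Proof. exact: iso_square (isog g) e f' e' e''. Qed.

Lemma vertex_reps : exists2 F : set X, finite_set F &
  (forall v, F v -> is_vertex v) /\ forall v, is_vertex v -> exists g, F (act g v).
Proof.
have [K cK KX] := coact; exists [set v | K v /\ is_vertex v]; first exact: finite_vertices.
split=> [v []//|v vv].
have : (\bigcup_(g in [set: Gamma]) (act g @` K)) v by rewrite KX.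
move=> [g _ [w Kw gw]]; exists g^-1%g; rewrite -gw actgK; split=> //.
by rewrite -[w](actgK g) gw; exact: iso_vertex.
Qed.

Lemma finite_transporter v (B : set X) : finite_set B -> finite_set [set g | B (act g v)].
Proof.
move=> fB; apply: (@sub_finite_set _ _
    [set g | (act g @` (v |` B)) `&` (v |` B) !=set0]).
  by move=> g Bg; exists (act g v); split; [exists v => //; left|right].
by apply: pact; apply: finite_compact; rewrite finite_setU; split=> //; exact: finite_set1.
Qed.

(** A cube has as many distinct edges at a corner as its dimension, and finitely many edges start in
    [F]. *)
Lemma dim_bound : exists D, forall c : cell X, (#|coord c| <= D)%N.
Proof.
have [F fF [Fv Fr]] := vertex_reps.
have fE : finite_set (\bigcup_(v in F) edges_from v).
  by apply: bigcup_finite => // v _; exact: finite_edges_from.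
have [D DP] := finite_card_bound fE; exists D => c.
pose u0 : coord c -> bool := fun=> false.
have [|g Fg] := Fr (chart X c (vtx u0)); first by exists (Corner u0).
apply: (DP _ (fun a => move g (dedge u0 a))) => [a b /(congr1 (move g^-1%g))|a].
  by rewrite !moveK; exact: (dedge_dir_inj cat0.2).
exists (act g (chart X c (vtx u0))) => //; split.
  by apply: move_edge; exists c, u0, a.
by rewrite /move/= dedge0.
Qed.

(** A genuine restriction: an element of [Gamma] may exchange isomorphic factors, or mix the types
    when factors decompose further. *)
Definition preserves_types g := forall e i, typed e i <-> typed (move g e) i.

Lemma preserves_typesM g h :
  preserves_types g -> preserves_types h -> preserves_types (g * h)%g.
Proof. by move=> tg th e i; rewrite moveM -tg -th. Qed.

Lemma preserves_typesV g : preserves_types g -> preserves_types g^-1%g.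
Proof. by move=> tg e i; rewrite (tg (move g^-1%g e)) moveKV. Qed.

Lemma preserves_types1 : preserves_types 1%g.
Proof.
move=> e i; suff -> : move 1%g e = e by [].
by apply/funext => t; rewrite /move/= act1.
Qed.

Lemma preserves_typesX g k : preserves_types g -> preserves_types (g ^+ k)%g.
Proof.
move=> tg; elim: k => [|k IH]; first by rewrite expg0; exact: preserves_types1.
by rewrite expgS; exact: preserves_typesM.
Qed.

Lemma preserves_types_zpow g z : preserves_types g -> preserves_types (zpow g z).
Proof.
move=> tg; case: z => k; first exact: preserves_typesX.
exact/preserves_typesV/preserves_typesX.
Qed.

Definition types_at g v := forall e, edges_from v e -> forall i,
  typed e i <-> typed (move g e) i.

(* A square with sides e and e' at the vertex e 1 has its side opposite to e' at
   e 0, unless e and e' have the same type. *)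
Lemma types_at_step g e : types_at g (e 0) -> is_edge e -> types_at g (e 1).
Proof.
move=> tv he e' [he' e'0].
have [k tk] := edge_typed isof he; have [j tj] := edge_typed isof he'.
have [j' tj'] := edge_typed isof (move_edge g he').
suff jj : j = j'.
  subst j'; move=> i; split=> ti.
    by rewrite (typed_uniq isof ti tj).
  by rewrite (typed_uniq isof ti tj').
have opposite (a a' : R -> X) ka ka' : typed a ka -> typed a' ka' -> a 1 = a' 0 -> ka <> ka' ->
    exists s t, [/\ square a a' s t, s 0 = a 0 & typed s ka'].
  move=> ta ta' aa ne.
  have [|s1 [t1 s]] := typed_square isof (typed_erev isof ta) ta' ne.
    by rewrite /erev subr0.
  have s' := square_rot s; rewrite erevK in s'.
  exists s1, (erev t1); split=> //; first by have [-> _ _ _] := square_ends s'.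
  exact: (square_typedV isof (square_sym s') ta').
have [kj|kj] := pselect (k = j); last first.
  have [s [t [sq s0 ts]]] := opposite _ _ _ _ tk tj (esym e'0) kj.
  have [_ _ hs _] := square_edges sq.
  have ts' := (tv s (conj hs s0) j).1 ts.
  exact: typed_uniq (square_typed isof (square_sym (move_square g sq)) ts') tj'.
(* Here [e] and [e'] have one type, but their images would have two and span a square. Pulled back
   by [g^-1], its side at [e 0] would have the type of [e'] and also that of its image. *)
subst k; apply: contrapT => jj'.
have [s [t [sq s0 ts]]] := opposite _ _ _ _ ((tv e (conj he erefl) j).1 tk) tj'
  (congr1 (act g) (esym e'0)) jj'.
have := move_square g^-1%g sq; rewrite !moveK => sq'.
have [_ _ hs _] := square_edges sq'; have [l tl] := edge_typed isof hs.
have s0' : move g^-1%g s 0 = e 0 by rewrite /move/= s0 /move/= actgK.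
have := (tv _ (conj hs s0') l).1 tl; rewrite moveKV => tsl.
have lj' : l = j' by exact: typed_uniq tsl ts.
have lj : l = j by exact: typed_uniq (square_typed isof (square_sym sq') tl) tj.
by apply: jj'; rewrite -lj lj'.
Qed.

Lemma types_at_preserves g v : is_vertex v -> types_at g v -> preserves_types g.
Proof.
move=> vv tv.
have all w : is_vertex w -> types_at g w.
  move=> vw; have [p vp] := epath_connected cat0.1 vv vw.
  elim: p w vp {vw} => /= [w <-//|e p IH w [he <- /IH te]].
  exact: types_at_step.
have half e i : is_edge e -> typed e i <-> typed (move g e) i.
  move=> he; apply: (all (e 0)) => //.
  by have [c [u [a ->]]] := he; rewrite dedge0; exists (Corner u).
move=> e i; split=> te; first exact: (half e i (typed_edge te)).1.
apply: (half e i _).2 => //; rewrite -[e](moveK g); apply: move_edge.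
exact: typed_edge te.
Qed.

Lemma act_epath g v p w : epath v p w -> epath (act g v) (map (move g) p) (act g w).
Proof. exact: iso_epath (isog g) v p w. Qed.

Lemma move_type_count g i p : preserves_types g ->
  type_count i (map (move g) p) = type_count i p.
Proof.
move=> tg; rewrite /type_count count_map; apply: eq_count => e /=.
by apply/asboolP/asboolP; [exact: (tg e i).2|exact: (tg e i).1].
Qed.

Lemma zero_type_pos i v p w : epath v p w -> type_count i p = 0%N -> pos v i = pos w i.
Proof.
elim: p w => /= [w ->//|e p IH w [he <- vp]]; rewrite /type_count/=.
case: asboolP => // nti /(IH _ vp) ->.
have [j tj] := edge_typed isof he; rewrite (typed_pos tj)//.
by move=> ij; apply: nti; rewrite ij.
Qed.

(** By [fiber_path], a shared [i]-th coordinate means a path without edges of type [i], and [g]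
    preserves such paths: it acts on the vertices of each factor. *)
Lemma preserves_pos g v w i : preserves_types g -> is_vertex v -> is_vertex w ->
  pos v i = pos w i -> pos (act g v) i = pos (act g w) i.
Proof.
move=> tg vv vw vwi; have [p vp p0] := fiber_path isof cat0 vv vw vwi.
by apply: (zero_type_pos (act_epath g vp)); rewrite move_type_count.
Qed.

(** By [last_edges_cons] a continuation stays reduced or not according to the set of last edges
    only, so [q] can be moved from [p] to any reduced [p'] in the translated state. *)
Lemma reduced_move g p p' q : last_edges p' = move g @` last_edges p ->
  reduced p' -> reduced (q ++ p) ->
  reduced (map (move g) q ++ p') /\
  last_edges (map (move g) q ++ p') = move g @` last_edges (q ++ p).
Proof.
move=> lp rp'; elim: q => [_|e q IH /= [rq ne]]; first by split.
have {IH} [rq' lq] := IH rq; split.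
  split=> //; rewrite lq => -[a la ga]; apply: ne.
  suff <- : a = erev e by [].
  by rewrite -[a](moveK g) ga -[RHS](moveK g).
apply/seteqP; split=> x.
  move=> /(last_edges_consX cat0)[->|[a' + [b s]]].
    by exists e => //; apply/(last_edges_consX cat0); left.
  rewrite lq => -[a la ga]; exists (move g^-1%g x); last exact: moveKV.
  apply/(last_edges_consX cat0); right; exists a => //.
  by exists (move g^-1%g b); have := move_square g^-1%g s; rewrite -ga !moveK.
move=> [y /(last_edges_consX cat0)[->|[a la [b s]]] <-]; apply/(last_edges_consX cat0).
  by left.
right; exists (move g a); first by rewrite lq; exists a.
by exists (move g b); exact: move_square.
Qed.

Section Recurrence.
Variables (F : set X) (gv : X -> Gamma).
Hypotheses (fF : finite_set F) (gvF : forall v, is_vertex v -> F (act (gv v) v)).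

(** The state at [v], brought to [F] by [gv v]: the representative, the last edges [S], and the
    types of the edges at [v]. Through [types_at_preserves] the last component makes the element
    relating two equal states preserve types. *)
Definition local_data v (S : set (R -> X)) : X * set (R -> X) * set ((R -> X) * 'I_n) :=
  (act (gv v) v, move (gv v) @` S,
   [set ei | exists2 e, edges_from v e & typed e ei.2 /\ ei.1 = move (gv v) e]).

Definition all_data : set (X * set (R -> X) * set ((R -> X) * 'I_n)) :=
  [set d | [/\ F d.1.1, d.1.2 `<=` (@erev R X) @` (\bigcup_(v in F) edges_from v) &
    d.2 `<=` (\bigcup_(v in F) edges_from v) `*` setT]].

Lemma finite_all_data : finite_set all_data.
Proof.
have fE : finite_set (\bigcup_(v in F) edges_from v).
  by apply: bigcup_finite => // v _; exact: finite_edges_from.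
apply: (@sub_finite_set _ _ ((F `*` [set B | B `<=` (@erev R X) @` (\bigcup_(v in F) edges_from v)])
  `*` [set B | B `<=` (\bigcup_(v in F) edges_from v) `*` setT])).
  by move=> [[a b] c] /= [? ? ?].
apply: finite_setX; first apply: finite_setX => //; apply: finite_subsets.
  exact: finite_image.
by apply: finite_setX => //; exact: finite_finset.
Qed.

Lemma local_data_all v S : is_vertex v -> (forall e, S e -> is_edge e /\ e 1 = v) ->
  all_data (local_data v S).
Proof.
move=> vv Sv; split=> /=; first exact: gvF.
  move=> _ [e /Sv[he ev] <-]; exists (erev (move (gv v) e)); last exact: erevK.
  exists (act (gv v) v); [exact: gvF|split; first exact/erev_edge/move_edge].
  by rewrite /erev /move/= subr0 ev.
move=> [_ i] /= [e [he ev] [_ ->]]; split=> //.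
exists (act (gv v) v); first exact: gvF.
by split; [exact: move_edge|rewrite /move/= ev].
Qed.

Lemma local_data_eq v w S S' (h := ((gv w)^-1 * gv v)%g) : is_vertex v -> is_vertex w ->
  local_data v S = local_data w S' ->
  [/\ act h v = w, move h @` S = S' & preserves_types h].
Proof.
move=> vv vw [E1 E2 E3].
have hv : act h v = w by rewrite /h actM E1 actgK.
have mh e : move h e = move (gv w)^-1%g (move (gv v) e) by rewrite -moveM.
split=> //.
  have -> : move h = move (gv w)^-1%g \o move (gv v) by apply/funext => e; exact: mh.
  rewrite -image_comp E2 image_comp; apply/seteqP; split=> [_ [e Se <-]|e Se].
    by rewrite /= moveK.
  by exists e => //=; rewrite moveK.
apply: (types_at_preserves vv) => e [he ev] i; split=> te.
  have : [set ei | exists2 e, edges_from v e & typed e ei.2 /\ ei.1 = move (gv v) e]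
      (move (gv v) e, i) by exists e.
  rewrite E3 => -[e' [he' ew'] [/= te' Ee']].
  by rewrite mh Ee' moveK.
have : [set ei | exists2 e, edges_from w e & typed e ei.2 /\ ei.1 = move (gv w) e]
    (move (gv v) e, i).
  exists (move h e); last by split=> //; rewrite mh moveKV.
  by split; [exact: move_edge|rewrite /move/= ev].
rewrite -E3 => -[e' _ [/= te' /(congr1 (move (gv v)^-1%g))]].
by rewrite !moveK => ->.
Qed.

(* A translation in the direction of every factor at once: the type-preserving
   element found by pigeonhole along a path cut into blocks maps the state (last
   vertex, last edges) of one prefix to that of a longer one, so that the path
   between them has reduced translates which concatenate to reduced paths. *)
Lemma diagonal_translation v0 : is_vertex v0 -> exists g v,
  [/\ is_vertex v, preserves_types g &
    forall i a b, (a < b)%N -> pos (act (g ^+ a)%g v) i <> pos (act (g ^+ b)%g v) i].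
Proof.
move=> vv0; have [D DP] := dim_bound.
have [N pig] := finite_pigeonhole finite_all_data.
have [w vw far] := far_vertex isof cat0 N vv0 unb DP.
have [p vp rp] := reduced_path cat0 vv0 vw.
have [P [pP blocks]] := block_path isof vp (fun i => far p i vp).
have good k : (k <= N)%N -> exists x, epath v0 (P k) x /\ reduced (P k).
  move=> kN; have [d ->] : exists d, k = (N - d)%N by exists (N - k)%N; rewrite subKn.
  elim: d {kN} => [|d [x [ex rx]]].
    by rewrite subn0; exists w; split; [exact: flips_epath pP vp|exact: (flips_reducedX cat0) rp].
  have [dN|dN] := leqP N d.
    have Ed : (N - d.+1 = N - d)%N by lia.
    by rewrite Ed; exists x.
  have [|b Pb _] := blocks (N - d.+1)%N; first by lia.
  move: ex rx; have -> : (N - d = (N - d.+1).+1)%N by lia.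
  rewrite Pb => /epath_catP[z ez _] /reduced_suffix rz.
  by exists z.
have step k : exists x, (k <= N)%N -> epath v0 (P k) x /\ reduced (P k).
  by have [kN|] := leqP k N; [have [x ex] := good k kN; exists x|exists v0].
have [x xP] := choice step.
have [k kN|k [l [kl lN E]]] := pig (fun k => local_data (x k) (last_edges (P k))).
  have [ex _] := xP k kN; apply: local_data_all; first exact: epath_vertex0 ex vv0.
  by move=> e [q Pq]; have [he e1 _] := flips_epath Pq ex.
have kN : (k <= N)%N by lia.
have [exk rk] := xP k kN; have [exl rl] := xP l lN.
have vk := epath_vertex0 exk vv0; have vl := epath_vertex0 exl vv0.
have [hx hS th] := local_data_eq vk vl E.
set h := (_ * _)%g in hx hS th; clearbody h.
have [c Pc cc] : exists2 c, P l = c ++ P k & forall i, type_count i c = (l - k)%N.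
  move: (lN) (kl); have [d ->] : exists d, l = (k + d)%N by exists (l - k)%N; lia.
  elim: d => [|d IH] kdN kd; first by exists [::]; rewrite ?addn0 // => i; rewrite subnn.
  have [d0|d0] := eqVneq d 0%N.
    have [|b Pb b1] := blocks k; first by lia.
    exists b; rewrite d0 ?addn1// => i; rewrite b1; lia.
  have [c Pc cc] : exists2 c, P (k + d)%N = c ++ P k & forall i, type_count i c = (k + d - k)%N.
    by apply: IH; lia.
  have [|b Pb b1] := blocks (k + d)%N; first by lia.
  exists (b ++ c); first by rewrite addnS Pb Pc catA.
  by move=> i; rewrite type_count_cat b1 cc; lia.
(* [P k], then [c] and its translates by the powers of [h]. As [h] maps the state at the end of
   [P k] to that at the end of [c ++ P k], each translate continues the previous one. *)
pose W := fix W m := if m is m'.+1 then map (move (h ^+ m')%g) c ++ W m' else P k.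
have WP m : [/\ epath v0 (W m) (act (h ^+ m)%g (x k)), reduced (W m),
    last_edges (W m) = move (h ^+ m)%g @` last_edges (P k) &
    forall i, type_count i (W m) = (type_count i (P k) + m * (l - k))%N].
  elim: m => [|m [em rm lm cm]].
    split=> //=; first by rewrite expg0 act1.
      rewrite expg0; apply/seteqP; split=> [e le|_ [e le <-]].
        by exists e => //; apply/funext => t; rewrite /move/= act1.
      by suff -> : move 1%g e = e by []; apply/funext => t; rewrite /move/= act1.
    by move=> i; rewrite mul0n addn0.
  have ec : epath (x k) c (x l).
    by have := exl; rewrite Pc => /epath_catP[z /epath_end/(_ exk) ->].
  have [|rc lc'] := reduced_move lm rm (q := c); first by rewrite -Pc.
  split=> //=.
  - apply: epath_cat em _; rewrite expgSr actM hx; exact: act_epath.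
  - rewrite lc' -Pc -hS; apply/seteqP; split.
      move=> _ [_ [e le <-] <-]; exists e => //.
      by rewrite expgSr moveM.
    move=> _ [e le <-]; exists (move h e); first by exists e.
    by rewrite expgSr moveM.
  - by move=> i; rewrite type_count_cat move_type_count ?cc ?cm; [lia|exact: preserves_typesX].
(* With a common [i]-th coordinate, [W a] and a path without edges of type [i] would reach the end
   of [W b] with fewer edges of type [i] than the reduced path [W b]. *)
exists h, (x k); split=> // i a b ab E'.
have [ea ra _ ca] := WP a; have [eb rb _ cb] := WP b.
have [s es s0] := fiber_path isof cat0 (epath_vertex0 ea vv0) (epath_vertex0 eb vv0) E'.
have := homotopic_type_count isof cat0 i (epath_homotopic_loop
  (fun x s => epath_loop_homotopic cat0.1) (epath_cat ea es) eb) rb.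
rewrite type_count_cat s0 add0n ca cb leq_add2l leq_mul2r; lia.
Qed.

Section Flat.
Variables (g : Gamma) (p : X).
Hypotheses (vp : is_vertex p) (tg : preserves_types g).
Hypothesis disp : forall i a b, (a < b)%N -> pos (act (g ^+ a)%g p) i <> pos (act (g ^+ b)%g p) i.

Definition axis (z : int) : X := act (zpow g z) p.

Lemma axisD x y : act (zpow g x) (axis y) = axis (x + y).
Proof. by rewrite /axis -actM zpowD. Qed.

Lemma axis_vertex z : is_vertex (axis z).
Proof. exact: iso_vertex. Qed.

Lemma axis_inj i x y : pos (axis x) i = pos (axis y) i -> x = y.
Proof.
have lt (a b : int) : (a < b)%R -> pos (axis a) i <> pos (axis b) i.
  (* A translation by the power |a| of [g] makes both exponents natural numbers, as [disp]
     requires. *)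
  move=> ab /(preserves_pos (preserves_types_zpow `|a|%N tg) (axis_vertex a) (axis_vertex b)).
  rewrite !axisD; have [m Em] : exists m : nat, `|a|%N%:Z + a = m by exists (absz (Posz (absz a) + a)); lia.
  have [m' Em'] : exists m : nat, `|a|%N%:Z + b = m by exists (absz (Posz (absz a) + b)); lia.
  by rewrite Em Em'; apply: disp; lia.
by move=> E; have [/lt//|/lt/nesym//|//] := ltgtP x y.
Qed.

Lemma flat_ex (u : 'I_n -> int) :
  exists v, is_vertex v /\ forall i, pos v i = pos (axis (u i)) i.
Proof.
have [v vv vE] := vertex_of isof (fun i => axis_vertex (u i)).
by exists v.
Qed.

Definition flat u : X := projT1 (cid (flat_ex u)).

Lemma flat_vertex u : is_vertex (flat u).
Proof. by have [] := projT2 (cid (flat_ex u)). Qed.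

Lemma pos_flat u i : pos (flat u) i = pos (axis (u i)) i.
Proof. by have [_ +] := projT2 (cid (flat_ex u)); exact. Qed.

Lemma flat_inj : injective flat.
Proof.
move=> u u' E; apply/funext => i; apply: (@axis_inj i).
by rewrite -!pos_flat E.
Qed.

Lemma flat_eq v u : (forall i, pos v i = pos (axis (u i)) i) -> v = flat u.
Proof. by move=> vu; apply: (pos_inj isof) => i; rewrite vu pos_flat. Qed.

(** Translates by [zpow g (u j)] of one path [c] from [p] to its image under [g] are spliced. They
    preserve types, so the length is the same at all points of the grid. *)
Lemma flat_displacement : exists L, forall i (k : nat), exists2 s,
  epath (flat (shift (fun=> 0) i k)) s (act g (flat (shift (fun=> 0) i k))) & (size s <= L)%N.
Proof.
have [c pc] := epath_connected cat0.1 vp (iso_vertex (isog g) vp).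
exists (\sum_j type_count j c)%N => i k.
set u := shift _ i k.
have [|||s [es ss _]] := @splice_paths _ _ _ _ _ isof (fun j => axis (u j))
  (fun j => act g (axis (u j))) (fun j => map (move (zpow g (u j))) c) (flat u) (act g (flat u)) _
  (flat_vertex u).
- move=> j; have -> : act g (axis (u j)) = act (zpow g (u j)) (act g p).
    by rewrite /axis -!actM (zpow_commute _ (commute_refl g)).
  exact: act_epath.
- by move=> j; rewrite pos_flat.
- move=> j; apply: preserves_pos => //; [exact: flat_vertex|exact: axis_vertex|].
  exact: pos_flat.
exists s => //; rewrite ss; apply: leq_sum => j _.
by rewrite move_type_count//; exact: preserves_types_zpow.
Qed.

(* The conjugates of g by elements bringing the points of a coordinate axis of the
   flat back to F have bounded displacement on F: finitely many elements occur. *)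
Lemma centralizing_translation i : exists (c : Gamma) (m : nat), (0 < m)%N /\
  forall u, act c (flat u) = flat (shift u i m).
Proof.
have [L LP] := flat_displacement.
pose B := \bigcup_(r in F) [set h | [set w | exists2 q, epath r q w & (size q <= L)%N] (act h r)].
have fB : finite_set B.
  by apply: bigcup_finite => // r _; apply: finite_transporter; exact: finite_reach.
have [N pig] := finite_pigeonhole (finite_setX finite_all_data fB).
pose v (k : nat) := flat (shift (fun=> 0) i k).
have vv k : is_vertex (v k) by exact: flat_vertex.
(* The state, with an empty set of last edges, is paired with the conjugate of [g] that moves the
   representative of [v k] by at most [L] edges. *)
have [k _|k [l [kl _ EE]]] := pig (fun k => (local_data (v k) set0,
    gv (v k) * g * (gv (v k))^-1)%g).
  split; first exact: local_data_all.
  exists (act (gv (v k)) (v k)); first exact: gvF.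
  have [s vs sL] := LP i k.
  exists (map (move (gv (v k))) s); last by rewrite size_map.
  by rewrite /= !actM actgK; exact: act_epath.
have Eg := congr1 snd EE; rewrite /= in Eg.
have [hv _ th] := local_data_eq (vv k) (vv l) (congr1 fst EE).
set h := (_ * _)%g in hv th.
(* The conjugates of [g] by [gv (v k)] and [gv (v l)] are equal, hence [h] centralizes [g]. *)
have hg : commute h g.
  apply: (mulgI (gv (v l))); rewrite /h !mulgA mulgV mul1g.
  apply: (mulIg (gv (v k))^-1%g); rewrite Eg -!mulgA mulgV mulg1; congr (_ * (_ * _))%g.
clearbody h; exists h, (l - k)%N; split; first by rewrite subn_gt0.
have hz z w : act h (act (zpow g z) w) = act (zpow g z) (act h w).
  by rewrite -!actM (zpow_commute _ hg).
have hpos z w w' j : is_vertex w -> is_vertex w' -> pos w j = pos w' j ->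
    pos (act (zpow g z) w) j = pos (act (zpow g z) w') j.
  by apply: preserves_pos; exact: preserves_types_zpow.
move=> u; apply: flat_eq => j.
rewrite (preserves_pos th (flat_vertex u) (axis_vertex (u j)) (pos_flat u j)).
have ha z : pos (v k) j = pos (axis z) j -> pos (act h (axis z)) j = pos (v l) j.
  by move=> vz; rewrite -hv; apply: preserves_pos => //; exact: axis_vertex.
(* Off the direction [i], both [v k] and [v l] have the coordinate of [p], which [h] therefore
   fixes, together with its translates by powers of [g]. *)
rewrite [in RHS]/shift; have [Ej|ji] := eqVneq j i; last first.
  rewrite addr0 hz -[X in pos X j]/(act _ (act h p)).
  apply: hpos => //; first exact: iso_vertex.
  have p0 : p = axis 0 by rewrite /axis /= expg0 act1.
  by rewrite {1}p0 ha ?pos_flat /shift (negPf ji) addr0// -p0.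
subst j.
(* In the direction [i], [h] takes the coordinate of [axis k] to that of [axis l]; commuting with
   [g], it shifts the whole axis by [l - k]. *)
have -> : axis (u i) = act (zpow g (u i - k%:Z)) (axis k) by rewrite axisD subrK.
have -> : axis (u i + (l - k)%N%:Z) = act (zpow g (u i - k%:Z)) (axis l).
  by rewrite axisD; congr axis; lia.
have vi m : pos (v m) i = pos (axis m) i by rewrite pos_flat /shift eqxx add0r.
rewrite hz; apply: hpos; [exact/iso_vertex/axis_vertex|exact: axis_vertex|].
by rewrite -vi; apply: ha; exact: vi.
Qed.

End Flat.
End Recurrence.

Theorem free_abelian_subgroup : has_subgroup_isomorphic_to_Zn Gamma n.
Proof.
have [F fF [_ Fr]] := vertex_reps.
have [x0 _] : [set: X] !=set0 by case: cat0 => -[].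
have [c0 _] := open_cell_cover x0.
pose u0 : coord c0 -> bool := fun=> false.
have v0 : is_vertex (chart X c0 (vtx u0)) by exists (Corner u0).
have step v : exists g, is_vertex v -> F (act g v).
  by have [/Fr[g Fg]|] := pselect (is_vertex v); [exists g|exists 1%g].
have [gv gvF] := choice step.
have [g [p [vp tg disp]]] := diagonal_translation fF gvF v0.
have [c cP] := choice (centralizing_translation fF gvF vp tg).
have [m mP] := choice cP.
have m0 i := (mP i).1; have cm i := (mP i).2.
have flatI : injective (flat g vp) by exact: flat_inj.
apply: (grid_free_abelian act1 actM flatI m0 cm).
exact: (finite_transporter _ (finite_set1 (flat g vp (fun=> 0)))).
Qed.

End ProductAction.

Theorem corollary4 (R : realType) (X : cubeComplex R) (Gamma : groupType)
    (act : Gamma -> X -> X) (n : nat) (Y : 'I_n -> cubeComplex R) :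
  CAT0_cube_complex X -> locally_compact [set: X] ->
  cubical_action act -> proper_action act -> cocompact_action act ->
  (forall i, unbounded (Y i)) ->
  (exists f : X -> cube_product Y, cubical_iso f) ->
  has_subgroup_isomorphic_to_Zn Gamma n.
Proof.
move=> cat0 lc cact pact coact unb [f isof].
exact: free_abelian_subgroup isof cat0 lc cact pact coact unb.
Qed.
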